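(* Let $u^0\in V$ with $\|u^0\|=1$, let $\sigma\ge\frac43E(u^0)$ and assume $W(x)\ge\Omega^2|x|^2$ in $\mathcal{D}$. Then there exists a $\tau^*>0$ (that only depends on $u^0$ and its energy) such that for all $0<\tau_n\le\tau^*$ the sequence $(u^n)$ obtained by the damped $J$-method $$\tilde u^{n+1}=(1-\tau_n)u^n+\tau_n\gamma_nJ_\sigma(u^n)^{-1}\mathcal{I}u^n,\qquad u^{n+1}=\frac{\tilde u^{n+1}}{\|\tilde u^{n+1}\|},\qquad\gamma_n^{-1}:=(J_\sigma(u^n)^{-1}\mathcal{I}u^n,u^n)_H,$$ is well-posed and strictly energy diminishing for all $n$, i.e. it holds $$E(u^{n+1})\le E(u^n)\le E(u^0),$$ where $E(u^{n+1})<E(u^n)$ if $u^n$ is not already a critical point of $E$ (on the manifold $\{v\in V:\|v\|=1\}$) and thus an eigenstate, i.e. if $u^n$ is not already a solution of $\mathcal{A}(u^n)=\lambda\mathcal{I}u^n$ for some $\lambda\in\mathbb{R}$.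
   Context: $\mathcal{D}\subset\mathbb{R}^d$ ($d=2,3$) is a bounded domain. $H=L^2(\mathcal{D},\mathbb{C})$ and $V=H^1_0(\mathcal{D},\mathbb{C})$ are regarded as real Hilbert spaces with inner products $(v,w)_H=\Re\int_{\mathcal{D}}v\overline{w}\,dx$ and $(v,w)_V=\Re\int_{\mathcal{D}}\nabla v\cdot\overline{\nabla w}\,dx$; $\|\cdot\|$ is the $L^2(\mathcal{D})$-norm, $V^*$ is the real dual of $V$, and $\mathcal{I}\colon V\to V^*$ is $\langle\mathcal{I}u,\cdot\rangle=(u,\cdot)_H$. Data (fixed): $W\in L^\infty(\mathcal{D},\mathbb{R})$ non-negative, $\Omega\in\mathbb{R}$, $\kappa\ge0$. Put $W_R(x)=W(x)-\frac14\Omega^2|x|^2$ and $\nabla_R v=\nabla v+\mathrm{i}\frac{\Omega}{2}R^\top v$ with $R(x,y)=(y,-x)$ if $d=2$ and $R(x,y,z)=(y,-x,0)$ if $d=3$. The Gross-Pitaevskii operator is $\mathcal{A}(u)=A(u,u)$ with $$\langle A(u,v),w\rangle=\Re\Big(\int_{\mathcal{D}}\nabla_R v\cdot\overline{\nabla_R w}+W_R v\overline{w}\,dx+\frac{\kappa}{\|u\|^2}\int_{\mathcal{D}}|u|^2v\overline{w}\,dx\Big),$$ the energy is $E(u)=\frac12\int_{\mathcal{D}}|\nabla_Ru|^2+W_R|u|^2+\frac{\kappa}{2}|u|^4\,dx$, and $J(u)\colon V\to V^*$ is the real-Fréchet derivative of $\mathcal{A}$ at $u\neq0$, explicitly $$\langle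 J(u)v,w\rangle=\Re\Big(\int_{\mathcal{D}}\nabla_R v\cdot\overline{\nabla_R w}+W_Rv\overline{w}\,dx+\frac{\kappa}{\|u\|^2}\int_{\mathcal{D}}(u\overline{v}+2v\overline{u})u\overline{w}\,dx-\frac{2\kappa(u,v)_H}{\|u\|^4}\int_{\mathcal{D}}|u|^2u\overline{w}\,dx\Big),$$ with $J_\sigma(u)=J(u)+\sigma\mathcal{I}$ for $\sigma\in\mathbb{R}$. Well-posedness means that all $J_\sigma(u^n)$ are invertible and all quantities in the iteration are well-defined. *)

(* Defs.v *)
From HB Require Import structures.
From mathcomp Require Import all_boot all_order all_algebra.
From mathcomp Require Import complex.
From mathcomp Require Import all_classical all_reals all_analysis.

Set Implicit Arguments.
Unset Strict Implicit.
Unset Printing Implicit Defensive.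

Import Order.TTheory GRing.Theory Num.Theory.
Import numFieldNormedType.Exports.

Local Open Scope classical_set_scope.
Local Open Scope ring_scope.
Local Open Scope complex_scope.

(* 'rV[R]_n carries the product of the Borel sigma-algebras of R, as
   n.-tuple T does in the library; this is the Borel sigma-algebra of R^n.
   Elements of Lebesgue spaces are represented by Borel functions. *)
Definition rV_display : measure_display. Proof. exact: default_measure_display. Qed.

Section measurable_rV.
Context {R : realType}.
Variable n : nat.

Let coor : 'I_n -> 'rV[R]_n -> R := fun i x => x ord0 i.

Let rV_set0 : g_sigma_preimage coor set0.
Proof. exact: sigma_algebra0. Qed.

Let rV_setC A : g_sigma_preimage coor A -> g_sigma_preimage coor (~` A).
Proof. exact: sigma_algebraC. Qed.

Let rV_bigcup (F : _^nat) : (forall i, g_sigma_preimage coor (F i)) ->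
  g_sigma_preimage coor (\bigcup_i (F i)).
Proof. exact: sigma_algebra_bigcup. Qed.

HB.instance Definition _ := @isMeasurable.Build rV_display
  'rV[R]_n (g_sigma_preimage coor) rV_set0 rV_setC rV_bigcup.

Lemma measurable_coor (i : 'I_n) : measurable_fun setT (coor i).
Proof.
move=> _ Y mY; rewrite setTI; apply: sub_sigma_algebra => /=.
rewrite -bigcup_seq/=; exists i => /=; first by rewrite mem_index_enum.
by exists Y => //; rewrite setTI.
Qed.

Lemma measurable_fun_rVP d (T : measurableType d) (f : T -> 'rV[R]_n) :
  (forall i, measurable_fun setT (fun x => f x ord0 i)) -> measurable_fun setT f.
Proof.
move=> mf.
have H : g_sigma_preimage (fun i => coor i \o f) `<=` measurable.
  apply: smallest_sub; first exact: sigma_algebra_measurable.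
  rewrite -bigcup_seq => A [i _] [B mB <-].
  exact: mf.
by move: H; rewrite g_sigma_preimage_comp => H _ A mA; apply: H; exists A.
Qed.

End measurable_rV.

Section lebesgue_rV.
Context {R : realType}.

Definition cons_rV n (p : R * 'rV[R]_n) : 'rV[R]_n.+1 :=
  row_mx (p.1)%:M p.2.

Definition uncons_rV n (v : 'rV[R]_n.+1) : R * 'rV[R]_n :=
  (v ord0 ord0, @rsubmx R 1 1 n v).

Lemma measurable_cons_rV n : measurable_fun setT (@cons_rV n).
Proof.
apply: measurable_fun_rVP => i; rewrite /cons_rV.
have [j ->|j ->] := @split_ordP 1 n i.
  rewrite (_ : (fun _ => _) = fst); first exact: measurable_fst.
  apply/funext => x; apply: etrans (@row_mxEl R 1 1 n _ _ _ _) _.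
  by rewrite [j]ord1 mxE.
rewrite (_ : (fun _ => _) = (fun v : 'rV[R]_n => v ord0 j) \o snd).
  apply: measurableT_comp; [exact: measurable_coor|exact: measurable_snd].
by apply/funext => x; exact: (@row_mxEr R 1 1 n).
Qed.

Lemma measurable_uncons_rV n : measurable_fun setT (@uncons_rV n).
Proof.
apply: measurable_fun_pair; first exact: measurable_coor.
apply: measurable_fun_rVP => i.
rewrite (_ : (fun _ => _) = (fun v : 'rV[R]_n.+1 => v ord0 (rshift 1 i))).
  exact: measurable_coor.
by apply/funext => x; rewrite mxE.
Qed.

Lemma cons_rVK n : cancel (@cons_rV n) (@uncons_rV n).
Proof.
move=> [a v]; rewrite /uncons_rV /cons_rV row_mxKr/=; congr pair.
rewrite (_ : ord0 = lshift n (ord0 : 'I_1)); last exact/val_inj.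
by apply: etrans (@row_mxEl R 1 1 n _ _ _ _) _; rewrite mxE.
Qed.

Lemma uncons_rVK n : cancel (@uncons_rV n) (@cons_rV n).
Proof.
move=> v; rewrite /uncons_rV /cons_rV /=.
apply: etrans _ (@hsubmxK R 1 1 n v); congr (@row_mx R 1 1 n _ _).
by apply/matrixP => i j; rewrite !mxE !ord1; congr (v _ _); apply/val_inj.
Qed.

Section cons_measure.
Variables (n : nat) (m : {sigma_finite_measure set 'rV[R]_n -> \bar R}).

(* Lebesgue measure on R * 'rV_n transported to 'rV_n.+1. *)
Definition cons_measure : set 'rV[R]_n.+1 -> \bar R :=
  pushforward (@lebesgue_measure R \x m)%E (@cons_rV n).

Let cons_measure0 : cons_measure set0 = 0%E.
Proof. by rewrite /cons_measure /pushforward preimage_set0 measure0. Qed.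

Let cons_measure_ge0 A : (0 <= cons_measure A)%E.
Proof. exact: (measure_ge0 (@lebesgue_measure R \x m)%E). Qed.

Let cons_measure_sigma_additive : semi_sigma_additive cons_measure.
Proof.
move=> F mF tF mUF; rewrite /cons_measure /pushforward preimage_bigcup.
apply: measure_semi_sigma_additive.
- by move=> k; rewrite -[X in measurable X]setTI; exact: measurable_cons_rV.
- apply/trivIsetP => /= i j _ _ ij; rewrite -preimage_setI.
  by move/trivIsetP : tF => /(_ _ _ _ _ ij) ->//; rewrite preimage_set0.
- by rewrite -preimage_bigcup -[X in measurable X]setTI; exact: measurable_cons_rV.
Qed.

HB.instance Definition _ := isMeasure.Build _ _ _ cons_measure
  cons_measure0 cons_measure_ge0 cons_measure_sigma_additive.

Let cons_measure_sigma_finite : sigma_finite setT cons_measure.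
Proof.
have /sigma_finiteP[F [TF ndF Foo]] := sigma_finiteT (@lebesgue_measure R).
have /sigma_finiteP[G [TG ndG Goo]] := sigma_finiteT m.
exists (fun k => @uncons_rV n @^-1` (F k `*` G k)).
  rewrite -preimage_bigcup -[LHS](preimage_setT (@uncons_rV n)); congr (_ @^-1` _).
  apply/seteqP; split => // -[x y] _.
  have [k _ Fkx] : (\bigcup_k F k) x by rewrite -TF.
  have [l _ Gly] : (\bigcup_k G k) y by rewrite -TG.
  exists (maxn k l) => //; split => /=.
    by move: x Fkx; exact/subsetPset/ndF/leq_maxl.
  by move: y Gly; exact/subsetPset/ndG/leq_maxr.
move=> k; have [mF Fkoo] := Foo k; have [mG Gkoo] := Goo k; split.
  rewrite -[X in measurable X]setTI; apply: measurable_uncons_rV => //.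
  exact: measurableX.
rewrite /cons_measure /pushforward -comp_preimage.
rewrite (_ : _ \o _ = id) ?preimage_id; last first.
  by apply/funext => p /=; rewrite cons_rVK.
by rewrite product_measure1E// lte_mul_pinfty// ge0_fin_numE.
Qed.

HB.instance Definition _ := Measure_isSigmaFinite.Build _ _ _ cons_measure
  cons_measure_sigma_finite.

End cons_measure.

Fixpoint lebesgue_rV n : {sigma_finite_measure set 'rV[R]_n -> \bar R} :=
  if n is k.+1 then cons_measure (lebesgue_rV k) else \d_(0 : 'rV[R]_0).

End lebesgue_rV.

Section spaces.
Context {R : realType} {d : nat}.
Local Notation Rd := 'rV[R]_d.
Local Notation Cfun := ('rV[R]_d -> R[i]).
Local Notation mu := (@lebesgue_rV R d).
Implicit Types (D : set Rd) (u v w f g phi : Cfun).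

Definition Cintegral D f : R[i] :=
  (\int[mu]_(x in D) complex.Re (f x)) +i* (\int[mu]_(x in D) complex.Im (f x)).

Definition cmod (z : R[i]) : R := Normc.normc z.

Definition sqnorm (x : Rd) : R := \sum_(i < d) x ord0 i ^+ 2.

(* Elements of L^2(D, C) and of its subspaces are represented by functions whose
   values outside D are irrelevant; equality in these spaces is eqae D. *)

Definition eqae D u v := u = v %[ae mu in D].

Definition Cmeasurable D f :=
  measurable_fun D (fun x => complex.Re (f x)) /\
  measurable_fun D (fun x => complex.Im (f x)).

Definition L2space D f :=
  Cmeasurable D f /\ mu.-integrable D (fun x => (cmod (f x) ^+ 2)%:E).

Definition Hinner D v w : R := complex.Re (Cintegral D (fun x => v x * (w x)^*%C)).

Definition Hnorm D v : R := Num.sqrt (Hinner D v v).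

Definition partial (j : 'I_d) (f : Rd -> R) : Rd -> R :=
  fun x => 'D_(delta_mx ord0 j) f x.

(* all iterated partial derivatives are differentiable, hence continuous *)
Definition smooth (f : Rd -> R) :=
  forall (s : seq 'I_d) (x : Rd), differentiable (foldr partial f s) x.

Definition Cpartial (j : 'I_d) phi : Cfun := fun x =>
  partial j (fun y => complex.Re (phi y)) x +i*
  partial j (fun y => complex.Im (phi y)) x.

(* C_c^oo(D, C), each function being extended by 0 outside D *)
Definition test_function D phi :=
  [/\ smooth (fun x => complex.Re (phi x)), smooth (fun x => complex.Im (phi x)) &
    exists K : set Rd,
      [/\ compact K, K `<=` D & forall x, ~ K x -> phi x = 0]].

Definition weak_partial D (j : 'I_d) u g :=
  forall phi, test_function D phi ->
    Cintegral D (fun x => u x * Cpartial j phi x) =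
    - Cintegral D (fun x => g x * phi x).

Definition H1space D u :=
  L2space D u /\ forall j, exists g, L2space D g /\ weak_partial D j u g.

(* well-defined up to eqae D when u is in H1space D *)
Definition grad D u (j : 'I_d) : Cfun :=
  xget (fun=> 0) [set g | L2space D g /\ weak_partial D j u g].

Definition Vinner D v w : R :=
  complex.Re (Cintegral D (fun x => \sum_(j < d) grad D v j x * (grad D w j x)^*%C)).

Definition Vnorm D v : R := Num.sqrt (Vinner D v v).

Definition H1norm D v : R := Num.sqrt (Hinner D v v + Vinner D v v).

(* closure of C_c^oo(D, C) in H^1(D, C) *)
Definition H10space D u :=
  H1space D u /\ forall e : R, 0 < e ->
    exists2 phi, test_function D phi & H1norm D (u - phi) < e.

Definition H10dual D (F : Cfun -> R) :=
  (forall (a : R) v w, H10space D v -> H10space D w ->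
     F (fun x => a%:C * v x + w x) = a * F v + F w) /\
  exists C : R, forall v, H10space D v -> `|F v| <= C * Vnorm D v.

(* An operator T : V -> V^*, V = H10space D, is given by T v w := <T v, w>. *)
Definition solves D (T : Cfun -> Cfun -> R) (F : Cfun -> R) v :=
  H10space D v /\ forall w, H10space D w -> T v w = F w.

(* T maps V to its dual, is onto, one-to-one, and has a bounded inverse. *)
Definition invertible D (T : Cfun -> Cfun -> R) :=
  [/\ forall v, H10space D v -> H10dual D (T v),
      forall F, H10dual D F -> exists v, solves D T F v,
      forall v v', H10space D v -> H10space D v' ->
        (forall w, H10space D w -> T v w = T v' w) -> eqae D v v' &
      exists C : R, forall v (M : R), H10space D v -> 0 <= M ->
        (forall w, H10space D w -> `|T v w| <= M * Vnorm D w) -> Vnorm D v <= C * M].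

(* a representative of T^-1 F *)
Definition Vinverse D (T : Cfun -> Cfun -> R) (F : Cfun -> R) : Cfun :=
  xget (fun=> 0) [set v | solves D T F v].

(* real Frechet derivative with respect to the norm of H^1_0 *)
Definition H10derivative D (E : Cfun -> R) u (F : Cfun -> R) :=
  H10dual D F /\ forall e : R, 0 < e -> exists2 r : R, 0 < r &
    forall h, H10space D h -> Vnorm D h < r ->
      `|E (u + h) - E u - F h| <= e * Vnorm D h.

End spaces.

Section gross_pitaevskii.
Context {R : realType} {d : nat}.
Local Notation Rd := 'rV[R]_d.
Local Notation Cfun := ('rV[R]_d -> R[i]).
Local Notation mu := (@lebesgue_rV R d).
Variables (D : set Rd) (W : Rd -> R) (Omega kappa : R).
Implicit Types (u v w : Cfun).

(* (y, -x) if d = 2 and (y, -x, 0) if d = 3, indices starting from 0 *)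
Definition rot_mx : 'M[R]_d := \matrix_(i < d, j < d)
  (((i == 1%N :> nat) && (j == 0%N :> nat))%:R
   - ((i == 0%N :> nat) && (j == 1%N :> nat))%:R).

Definition rotation (x : Rd) : Rd := x *m rot_mx.

Definition W_R (x : Rd) : R := W x - 4^-1 * Omega ^+ 2 * sqnorm x.

(* the transpose in nabla_R only turns the row vector R(x) into a column *)
Definition grad_R v (j : 'I_d) : Cfun := fun x =>
  grad D v j x + (0 +i* (Omega / 2 * rotation x ord0 j)) * v x.

Definition energy u : R :=
  2^-1 * \int[mu]_(x in D)
    (\sum_(j < d) cmod (grad_R u j x) ^+ 2 + W_R x * cmod (u x) ^+ 2
     + kappa / 2 * cmod (u x) ^+ 4).

Definition linear_part v w : R[i] :=
  Cintegral D (fun x => \sum_(j < d) grad_R v j x * (grad_R w j x)^*%C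
                        + (W_R x)%:C * v x * (w x)^*%C).

(* A_form u v w is <A(u, v), w> *)
Definition A_form u v w : R :=
  complex.Re (linear_part v w + (kappa / Hnorm D u ^+ 2)%:C *
    Cintegral D (fun x => (cmod (u x) ^+ 2)%:C * v x * (w x)^*%C)).

Definition GP_operator u w : R := A_form u u w.

Definition J_form u v w : R :=
  complex.Re (linear_part v w
    + (kappa / Hnorm D u ^+ 2)%:C *
      Cintegral D (fun x =>
        (u x * (v x)^*%C + 2%:R * v x * (u x)^*%C) * u x * (w x)^*%C)
    - (2 * kappa * Hinner D u v / Hnorm D u ^+ 4)%:C *
      Cintegral D (fun x => (cmod (u x) ^+ 2)%:C * u x * (w x)^*%C)).

Definition J_sigma (sigma : R) u v w : R := J_form u v w + sigma * Hinner D v w.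

Definition eigenstate u :=
  exists lambda : R, forall w, H10space D w -> GP_operator u w = lambda * Hinner D u w.

(* The derivative vanishes on the tangent space at u of the unit L^2 sphere. *)
Definition critical_point u :=
  [/\ H10space D u, Hnorm D u = 1 &
    exists2 F, H10derivative D energy u F &
      forall v, H10space D v -> Hinner D u v = 0 -> F v = 0].

(* J_sigma(u)^-1 I u *)
Definition J_solution (sigma : R) u : Cfun :=
  Vinverse D (J_sigma sigma u) (Hinner D u).

Definition J_gamma (sigma : R) u : R := (Hinner D (J_solution sigma u) u)^-1.

Definition J_unnormalized (sigma tau : R) u : Cfun := fun x =>
  (1 - tau)%:C * u x + (tau * J_gamma sigma u)%:C * J_solution sigma u x.

Definition J_step (sigma tau : R) u : Cfun := fun x =>
  ((Hnorm D (J_unnormalized sigma tau u))^-1)%:C * J_unnormalized sigma tau u x.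

Fixpoint J_method (sigma : R) (tau : nat -> R) (u0 : Cfun) (n : nat) : Cfun :=
  if n is k.+1 then J_step sigma (tau k) (J_method sigma tau u0 k) else u0.

Definition step_wellposed (sigma tau : R) u :=
  [/\ H10space D u, Hnorm D u != 0, invertible D (J_sigma sigma u),
      Hinner D (J_solution sigma u) u != 0 &
      Hnorm D (J_unnormalized sigma tau u) != 0].

End gross_pitaevskii.

(* Main.v *)
Require Import Defs.
From HB Require Import structures.
From mathcomp Require Import all_boot all_order all_algebra.
From mathcomp Require Import complex ring lra zify.
From mathcomp Require Import all_classical all_reals all_analysis.
From mathcomp Require Import measurable_realfun.

Set Implicit Arguments.
Unset Strict Implicit.
Unset Printing Implicit Defensive.

Import Order.TTheory GRing.Theory Num.Theory.
Import numFieldNormedType.Exports.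

Local Open Scope classical_set_scope.
Local Open Scope ring_scope.

(* At a unit vector [u] one has [kappa |u|_4^4 <= 4 E(u)], so that for
   [sigma >= 4/3 E(u)] the Cauchy-Schwarz inequality absorbs the negative rank-one term of
   [J_sigma(u)], and [W >= Omega^2 |x|^2] makes the remaining form dominate half the
   Dirichlet form: [J_sigma(u)] is coercive, hence invertible. Let [p = gamma J^-1 I u] and
   [d = p - u]. Then [(u, d) = 0], and since [J_sigma(u) u = A(u) + sigma I u],
   [E'(u) d = <J u, d> - sigma (u, d) = gamma (u, d) - <J d, d> = - <J d, d>]. The step
   [u + tau d] has norm at least 1, so normalising it does not increase the energy; the
   energy itself changes by [- tau <J d, d>] up to a term of order [tau^2 <J d, d>] whose
   constant depends on the energy only. If nothing is gained then [d = 0] and [u] is an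
   eigenstate. The quartic terms are controlled by the gradient through Ladyzhenskaya-type
   inequalities for test functions, which is where [d = 2, 3] enters. *)

(** * Forms on a real Hilbert space and the descent step *)

(** Elements of [H10space] are functions identified only almost everywhere, and [grad] is a choice
    among weak gradients, hence linear only almost everywhere. The iteration is therefore analysed
    for real forms on a bare type whose operations [add] and [sc] obey no laws: an identity such as
    x = u + tau d is used only under a linear functional, and [v = 0] is replaced by [vip v v = 0].
    The threshold 4/3 comes from splitting the rank-one term with weight 3, exactly the amount of
    quartic terms available, which leaves kappa q(u,u,u,u) / 3, at most 4/3 E(u). The step size must
    not depend on [sigma], although P = <J d, d> is defined through it; the remedy is that P = -
    <A(u), d>, where [sigma] has dropped out, so that P^2 <= P0 P with P0 fixed by the energy level
    and the Sobolev constants. As the energy decreases, the level E(u0) serves all steps. The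
    Sobolev inequalities are proved by slicing for C^1 functions of compact support; they reach the
    closure by Fatou along almost everywhere convergent test functions, because the quartic integral
    is not continuous for the L^2 distance. *)

Section real_lemmas.
Context {R : realType}.
Implicit Types x y z t C : R.

Lemma sqr_le x y : 0 <= y -> x ^+ 2 <= y ^+ 2 -> x <= y.
Proof.
move=> y0; have [//|yx] := leP x y.
by rewrite ler_pXn2r// ?nnegrE// ?(le_trans y0 (ltW yx))// leNgt yx.
Qed.

Lemma sqr_le_normr x y : 0 <= y -> x ^+ 2 <= y ^+ 2 -> `|x| <= y.
Proof.
by move=> y0 h; apply: sqr_le; rewrite // real_normK// num_real.
Qed.

Lemma sqr_le_mul t x y : 0 <= x -> 0 <= y -> t ^+ 2 <= x * y -> 2 * t <= x + y.
Proof. by move=> x0 y0 h; apply: sqr_le; [lra|have := sqr_ge0 (x - y); nra]. Qed.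

(** For z > 0 evaluate at the minimiser t = -y/z. For z = 0 a nonzero slope is excluded by the test
    value, which makes the affine function equal to -1. *)
Lemma discriminant_le x y z : 0 <= z ->
  (forall t, 0 <= x + 2 * t * y + t ^+ 2 * z) -> y ^+ 2 <= x * z.
Proof.
rewrite le_eqVlt eq_sym => /predU1P[z0|z0] h.
- have [->|y0] := eqVneq y 0; first by rewrite z0 mulr0 expr0n.
  have := h (- (x + 1) / (2 * y)); rewrite z0 mulr0 addr0.
  have -> : x + 2 * (- (x + 1) / (2 * y)) * y = - 1 by field.
  by lra.
- have := h (- (y / z)).
  have -> : x + 2 * - (y / z) * y + (- (y / z)) ^+ 2 * z = (x * z - y ^+ 2) / z.
    by field; rewrite gt_eqF.
  by rewrite pmulr_lge0 ?invr_gt0// subr_ge0.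
Qed.

Lemma pair_inj_sqrt x y C a b : 0 <= C -> 0 <= a -> 0 <= b ->
  x ^+ 2 <= C ^+ 2 * (a * b) -> `|x| <= C * Num.sqrt a * Num.sqrt b.
Proof.
move=> C0 a0 b0 h; apply: sqr_le_normr; first by rewrite !mulr_ge0 ?sqrtr_ge0.
by rewrite !exprMn !sqr_sqrtr// -mulrA.
Qed.

End real_lemmas.

Section forms.
Context {R : realType} {T : Type}.
Variables (add : T -> T -> T) (sc : R -> T -> T).

(** No laws are imposed on [add] and [sc] themselves: every computation takes place after applying a
    real-valued functional. *)
Record linfun_on (F : T -> R) : Prop := {
  linD : forall u v, F (add u v) = F u + F v ;
  linZ : forall a u, F (sc a u) = a * F u }.

Record symform (B : T -> T -> R) : Prop := {
  sfl : forall w, linfun_on (B ^~ w) ;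
  sfC : forall u v, B u v = B v u ;
  sf_ge0 : forall u, 0 <= B u u }.

Section symform_theory.
Variables (B : T -> T -> R) (sB : symform B).

Lemma sfDl u v w : B (add u v) w = B u w + B v w.
Proof. exact: (linD (sfl sB w)). Qed.

Lemma sfZl a u w : B (sc a u) w = a * B u w.
Proof. exact: (linZ (sfl sB w)). Qed.

Lemma sfDr u v w : B w (add u v) = B w u + B w v.
Proof. by rewrite !(sfC sB w) sfDl. Qed.

Lemma sfZr a u w : B w (sc a u) = a * B w u.
Proof. by rewrite !(sfC sB w) sfZl. Qed.

Lemma sf_cs u v : B u v ^+ 2 <= B u u * B v v.
Proof.
apply: discriminant_le => [|t]; first exact: sf_ge0.
have := sf_ge0 sB (add u (sc t v)).
by rewrite !(sfDl, sfDr, sfZl, sfZr) (sfC sB v u); congr (_ <= _); ring.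
Qed.

Definition sub_on u v := add u (sc (-1) v).

(** Completeness for a seminorm: a limit is determined only up to vectors with [B v v = 0]. *)
Definition complete_for := forall f : nat -> T,
  (forall e : R, 0 < e -> exists N : nat, forall m n, (N <= m)%N -> (N <= n)%N ->
     B (sub_on (f m) (f n)) (sub_on (f m) (f n)) <= e) ->
  exists v, forall e : R, 0 < e -> exists N : nat, forall n, (N <= n)%N ->
    B (sub_on (f n) v) (sub_on (f n) v) <= e.

End symform_theory.

(* The minimiser of [B v v - 2 F v]; a minimising sequence is Cauchy by the
   parallelogram identity. *)
Lemma riesz_representation (B : T -> T -> R) (F : T -> R) (C : R) :
  symform B -> complete_for B -> linfun_on F ->
  (forall v, F v ^+ 2 <= C * B v v) -> T ->
  exists v, forall w, B v w = F w.
Proof.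
move=> sB cB lF FC t0.
(* For C <= 0 the bound forces F = 0, which is represented by [sc 0 t0]. *)
have [C0|C0] := leP C 0.
  exists (sc 0 t0) => w; rewrite (sfZl sB) mul0r.
  by have := FC w; have := sf_ge0 sB w; nra.
pose I v := B v v - 2 * F v.
have Ilb v : - C <= I v.
  rewrite /I; have := FC v; have := sf_ge0 sB v => b0 h.
  have := @sqr_le_mul R (F v) C (B v v) (ltW C0) b0 h; lra.
pose S := [set I v | v in [set: T]].
have S0 : has_inf S.
  split; first by exists (I t0), t0.
  by exists (- C) => _ [v _ <-].
pose m := inf S.
have mI v : m <= I v by apply: ge_inf; [exact: S0.2|exists v].
have ex n : exists v, I v < m + n.+1%:R^-1.
  have e0 : 0 < n.+1%:R^-1 :> R by rewrite invr_gt0 ltr0n.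
  by have [_ [v _ <-] h] := inf_adherent e0 S0; exists v.
pose f n := projT1 (cid (ex n)).
have fI n : I (f n) < m + n.+1%:R^-1 by exact: projT2 (cid (ex n)).
have small (e : R) : 0 < e -> exists N : nat, forall n, (N <= n)%N -> n.+1%:R^-1 <= e.
  move=> e0; exists (Num.bound (e^-1)) => n Nn.
  rewrite invf_ple ?posrE ?ltr0n//.
  have /ltW h := archi_boundP (ltW (eqbRL (invr_gt0 e) e0)).
  by apply: (le_trans h); rewrite ler_nat; exact: leqW.
have cau : forall e : R, 0 < e -> exists N : nat, forall i j, (N <= i)%N -> (N <= j)%N ->
     B (sub_on (f i) (f j)) (sub_on (f i) (f j)) <= e.
  move=> e e0; have [N hN] := small (e / 4) ltac:(by rewrite divr_gt0).
  exists N => i j /hN hi /hN hj.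
  (* The midpoint has I at least m while both points have I below m + e/4; the parallelogram
     identity turns this into a squared distance of at most e. *)
  have := mI (sc (2^-1) (add (f i) (f j))).
  have fN k (c : R) : k.+1%:R^-1 <= c -> I (f k) < m + c.
    by move=> kc; apply: lt_le_trans (fI k) _; rewrite lerD2l.
  have := fN _ _ hi; have := fN _ _ hj; rewrite /I /sub_on.
  rewrite !(linD lF, linZ lF, sfDl sB, sfDr sB, sfZl sB, sfZr sB) (sfC sB (f j) (f i)).
  lra.
have [v hv] := cB f cau; exists v => w.
(* Comparing I at f n + t w with I at f n and letting n grow gives the first-order condition at [v],
   without computing [I v]. *)
have key t : 0 <= t ^+ 2 * B w w + 2 * t * (B v w - F w).
  apply/ler_addgt0Pl => e e0.
  have [N1 h1] := small (e / 2) ltac:(by rewrite divr_gt0).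
  (* Chosen so that Cauchy-Schwarz bounds B (f n - v) w by e / (4 (|t| + 1)), whose product with |t|
     is at most e/4. *)
  pose e1 := (e / (4 * (`|t| + 1))) ^+ 2 / (1 + B w w).
  have w0 := sf_ge0 sB w; have t1 := normr_ge0 t.
  have e10 : 0 < e1 by rewrite divr_gt0 ?exprn_gt0 ?divr_gt0//; nra.
  have [N2 h2] := hv e1 e10.
  pose n := maxn N1 N2.
  have {}h1 := h1 n (leq_maxl _ _); have {}h2 := h2 n (leq_maxr _ _).
  have : I (f n) < m + e / 2 by apply: lt_le_trans (fI n) _; rewrite lerD2l.
  have := mI (add (f n) (sc t w)).
  rewrite /I !(linD lF, linZ lF, sfDl sB, sfDr sB, sfZl sB, sfZr sB) (sfC sB w (f n)) => h3 h4.
  have : `|B (f n) w - B v w| <= e / (4 * (`|t| + 1)).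
    apply: sqr_le_normr; first by rewrite divr_ge0//; nra.
    have := sf_cs sB (sub_on (f n) v) w.
    rewrite {1}/sub_on (sfDl sB) (sfZl sB) mulN1r => /le_trans; apply.
    apply: (@le_trans _ _ (e1 * B w w)); first by rewrite ler_wpM2r.
    rewrite /e1 mulrAC ler_pdivrMr; last by lra.
    by rewrite ler_wpM2l ?sqr_ge0//; lra.
  have te : `|t| * (e / (4 * (`|t| + 1))) <= e / 4.
    rewrite mulrA ler_pdivrMr; last by lra.
    by nra.
  move=> h5; have : `|t * (B (f n) w - B v w)| <= e / 4.
    by rewrite normrM; apply: le_trans te; rewrite ler_wpM2l.
  rewrite ler_norml => /andP[h6 h7]; nra.
(* The quadratic in t has no constant term, so the discriminant bound kills its linear
   coefficient. *)
suff : (B v w - F w) ^+ 2 <= 0 * B w w by rewrite mul0r; nra.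
apply: discriminant_le => [|t]; first exact: sf_ge0.
by have := key t; lra.
Qed.


Lemma sf_bound (vip B : T -> T -> R) (C : R) v w : symform vip -> 0 <= C -> symform B ->
  (forall v, B v v <= C * vip v v) ->
  `|B v w| <= C * Num.sqrt (vip v v) * Num.sqrt (vip w w).
Proof.
move=> vipS C0 sB hB; apply: pair_inj_sqrt; rewrite ?(sf_ge0 vipS)//.
apply: le_trans (sf_cs sB _ _) _; rewrite expr2 mulrACA.
by apply: ler_pM; rewrite ?(sf_ge0 sB)// hB.
Qed.

(** * Abstract Gross-Pitaevskii forms: coercivity, inversion and energy descent *)

Section gross_pitaevskii_forms.
Variables (vip h a : T -> T -> R) (q : T -> T -> T -> T -> R).
Variables (kappa Cp Ca Cq : R).
Hypothesis (vipS : symform vip) (hS : symform h) (aS : symform a).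
Hypothesis vip_complete : complete_for vip.
Hypothesis kappa_ge0 : 0 <= kappa.
Hypothesis h_le : forall v, h v v <= Cp * vip v v.
Hypothesis a_ge : forall v, 2^-1 * vip v v <= a v v.
Hypothesis a_le : forall v, a v v <= Ca * vip v v.
Hypothesis Cq_ge0 : 0 <= Cq.
Hypothesis Cp_ge0 : 0 <= Cp.
Hypothesis Ca_ge0 : 0 <= Ca.
Hypothesis q_lin : forall v w z, linfun_on (fun u => q u v w z).
Hypothesis qC : forall u v w z, q u v w z = q v u w z.
Hypothesis qS : forall u v w z, q u v w z = q w z u v.
Hypothesis q_ge0 : forall u v, 0 <= q u v u v.
Hypothesis q_cs : forall u v w z, q u v w z ^+ 2 <= q u v u v * q w z w z.
Hypothesis q_swap : forall u v, q u v u v <= q u u v v.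
Hypothesis q_le : forall v, q v v v v <= Cq * vip v v ^+ 2.

Let q_lin2 u w z : linfun_on (fun v => q u v w z).
Proof. by split=> *; rewrite !(qC u) ?(linD (q_lin _ _ _)) ?(linZ (q_lin _ _ _)). Qed.

Let q_lin3 u v z : linfun_on (fun w => q u v w z).
Proof. by split=> *; rewrite !(qS u v) ?(linD (q_lin _ _ _)) ?(linZ (q_lin _ _ _)). Qed.

Let q_lin4 u v w : linfun_on (fun z => q u v w z).
Proof. by split=> *; rewrite !(qS u v) ?(linD (q_lin2 _ _ _)) ?(linZ (q_lin2 _ _ _)). Qed.

Let qC' u v w z : q w z u v = q w z v u.
Proof. by rewrite !(qS w z) qC. Qed.

(** [q u v w z] stands for the integral of Re(u conj v) Re(w conj z), [a] for the linear part of the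
    operator, [h] for the L^2 product and [vip] for the Dirichlet product. [A_gen] and [J_gen] are
    the forms at a vector with [h u u = 1], which is why no norm of [u] appears in them. *)
Definition E_form v := 2^-1 * a v v + kappa / 4 * q v v v v.

Definition A_gen u w := a u w + kappa * q u u u w.

(** The symmetric nonnegative part of [J_gen]. The term left out has rank one but is not symmetric
    in v and w. *)
Definition N_gen sigma u v w :=
  a v w + kappa * (2 * q u v u w + q u u v w) + sigma * h v w.

Definition J_gen sigma u v w := N_gen sigma u v w - 2 * kappa * h u v * q u u u w.

Let vip_ge0 := sf_ge0 vipS.

Lemma q_pair_ge0 u v : 0 <= q u u v v.
Proof. exact: le_trans (q_ge0 u v) (q_swap u v). Qed.

Lemma q_pair_le u v : q u u v v <= Cq * vip u u * vip v v.
Proof.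
have U := vip_ge0 u; have V := vip_ge0 v.
apply: sqr_le; first by rewrite !mulr_ge0.
apply: le_trans (q_cs _ _ _ _) _.
have -> : (Cq * vip u u * vip v v) ^+ 2 =
  (Cq * vip u u ^+ 2) * (Cq * vip v v ^+ 2) by ring.
by apply: ler_pM.
Qed.

Lemma q_bound_middle u v w : `|q u v u w| <= Cq * vip u u * Num.sqrt (vip v v) * Num.sqrt (vip w w).
Proof.
apply: pair_inj_sqrt => //; first by rewrite mulr_ge0.
apply: le_trans (q_cs _ _ _ _) _.
have -> : (Cq * vip u u) ^+ 2 * (vip v v * vip w w) =
  (Cq * vip u u * vip v v) * (Cq * vip u u * vip w w) by ring.
by apply: ler_pM => //; apply: le_trans (q_swap _ _) (q_pair_le _ _).
Qed.

Lemma q_bound_outer u v w : `|q u u v w| <= Cq * vip u u * Num.sqrt (vip v v) * Num.sqrt (vip w w).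
Proof.
apply: pair_inj_sqrt => //; first by rewrite mulr_ge0.
apply: le_trans (q_cs _ _ _ _) _.
have -> : (Cq * vip u u) ^+ 2 * (vip v v * vip w w) =
  (Cq * vip u u ^+ 2) * (Cq * vip v v * vip w w) by ring.
by apply: ler_pM => //; apply: le_trans (q_swap _ _) (q_pair_le _ _).
Qed.

Lemma A_gen_bound u : exists C : R, forall w, `|A_gen u w| <= C * Num.sqrt (vip w w).
Proof.
exists (Ca * Num.sqrt (vip u u) + kappa * (Cq * vip u u * Num.sqrt (vip u u))) => w.
rewrite /A_gen (le_trans (ler_normD _ _))// mulrDl lerD//; first exact: sf_bound.
by rewrite normrM ger0_norm// -(mulrA kappa) ler_wpM2l// q_bound_outer.
Qed.

Lemma A_gen_lin u : linfun_on (A_gen u).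
Proof.
by split=> *; rewrite /A_gen ?(sfDr aS) ?(sfZr aS) ?(linD (q_lin4 _ _ _)) ?(linZ (q_lin4 _ _ _)); ring.
Qed.

Lemma N_gen_sym sigma u : 0 <= sigma -> symform (N_gen sigma u).
Proof.
move=> s0; rewrite /N_gen; split.
- move=> w; split=> *; rewrite ?(sfDl aS) ?(sfZl aS) ?(sfDl hS) ?(sfZl hS)
    ?(linD (q_lin2 _ _ _)) ?(linZ (q_lin2 _ _ _)) ?(linD (q_lin3 _ _ _)) ?(linZ (q_lin3 _ _ _)); ring.
- by move=> v w; rewrite (sfC aS) (sfC hS) (qS u v u w) (qS u u v w) (qC v w) (qS w v).
- move=> v; rewrite !addr_ge0// ?mulr_ge0// ?(sf_ge0 aS) ?(sf_ge0 hS)//.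
  by rewrite addr_ge0// ?q_pair_ge0// mulr_ge0.
Qed.

Lemma J_gen_lin sigma u v : linfun_on (J_gen sigma u v).
Proof.
rewrite /J_gen /N_gen; split=> *; rewrite ?(sfDr aS) ?(sfZr aS) ?(sfDr hS) ?(sfZr hS)
    ?(linD (q_lin4 _ _ _)) ?(linZ (q_lin4 _ _ _)); ring.
Qed.

Lemma J_gen_linl sigma u w : linfun_on (fun v => J_gen sigma u v w).
Proof.
rewrite /J_gen /N_gen; split=> *;
  rewrite ?(sfDl aS) ?(sfZl aS) ?(sfDl hS) ?(sfZl hS) ?(sfDr hS) ?(sfZr hS)
    ?(linD (q_lin2 _ _ _)) ?(linZ (q_lin2 _ _ _)) ?(linD (q_lin3 _ _ _)) ?(linZ (q_lin3 _ _ _)); ring.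
Qed.

Lemma N_gen_bound sigma u : exists2 C : R, 0 <= C & forall v w,
  `|N_gen sigma u v w| <= C * Num.sqrt (vip v v) * Num.sqrt (vip w w).
Proof.
have U := vip_ge0 u.
exists (Ca + kappa * (2 * (Cq * vip u u) + Cq * vip u u) + `|sigma| * Cp).
  by rewrite !addr_ge0// !mulr_ge0// !addr_ge0// !mulr_ge0.
move=> v w; rewrite /N_gen !mulrDl; (apply: le_trans (ler_normD _ _) _; apply: lerD).
  apply: le_trans (ler_normD _ _) _; apply: lerD.
- exact: sf_bound.
- rewrite normrM ger0_norm// -!mulrA ler_wpM2l// !mulrA !mulrDl.
  apply: le_trans (ler_normD _ _) _; apply: lerD; last exact: q_bound_outer.
  by rewrite !mul1r; apply: le_trans (ler_normD _ _) _; apply: lerD; exact: q_bound_middle.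
- by rewrite normrM -!mulrA ler_wpM2l// mulrA; exact: sf_bound.
Qed.

Lemma J_gen_bound sigma u v : exists C : R, forall w,
  `|J_gen sigma u v w| <= C * Num.sqrt (vip w w).
Proof.
have [C C0 hC] := N_gen_bound sigma u.
exists (C * Num.sqrt (vip v v) + `|2 * kappa * h u v| * (Cq * vip u u * Num.sqrt (vip u u))) => w.
apply: le_trans (ler_normB _ _) _; rewrite [X in _ <= X]mulrDl; apply: lerD => //.
by rewrite normrM -(mulrA `|_|) ler_wpM2l// q_bound_outer.
Qed.

Section unit_sphere.
Variables (e0 sigma : R) (u : T).
Hypotheses (hu1 : h u u = 1) (Eu : E_form u <= e0) (sigma_ge : 4 / 3 * e0 <= sigma).

Lemma q_unit_le : kappa * q u u u u <= 4 * e0.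
Proof. by have := sf_ge0 aS u; move: Eu; rewrite /E_form; lra. Qed.

Lemma e0_ge0 : 0 <= e0.
Proof. by have := mulr_ge0 kappa_ge0 (q_ge0 u u); have := q_unit_le; lra. Qed.

Lemma vip_unit_le : vip u u <= 4 * e0.
Proof.
by have := mulr_ge0 kappa_ge0 (q_ge0 u u); have := a_ge u; move: Eu; rewrite /E_form; lra.
Qed.

Let sigma_ge0 : 0 <= sigma.
Proof. by move: sigma_ge; have := e0_ge0; lra. Qed.

(** By two Cauchy-Schwarz inequalities the square of h(u,v) q(u,u,u,v) is at most h(v,v) q(u,u,u,u)
    q(u,v,u,v). The positive terms 2 q(u,v,u,v) + q(u,u,v,v) are worth 3 q(u,v,u,v) by [q_swap], and
    [sigma] pays for the rest. *)
Lemma J_gen_coercive v : a v v <= J_gen sigma u v v.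
Proof.
rewrite /J_gen /N_gen -addrA -addrA lerDl.
have Z0 := q_ge0 u u; have hv := sf_ge0 hS v.
(* The weight 3 spends the quartic terms completely and leaves kappa q(u,u,u,u) / 3 <= 4/3 e0 in
   front of h(v,v); this fixes the threshold for [sigma]. *)
have : (h u v * q u u u v) ^+ 2 <= (3 * q u v u v) * (q u u u u * h v v / 3).
  have -> : 3 * q u v u v * (q u u u u * h v v / 3) =
    (h u u * h v v) * (q u u u u * q u v u v) by rewrite hu1; field.
  by rewrite exprMn ler_pM ?sqr_ge0// ?(sf_cs hS).
move/(sqr_le_mul (mulr_ge0 (ler0n _ 3) (q_ge0 u v))).
rewrite divr_ge0 ?mulr_ge0// => /(_ isT) h1.
have h2 := q_swap u v.
have h3 : kappa * (q u u u u * h v v / 3) <= sigma * h v v.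
  have -> : kappa * (q u u u u * h v v / 3) = kappa * q u u u u / 3 * h v v by field.
  by rewrite ler_wpM2r//; move: sigma_ge; have := q_unit_le; lra.
have : kappa * (2 * (h u v * q u u u v)) <=
   kappa * (2 * q u v u v + q u u v v + q u u u u * h v v / 3).
  by rewrite ler_wpM2l//; lra.
rewrite mulrDr; lra.
Qed.

Lemma J_gen_coercive_vip v : 2^-1 * vip v v <= J_gen sigma u v v.
Proof. exact: le_trans (a_ge v) (J_gen_coercive v). Qed.

Lemma N_gen_ge v : 2^-1 * vip v v <= N_gen sigma u v v.
Proof.
apply: le_trans (a_ge v) _; rewrite /N_gen -addrA lerDl addr_ge0//.
  by rewrite mulr_ge0// addr_ge0 ?q_pair_ge0// mulr_ge0.
by rewrite mulr_ge0// (sf_ge0 hS).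
Qed.

(** Bounds from above and below make [N_gen] and [vip] equivalent, so Cauchy sequences and limits
    are the same for both. *)
Lemma N_gen_complete : complete_for (N_gen sigma u).
Proof.
move=> f cf; have [C C0 hC] := N_gen_bound sigma u.
have N_ge v : 2^-1 * vip v v <= N_gen sigma u v v.
  exact: N_gen_ge.
have [|v hv] := vip_complete (f := f).
  move=> e ep; have [|N hN] := cf (2^-1 * e); first by rewrite mulr_gt0.
  exists N => m n Nm Nn; have := hN m n Nm Nn; have := N_ge (sub_on (f m) (f n)); lra.
exists v => e ep; have [|N hN] := hv (e / (C + 1)); first by rewrite divr_gt0// ltr_wpDl.
exists N => n Nn; have := hN n Nn; rewrite ler_pdivlMr ?ltr_wpDl//.
have := hC (sub_on (f n) v) (sub_on (f n) v); rewrite -mulrA -expr2 sqr_sqrtr//.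
have := ler_norm (N_gen sigma u (sub_on (f n) v) (sub_on (f n) v)).
have := vip_ge0 (sub_on (f n) v); nra.
Qed.

Lemma N_gen_riesz F : linfun_on F -> (exists C : R, forall v, `|F v| <= C * Num.sqrt (vip v v)) ->
  exists v, forall w, N_gen sigma u v w = F w.
Proof.
move=> lF [C FC].
apply: (riesz_representation (C := 2 * C ^+ 2) (N_gen_sym u sigma_ge0) N_gen_complete lF) => // v.
   have := FC v => {}FC.
  have : F v ^+ 2 <= C ^+ 2 * vip v v.
    rewrite -real_normK ?num_real// -[X in _ * X](sqr_sqrtr (vip_ge0 v)) -exprMn.
    by rewrite ler_pXn2r// ?nnegrE// (le_trans (normr_ge0 _) FC).
  have N_ge : 2^-1 * vip v v <= N_gen sigma u v v.
    exact: N_gen_ge.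
  move=> /le_trans; apply; have := sqr_ge0 C; nra.
Qed.

(** Substitute for [v = 0]: by Cauchy-Schwarz and boundedness, a vector of zero [vip]-length is
    invisible to the forms. *)
Lemma vip_null v : vip v v = 0 ->
  (forall w, a v w = 0) /\ (forall w, J_gen sigma u v w = 0) /\ (forall w, h v w = 0).
Proof.
move=> v0.
have hv w : h v w = 0.
  by have := sf_bound v w vipS Cp_ge0 hS h_le; rewrite v0 sqrtr0 mulr0 mul0r normr_le0 => /eqP.
split; [move=> w|split=> // w].
  by have := sf_bound v w vipS Ca_ge0 aS a_le; rewrite v0 sqrtr0 mulr0 mul0r normr_le0 => /eqP.
rewrite /J_gen (sfC hS) hv mulr0 mul0r subr0.
have [C C0 /(_ v w)] := N_gen_bound sigma u.
by rewrite v0 sqrtr0 mulr0 mul0r normr_le0 => /eqP.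
Qed.

(* [J] is the symmetric coercive form [N] minus a rank-one term. *)
Lemma J_gen_onto F : linfun_on F -> (exists C : R, forall v, `|F v| <= C * Num.sqrt (vip v v)) ->
  exists v, forall w, J_gen sigma u v w = F w.
Proof.
move=> lF bF; have [y Ny] := N_gen_riesz lF bF.
have [|z Nz] := N_gen_riesz (q_lin4 u u u).
  by exists (Cq * vip u u * Num.sqrt (vip u u)) => v; exact: q_bound_outer.
(* If this vanished, [J z z], which is (1 - 2 kappa h(u,z)) q(u,u,u,z), would be 0; coercivity would
   make [z] null, so h(u,z) = 0 and the left-hand side would be 1. *)
have c0 : 1 - 2 * kappa * h u z != 0.
  apply/negP => /eqP c0.
  have Jz : J_gen sigma u z z = 0.
    rewrite /J_gen Nz.
    by rewrite -{1}[q u u u z]mul1r -mulrBl c0 mul0r.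
  have z0 : vip z z = 0.
    by have := J_gen_coercive_vip z; rewrite Jz; have := vip_ge0 z; lra.
  move: c0; rewrite (sfC hS) (vip_null z0).2.2; lra.
(* Solves c = 2 kappa h(u, y + c z), the scalar equation left by the rank-one correction
   (Sherman-Morrison). *)
pose c := 2 * kappa * h u y / (1 - 2 * kappa * h u z).
exists (add y (sc c z)) => w.
have sN := N_gen_sym u sigma_ge0.
rewrite /J_gen (sfDl sN) (sfZl sN) Ny Nz (sfDr hS) (sfZr hS).
suff {1}-> : c = 2 * kappa * (h u y + c * h u z) by ring.
by rewrite /c; field.
Qed.

(** Were h(s,u) = 0, then [J s s = h u s = 0] would make [s] null by coercivity, against
    [J s u = h u u = 1]. This makes gamma well defined. *)
Lemma J_gen_solution_neq0 s : (forall w, J_gen sigma u s w = h u w) -> h s u != 0.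
Proof.
move=> Js; apply/eqP => su.
have s0 : vip s s = 0.
  have := J_gen_coercive_vip s; rewrite Js (sfC hS) su; have := vip_ge0 s; lra.
have := Js u; rewrite (vip_null s0).2.1 hu1 => /eqP.
by rewrite eq_sym oner_eq0.
Qed.

End unit_sphere.

Definition affine_step tau g u s := add (sc (1 - tau) u) (sc (tau * g) s).

(* With [d = p - u], [p = g s], one has [h u d = 0] and [E'(u) d = - J d d]:
   the step is a descent direction whatever [sigma] is, and [J d d] is bounded
   in terms of the energy, which makes the step size uniform. *)
Lemma J_step_descent (e0 : R) : 0 <= e0 -> exists2 taus : R, 0 < taus &
  forall (sigma tau : R) u s, h u u = 1 -> E_form u <= e0 -> 4 / 3 * e0 <= sigma ->
  0 < tau <= taus -> (forall w, J_gen sigma u s w = h u w) ->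
  let x := affine_step tau (h s u)^-1 u s in
  [/\ 1 <= h x x,
      E_form (sc (Num.sqrt (h x x))^-1 x) <= E_form u &
      E_form u <= E_form (sc (Num.sqrt (h x x))^-1 x) ->
        exists lambda, forall w, A_gen u w = lambda * h u w].
Proof.
move=> e00.
(* With P = J d d, these are the constants of q(u,u,d,d) <= 2 X0 P, P <= P0 and q(d,d,d,d) <= Y0 P,
   obtained from vip(u,u) <= 4 e0 and vip(d,d) <= 2 P. None of them contains [sigma]. *)
pose X0 := 4 * Cq * e0; pose P0 := 4 * e0 + 64 * kappa ^+ 2 * Cq * e0 ^+ 2 * X0.
pose Y0 := 4 * Cq * P0.
have X00 : 0 <= X0 by rewrite !mulr_ge0.
have P00 : 0 <= P0 by rewrite addr_ge0// ?mulr_ge0// sqr_ge0.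
have Y00 : 0 <= Y0 by rewrite !mulr_ge0.
pose C := 2^-1 + kappa / 4 * (16 * X0 + 3 * Y0).
have C12 : 2^-1 <= C by rewrite lerDl ?mulr_ge0 ?addr_ge0 ?mulr_ge0.
(* This gives tau C <= 1/2, so that the terms of order tau^2 and above cost at most half of the gain
   tau P. Moreover C >= 1/2 ensures tau <= 1, which bounds tau^3 and tau^4 by tau^2. *)
exists (2 * C)^-1; first by rewrite invr_gt0; lra.
move=> sigma tau u s hu1 Eu sge /andP[tau0 tauC] Js x.
have {tauC}tauC : tau * C <= 2^-1.
  move: tauC; rewrite invfM -ler_pdivrMr ?invr_gt0 ?invrK//; lra.
have tau1 : tau <= 1 by nra.
have su := J_gen_solution_neq0 hu1 Eu sge Js.
pose g := (h s u)^-1; pose d := add (sc (-1) u) (sc g s).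
(* The identity x = u + tau d, available only under linear functionals. *)
have L F : linfun_on F -> F x = F u + tau * F d.
  by move=> lF; rewrite /x /affine_step /d !(linD lF) !(linZ lF) -/g; ring.
have Ld F : linfun_on F -> F d = - F u + g * F s.
  by move=> lF; rewrite /d !(linD lF) !(linZ lF); ring.
(* [g] is the normalisation for which h(g s, u) = 1 = h(u, u). *)
have hd : h u d = 0.
  by rewrite (sfC hS) (Ld _ (sfl hS u)) hu1 /g mulVf//; ring.
have Jd w : J_gen sigma u d w = - J_gen sigma u u w + g * h u w.
  by rewrite (Ld _ (J_gen_linl sigma u w)) Js.
have Ju w : J_gen sigma u u w = A_gen u w + sigma * h u w.
  by rewrite /J_gen /N_gen /A_gen hu1; ring.
pose P := J_gen sigma u d d.
have PA : P = - A_gen u d by rewrite /P Jd Ju hd; ring.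
have aP : a d d <= P := J_gen_coercive hu1 Eu sge d.
have VP : vip d d <= 2 * P by have := J_gen_coercive_vip hu1 Eu sge d; rewrite -/P; lra.
have V0 := vip_ge0 d; have P_ge0 : 0 <= P by lra.
have U4 : vip u u <= 4 * e0 := vip_unit_le Eu.
pose X := q u u d d; pose Y := q d d d d.
have XV : X <= 2 * X0 * P.
  apply: le_trans (q_pair_le _ _) _.
  have -> : 2 * X0 * P = (Cq * (4 * e0)) * (2 * P) by rewrite /X0; ring.
  by apply: ler_pM => //; rewrite ?mulr_ge0// ler_wpM2l.
(* A priori bound: as P = - A(u, d), it is enough that A(u, d)^2 <= P0 P, and [sigma] does not occur
   in A(u, d). *)
have PP0 : P <= P0.
  have Ad : A_gen u d ^+ 2 <= P0 * P.
    have h1 : a u d ^+ 2 <= 2 * e0 * P.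
      apply: le_trans (sf_cs aS _ _) _; apply: ler_pM => //; [exact: sf_ge0|exact: sf_ge0|].
      by have := mulr_ge0 kappa_ge0 (q_ge0 u u); move: Eu; rewrite /E_form; lra.
    have h2 : q u u u d ^+ 2 <= (Cq * (4 * e0) ^+ 2) * (2 * X0 * P).
      apply: le_trans (q_cs _ _ _ _) _; apply: ler_pM => //.
        by apply: le_trans (q_le _) _; rewrite ler_wpM2l// ler_pXn2r// nnegrE// mulr_ge0.
      exact: le_trans (q_swap _ _) XV.
    have : A_gen u d ^+ 2 <= 2 * a u d ^+ 2 + 2 * kappa ^+ 2 * q u u u d ^+ 2.
      by rewrite /A_gen; have := sqr_ge0 (a u d - kappa * q u u u d); nra.
    move=> /le_trans; apply; rewrite /P0.
    have := ler_wpM2l (sqr_ge0 kappa) h2; nra.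
  have [P1|P1] := leP P 0; first exact: le_trans P1 P00.
  by move: Ad; rewrite -[X in X ^+ 2]opprK -PA sqrrN expr2 ler_pM2r.
have YP : Y <= Y0 * P.
  apply: le_trans (q_le d) _.
  have : vip d d ^+ 2 <= (2 * P0) * (2 * P) by rewrite expr2 ler_pM//; lra.
  by move/(ler_wpM2l Cq_ge0)/le_trans; apply; rewrite /Y0; lra.
have X_ge0 : 0 <= X := q_pair_ge0 u d.
have Y_ge0 : 0 <= Y := q_ge0 d d.
(* Exact fourth-degree expansion in tau; its first-order coefficient A(u, d) equals - P. *)
have Eqx : E_form x = E_form u - tau * P + tau ^+ 2 * (2^-1 * a d d) +
   kappa / 4 * (tau ^+ 2 * (4 * q u d u d + 2 * X) + 4 * tau ^+ 3 * q u d d d + tau ^+ 4 * Y).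
  rewrite /E_form PA /A_gen /X /Y.
  rewrite (L _ (sfl aS _)) !(sfC aS _ x) !(L _ (sfl aS _)) (sfC aS d u).
  rewrite (L _ (q_lin _ _ _)) !(L _ (q_lin2 _ _ _)) !(L _ (q_lin3 _ _ _)) !(L _ (q_lin4 _ _ _)).
  rewrite !(qC d u) !(qC' d u) !(qS u d u u) !(qS d d u u) !(qS d d u d).
  by field.
have Ex : E_form x <= E_form u - tau * P / 2.
  have Q3 : 2 * q u d d d <= X + Y.
    by apply: sqr_le_mul => //; apply: le_trans (q_cs _ _ _ _) _; rewrite ler_wpM2r//; exact: q_swap.
  have Q2 : q u d u d <= X by exact: q_swap.
  have t2 : 0 <= tau ^+ 2 by rewrite sqr_ge0.
  have t32 : tau ^+ 3 <= tau ^+ 2 by rewrite exprS ler_piMl.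
  have t42 : tau ^+ 4 <= tau ^+ 2 by rewrite exprS (le_trans _ t32)// ler_piMl ?exprn_ge0// ltW.
  have t30 : 0 <= tau ^+ 3 by rewrite exprn_ge0// ltW.
  have b1 : tau ^+ 2 * (4 * q u d u d + 2 * X) + 4 * tau ^+ 3 * q u d d d + tau ^+ 4 * Y <=
      tau ^+ 2 * ((16 * X0 + 3 * Y0) * P).
    apply: (@le_trans _ _ (tau ^+ 2 * (6 * X) + tau ^+ 2 * (2 * (X + Y)) + tau ^+ 2 * Y)).
      apply: lerD; last by rewrite ler_wpM2r.
      apply: lerD; first by rewrite ler_wpM2l//; lra.
      apply: (@le_trans _ _ (tau ^+ 3 * (2 * (X + Y)))); last by rewrite ler_wpM2r//; lra.
      have := ler_wpM2l t30 Q3; lra.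
    by rewrite -!mulrDr ler_wpM2l//; lra.
  have b2 : kappa / 4 * (tau ^+ 2 * (4 * q u d u d + 2 * X) + 4 * tau ^+ 3 * q u d d d + tau ^+ 4 * Y)
      <= kappa / 4 * (tau ^+ 2 * ((16 * X0 + 3 * Y0) * P)) by rewrite ler_wpM2l// divr_ge0.
  have b3 : tau ^+ 2 * (2^-1 * a d d) <= tau ^+ 2 * (2^-1 * P) by rewrite ler_wpM2l//; lra.
  have : tau * (tau * C * P) <= tau * (2^-1 * P) by rewrite (ler_wpM2l (ltW tau0))// (ler_wpM2r P_ge0).
  rewrite Eqx; move: b2 b3; rewrite /C; lra.
have hx : 1 <= h x x.
  rewrite (L _ (sfl hS _)) !(sfC hS _ x) !(L _ (sfl hS _)) (sfC hS d u) hd hu1.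
  by have := mulr_ge0 (sqr_ge0 tau) (sf_ge0 hS d); lra.
(* Both parts of the energy are nonnegative and homogeneous, of degrees 2 and 4, so a factor of at
   most 1 cannot increase it. *)
have Esc : E_form (sc (Num.sqrt (h x x))^-1 x) <= E_form x.
  set c := _^-1; have c1 : c <= 1 by rewrite invf_le1 ?sqrtr_gt0 ?(lt_le_trans ltr01)// -sqrtr1 ler_wsqrtr.
  have c0 : 0 <= c by rewrite invr_ge0 sqrtr_ge0.
  rewrite /E_form (sfZl aS) (sfZr aS) (linZ (q_lin _ _ _)) (linZ (q_lin2 _ _ _))
    (linZ (q_lin3 _ _ _)) (linZ (q_lin4 _ _ _)) !(mulrA c).
  have c2 : c * c <= 1 by rewrite mulr_ile1.
  have c4 : c * c * c * c <= 1 by rewrite -mulrA mulr_ile1// mulr_ge0.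
  apply: lerD; rewrite ler_wpM2l// ?divr_ge0// ?invr_ge0//.
    by rewrite ler_piMl// (sf_ge0 aS).
  by rewrite !mulrA ler_piMl// q_ge0.
split=> //.
  by have := mulr_ge0 (ltW tau0) P_ge0; lra.
(* No gain forces tau P / 2 <= 0, so [d] is null, and J d w = 0 reads A(u, w) + sigma h(u, w) = g
   h(u, w). *)
move=> EE; have P1 : P = 0.
  by apply/eqP; rewrite eq_le P_ge0 andbT -(pmulr_rle0 _ tau0); lra.
have d0 : vip d d = 0 by lra.
exists (g - sigma) => w.
have := Jd w; rewrite (vip_null sigma u d0).2.1 Ju; lra.
Qed.

(** The remainder of the quartic expansion has terms of degree 2, 3 and 4 in v, and the cubic one is
    dominated by the two others. This identifies [A_gen u] as the Frechet derivative of the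
    energy. *)
Lemma E_form_derivative u : exists2 C : R, 0 <= C & forall v,
  `|E_form (add u v) - E_form u - A_gen u v| <= C * (vip v v + vip v v ^+ 2).
Proof.
have U := vip_ge0 u.
exists (2^-1 * Ca + kappa * (3 * (Cq * vip u u) + Cq)).
  by rewrite addr_ge0// ?mulr_ge0// ?addr_ge0// !mulr_ge0.
move=> v; have V := vip_ge0 v.
pose X := q u u v v; pose Y := q v v v v.
have -> : E_form (add u v) - E_form u - A_gen u v = 2^-1 * a v v +
   kappa / 4 * (4 * q u v u v + 2 * X + 4 * q u v v v + Y).
  rewrite /E_form /A_gen /X /Y (sfDl aS) !(sfDr aS) (sfC aS v u).
  rewrite (linD (q_lin _ _ _)) !(linD (q_lin2 _ _ _)) !(linD (q_lin3 _ _ _)) !(linD (q_lin4 _ _ _)).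
  rewrite !(qC v u) !(qC' v u) !(qS u v u u) !(qS v v u u) !(qS v v u v).
  by field.
have XV : X <= Cq * vip u u * vip v v := q_pair_le u v.
have YV : Y <= Cq * vip v v ^+ 2 := q_le v.
have X_ge0 : 0 <= X := q_pair_ge0 u v.
have Y_ge0 : 0 <= Y := q_ge0 v v.
have Q3 : `|2 * q u v v v| <= X + Y.
  have Q4 : q u v v v ^+ 2 <= X * Y.
    by apply: le_trans (q_cs _ _ _ _) _; rewrite ler_wpM2r//; exact: q_swap.
  rewrite ler_norml (sqr_le_mul X_ge0 Y_ge0 Q4) andbT lerNl -mulrN.
  by apply: sqr_le_mul => //; rewrite sqrrN.
have Q2 : q u v u v <= X by exact: q_swap.
have Q20 := q_ge0 u v.
have a0 := sf_ge0 aS v; have aV := a_le v.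
apply: (le_trans (ler_normD _ _)).
rewrite [X in X + _]ger0_norm; last by rewrite mulr_ge0.
have B : `|4 * q u v u v + 2 * X + 4 * q u v v v + Y| <= 8 * X + 3 * Y.
  by move: Q3; rewrite !ler_norml => /andP[Q5 Q6]; apply/andP; split; lra.
rewrite normrM ger0_norm ?divr_ge0//.
have := ler_wpM2l (divr_ge0 kappa_ge0 (ler0n _ 4)) B.
have := ler_wpM2l kappa_ge0 XV; have := ler_wpM2l kappa_ge0 YV.
have : 0 <= kappa * (Cq * vip u u * vip v v) by rewrite !mulr_ge0.
have : 0 <= kappa * (Cq * vip u u * vip v v ^+ 2) by rewrite !mulr_ge0// sqr_ge0.
have : 0 <= kappa * (Cq * vip v v) by rewrite !mulr_ge0.
have : 0 <= kappa * (Cq * vip v v ^+ 2) by rewrite !mulr_ge0// sqr_ge0.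
have : 0 <= Ca * vip v v ^+ 2 by rewrite !mulr_ge0// sqr_ge0.
lra.
Qed.

End gross_pitaevskii_forms.
End forms.

(** * Square-integrable functions *)

Section real_sequences.
Context {R : realType}.
Implicit Type u : nat -> R.

Lemma bounded_nneg_series_cvg u (M : R) : (forall n, 0 <= u n) ->
  (forall n, \sum_(k < n) u k <= M) -> cvgn (series u).
Proof.
move=> u0 uM; apply: nondecreasing_is_cvgn.
  apply/nondecreasing_seqP => n; rewrite !seriesEnat/= big_nat_recr//= lerDl.
  exact: u0.
by exists M => _ [n _ <-]; rewrite seriesEord/= uM.
Qed.

Lemma bounded_variation_cvg u (M : R) :
  (forall n, \sum_(k < n) `|u k.+1 - u k| <= M) -> cvgn u.
Proof.
move=> uM; rewrite (_ : u = fun n => u 0%N + series (telescope u) n); last first.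
  by apply/funext => n; rewrite -eq_sum_telescope.
apply: is_cvgD; first exact: is_cvg_cst.
apply: normed_cvg; apply: (@bounded_nneg_series_cvg _ M) => n //=.
exact: uM.
Qed.

Lemma bounded_sqr_cvg0 u (l M : R) : (forall n, \sum_(k < n) (u k - l) ^+ 2 <= M) ->
  u @ \oo --> l.
Proof.
move=> uM.
have /cvg_series_cvg_0 h0 := @bounded_nneg_series_cvg (fun n => (u n - l) ^+ 2) M
  (fun n => sqr_ge0 _) uM.
apply/cvgrPdist_lt => e e0.
have e20 : 0 < e ^+ 2 by rewrite exprn_gt0.
move/cvgrPdist_lt : h0 => /(_ _ e20); apply: filterS => n.
rewrite sub0r normrN ger0_norm ?sqr_ge0// distrC => h.
by rewrite -(ltr_pXn2r (n := 2))// ?nnegrE ?ltW// real_normK ?num_real.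
Qed.

Lemma geometric_half_sum_le n : \sum_(k < n) (2 ^- k : R) <= 2.
Proof.
suff -> : \sum_(k < n) (2 ^- k : R) = 2 - 2 * 2 ^- n.
  by rewrite gerBl mulr_ge0// invr_ge0 exprn_ge0.
elim: n => [|n ih]; first by rewrite big_ord0 expr0 invr1; ring.
by rewrite big_ord_recr/= ih exprS; field; rewrite expf_neq0.
Qed.

End real_sequences.

Section L2_theory.
Context d {T : measurableType d} {R : realType}.
Variables (mu : {measure set T -> \bar R}) (D : set T) (mD : measurable D).
Implicit Types (f g h : T -> R).
Local Notation I f := (\int[mu]_(x in D) (f x)).

Definition intg f := mu.-integrable D (EFin \o f).

Lemma intg_measurable f : intg f -> measurable_fun D f.
Proof. by move=> /measurable_int/measurable_EFinP. Qed.

Lemma intg_lin a b f g : intg f -> intg g -> intg (fun x => a * f x + b * g x).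
Proof.
move=> If Ig.
have := integrableD mD (integrableZl mD a If) (integrableZl mD b Ig).
exact: eq_integrable.
Qed.

Lemma I_lin a b f g : intg f -> intg g ->
  I (fun x => a * f x + b * g x) = a * I f + b * I g.
Proof.
move=> If Ig; rewrite RintegralD ?RintegralZl//.
- by have := integrableZl mD a If; exact: eq_integrable.
- by have := integrableZl mD b Ig; exact: eq_integrable.
Qed.

Lemma intgD f g : intg f -> intg g -> intg (fun x => f x + g x).
Proof.
move=> If Ig; have := intg_lin 1 1 If Ig; rewrite /intg.
by apply: eq_integrable => // x _; rewrite /= !mul1r.
Qed.

Lemma I_D f g : intg f -> intg g -> I (fun x => f x + g x) = I f + I g.
Proof. by move=> If Ig; rewrite RintegralD. Qed.

Lemma intgZ a f : intg f -> intg (fun x => a * f x).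
Proof. by move=> If; have := integrableZl mD a If; exact: eq_integrable. Qed.

Lemma I_Z a f : intg f -> I (fun x => a * f x) = a * I f.
Proof. by move=> If; rewrite RintegralZl. Qed.

Lemma intg0 : intg (fun=> 0).
Proof. exact: integrable0. Qed.

Lemma I_0 : I (fun=> 0) = 0.
Proof. by rewrite Rintegral_cst// mul0r. Qed.

Lemma intg_sum n (f : 'I_n -> T -> R) : (forall i, intg (f i)) ->
  intg (fun x => \sum_(i < n) f i x).
Proof.
elim: n f => [|n ih] f h.
  by rewrite (_ : (fun _ => _) = (fun=> 0)); [exact: intg0|apply/funext => x; rewrite big_ord0].
rewrite (_ : (fun _ => _) = (fun x => \sum_(i < n) f (widen_ord (leqnSn n) i) x + f ord_max x)).
  by apply: intgD => //; exact: ih.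
by apply/funext => x; rewrite big_ord_recr.
Qed.

Lemma I_sum n (f : 'I_n -> T -> R) : (forall i, intg (f i)) ->
  I (fun x => \sum_(i < n) f i x) = \sum_(i < n) I (f i).
Proof.
elim: n f => [|n ih] f h.
  rewrite (_ : (fun _ => _) = (fun=> 0)); first by rewrite I_0 big_ord0.
  by apply/funext => x; rewrite big_ord0.
rewrite (_ : (fun _ => _) = (fun x => \sum_(i < n) f (widen_ord (leqnSn n) i) x + f ord_max x)).
  by rewrite I_D// ?ih ?big_ord_recr//; exact: intg_sum.
by apply/funext => x; rewrite big_ord_recr.
Qed.

Lemma EFin_I f : intg f -> (I f)%:E = (\int[mu]_(x in D) (f x)%:E)%E.
Proof. by move=> If; rewrite /Rintegral fineK//; exact: integrable_fin_num. Qed.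

Lemma intg_ae_dom f g : measurable_fun D f -> intg g ->
  {ae mu, forall x, D x -> `|f x| <= g x} -> intg f.
Proof.
move=> mf Ig fg; apply/integrableP; split; first exact/measurable_EFinP.
have /integrableP[mg] := Ig; apply: le_lt_trans.
apply: ae_ge0_le_integral => //.
- by apply: measurableT_comp => //; exact/measurable_EFinP.
- by apply: measurableT_comp.
- apply: filterS fg => x h Dx /=; rewrite lee_fin.
  by apply: le_trans (h Dx) _; exact: ler_norm.
Qed.

Lemma intg_dom f g : measurable_fun D f -> intg g ->
  (forall x, D x -> `|f x| <= g x) -> intg f.
Proof. by move=> mf Ig h; apply: (intg_ae_dom mf Ig); exact: aeW. Qed.

Lemma I_ae_eq f g : measurable_fun D f -> measurable_fun D g ->
  {ae mu, forall x, D x -> f x = g x} -> I f = I g.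
Proof.
move=> mf mg fg; congr fine; apply: ae_eq_integral => //; try exact/measurable_EFinP.
by apply: filterS fg => x h Dx; rewrite h.
Qed.

Lemma I_ge0 f : {ae mu, forall x, D x -> 0 <= f x} -> measurable_fun D f -> 0 <= I f.
Proof.
move=> f0 mf; rewrite (@I_ae_eq f (fun x => `|f x|))//.
- exact: Rintegral_ge0.
- exact: measurableT_comp.
- by apply: filterS f0 => x h Dx; rewrite ger0_norm// h.
Qed.

Lemma I_le f g : intg f -> intg g -> {ae mu, forall x, D x -> f x <= g x} -> I f <= I g.
Proof.
move=> If Ig fg; rewrite -subr_ge0.
have -> : I g - I f = I (fun x => 1 * g x + (-1) * f x) by rewrite I_lin//; ring.
apply: I_ge0; last by apply: intg_measurable; exact: intg_lin.
by apply: filterS fg => x h Dx; have := h Dx; lra.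
Qed.

Lemma I_eq0_ae f : intg f -> (forall x, D x -> 0 <= f x) -> I f = 0 ->
  {ae mu, forall x, D x -> f x = 0}.
Proof.
move=> If f0 f00.
have : (\int[mu]_(x in D) `|(f x)%:E| = 0)%E.
  rewrite -[RHS]/(0%:E) -f00 EFin_I//; apply: eq_integral => x; rewrite inE => Dx.
  by rewrite gee0_abs// lee_fin f0.
move/(ae_eq_integral_abs mu mD) => h.
have /h : measurable_fun D (EFin \o f) by apply/measurable_EFinP; exact: intg_measurable.
by apply: filterS => x xx Dx; have [] := xx Dx.
Qed.

Definition L2 f := measurable_fun D f /\ intg (fun x => f x ^+ 2).

Lemma L2_mul f g : L2 f -> L2 g -> intg (fun x => f x * g x).
Proof.
move=> [mf If] [mg Ig]; apply: (intg_dom _ (intg_lin 1 1 If Ig)).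
  exact: measurable_funM.
move=> x _; rewrite normrM -(real_normK (num_real (f x))) -(real_normK (num_real (g x))).
by have := sqr_ge0 (`|f x| - `|g x|); have := sqr_ge0 `|f x|; have := sqr_ge0 `|g x|; nra.
Qed.

Lemma L2_lin a b f g : L2 f -> L2 g -> L2 (fun x => a * f x + b * g x).
Proof.
move=> Lf Lg; have [mf If] := Lf; have [mg Ig] := Lg.
have mfg : measurable_fun D (fun x => a * f x + b * g x).
  by apply: measurable_funD; apply: measurable_funM => //; exact: measurable_cst.
split => //.
rewrite /intg (_ : _ \o _ = EFin \o (fun x => 1 * (a ^+ 2 * f x ^+ 2 + b ^+ 2 * g x ^+ 2) +
  (2 * a * b) * (f x * g x))); last by apply/funext => x /=; congr EFin; ring.
by apply: intg_lin; [exact: intg_lin|exact: L2_mul].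
Qed.

Lemma L2_D f g : L2 f -> L2 g -> L2 (fun x => f x + g x).
Proof.
move=> Lf Lg; have := L2_lin 1 1 Lf Lg.
by rewrite (_ : (fun _ => _) = (fun x => f x + g x))//; apply/funext => x; rewrite !mul1r.
Qed.

Lemma L2_B f g : L2 f -> L2 g -> L2 (fun x => f x - g x).
Proof.
move=> Lf Lg; have := L2_lin 1 (-1) Lf Lg.
by rewrite (_ : (fun _ => _) = (fun x => f x - g x))//; apply/funext => x; ring.
Qed.

Lemma L2_Z a f : L2 f -> L2 (fun x => a * f x).
Proof.
move=> Lf; have := L2_lin a 0 Lf Lf.
by rewrite (_ : (fun _ => _) = (fun x => a * f x))//; apply/funext => x; ring.
Qed.

Lemma L2_bounded_mul f g (M : R) : L2 f -> measurable_fun D g ->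
  {ae mu, forall x, D x -> `|g x| <= M} -> L2 (fun x => g x * f x).
Proof.
move=> [mf If] mg gM; split; first exact: measurable_funM.
apply: (intg_ae_dom _ (intgZ (M ^+ 2) If)).
  by apply: measurable_funX; exact: measurable_funM.
apply: filterS gM => x h Dx; rewrite normrX normrM exprMn.
rewrite [`|f x| ^+ 2]real_normK ?num_real// ler_wpM2r ?sqr_ge0//.
by rewrite ler_pXn2r ?nnegrE// ?h// (le_trans _ (h Dx)).
Qed.

Lemma L2_cs f g : L2 f -> L2 g ->
  I (fun x => f x * g x) ^+ 2 <= I (fun x => f x ^+ 2) * I (fun x => g x ^+ 2).
Proof.
move=> Lf Lg; have [mf If] := Lf; have [mg Ig] := Lg.
apply: discriminant_le => [|t].
  by apply: Rintegral_ge0 => x _; exact: sqr_ge0.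
rewrite (_ : _ + _ = I (fun x => 1 * (1 * f x ^+ 2 + t ^+ 2 * g x ^+ 2) + (2 * t) * (f x * g x))).
  by apply: Rintegral_ge0 => x _; have := sqr_ge0 (f x + t * g x); nra.
rewrite I_lin ?I_lin//; [ring|exact: intg_lin|exact: L2_mul].
Qed.

(** The limit is assumed only almost everywhere, so [g] may be negative on a null set; hence the
    absolute value in the conclusion. No integrability of [g] is assumed: a finite bound provides
    it. *)
Lemma fatou_ae (g_ : nat -> T -> R) g (C : \bar R) :
  (forall n, measurable_fun D (g_ n)) -> measurable_fun D g ->
  (forall n x, D x -> 0 <= g_ n x) ->
  {ae mu, forall x, D x -> g_ ^~ x @ \oo --> g x} ->
  (\forall n \near \oo, (\int[mu]_(x in D) (g_ n x)%:E <= C)%E) ->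
  (\int[mu]_(x in D) `|(g x)%:E| <= C)%E.
Proof.
move=> mg_ mg g0 gg gC.
have mE n : measurable_fun D (EFin \o g_ n) by exact/measurable_EFinP.
have pos n x : D x -> (0 <= (EFin \o g_ n) x)%E by move=> Dx; rewrite lee_fin g0.
have inf0 x : D x -> (0 <= limn_einf (fun n => (EFin \o g_ n) x))%E.
  move=> Dx; rewrite limn_einf_lim; apply: lime_ge; first exact: is_cvg_einfs.
  by apply: nearW => n; apply: le_ereal_inf_tmp => _ [m /= _ <-]; rewrite lee_fin g0.
have minf : measurable_fun D (fun x => limn_einf (fun n => (EFin \o g_ n) x)).
  rewrite (_ : (fun _ => _) = (fun x => (- limn_esup (fun n => - (EFin \o g_ n) x))%E)).
    apply: measurableT_comp => //; apply: measurable_fun_limn_esup => n.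
    exact: measurableT_comp.
  by apply/funext => x; rewrite -limn_einfN; congr limn_einf; apply/funext => n /=; rewrite opprK.
apply: (@le_trans _ _ (\int[mu]_(x in D) limn_einf (fun n => (EFin \o g_ n) x))%E).
  rewrite le_eqVlt; apply/orP; left; apply/eqP; apply: ge0_ae_eq_integral => //.
    by apply: measurableT_comp => //; exact/measurable_EFinP.
  apply: filterS gg => x h Dx /=.
  have hx : (EFin \o (fun n => g_ n x)) @ \oo --> (g x)%:E.
    by apply: cvg_EFin; [exact: nearW|exact: h].
  have [-> _] := cvg_limn_einf_sup hx.
  by rewrite ger0_norm//; have := inf0 _ Dx; rewrite (cvg_limn_einf_sup hx).1 lee_fin.
apply: (le_trans (fatou mu mD mE pos)).
rewrite limn_einf_lim; apply: lime_le; first exact: is_cvg_einfs.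
near=> n; apply: (@le_trans _ _ (\int[mu]_(x in D) (g_ n x)%:E)%E); last by near: n.
by apply: ereal_inf_lbound; exists n => /=.
Unshelve. all: by end_near. Qed.

(** By monotone convergence the sum has integral at most 2, so it is finite almost everywhere. *)
Lemma summable_integrals_ae (h : nat -> T -> R) :
  (forall n, measurable_fun D (h n)) -> (forall n x, D x -> 0 <= h n x) ->
  (forall n, (\int[mu]_(x in D) (h n x)%:E <= (2 ^- n)%:E)%E) ->
  {ae mu, forall x, D x -> exists M : R, forall n, \sum_(k < n) h k x <= M}.
Proof.
move=> mh h0 Ih.
pose F x := (\sum_(0 <= k <oo) (h k x)%:E)%E.
have mhE n : measurable_fun D (EFin \o h n) by exact/measurable_EFinP.
have h0E n x : D x -> (0 <= (EFin \o h n) x)%E by move=> Dx; rewrite lee_fin h0.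
have IF : (\int[mu]_(x in D) F x <= 2%:E)%E.
  rewrite (integral_nneseries mu mD mhE h0E).
  apply: lime_le.
    by apply: is_cvg_nneseries => n _ _; apply: integral_ge0 => x; exact: h0E.
  apply: nearW => n; rewrite big_mkord.
  apply: (@le_trans _ _ (\sum_(k < n) (2 ^- k)%:E)%E); first by apply: lee_sum => i _; exact: Ih.
  by rewrite sumEFin lee_fin geometric_half_sum_le.
have F0 x : D x -> (0 <= F x)%E.
  by move=> Dx; apply: nneseries_ge0 => n _ _; exact: h0E.
have mF : measurable_fun D F.
  apply: (ge0_emeasurable_sum (h := fun k => EFin \o h k)) => // n x Dx _; exact: h0E.
have iF : mu.-integrable D F.
  apply/integrableP; split => //; apply: le_lt_trans (ltry 2).
  rewrite (eq_integral (fun x => F x)) // => x; rewrite inE => Dx.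
  by rewrite gee0_abs// F0.
apply: filterS (integrable_ae mD iF) => x hx Dx.
exists (fine (F x)) => n; rewrite -lee_fin fineK ?hx// -sumEFin.
rewrite -(big_mkord xpredT (fun k => (h k x)%:E)).
by apply: nneseries_lim_ge => k _ _; exact: h0E.
Qed.

Lemma L2_fast_cvg_ae (f_ : nat -> T -> R) f : (forall n, L2 (f_ n)) -> L2 f ->
  (forall n, I (fun x => (f_ n x - f x) ^+ 2) <= 2 ^- n) ->
  {ae mu, forall x, D x -> f_ ^~ x @ \oo --> f x}.
Proof.
move=> Lf_ Lf ff.
have L n : L2 (fun x => f_ n x - f x) by apply: L2_B.
have : {ae mu, forall x, D x -> exists M : R, forall n, \sum_(k < n) (f_ k x - f x) ^+ 2 <= M}.
  apply: (summable_integrals_ae (h := fun n x => (f_ n x - f x) ^+ 2)) => [n|n x _|n].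
  - by apply: measurable_funX; exact: (L n).1.
  - exact: sqr_ge0.
  - by rewrite -EFin_I ?lee_fin//; exact: (L n).2.
by apply: filterS => x h /h[M]; exact: bounded_sqr_cvg0.
Qed.

(** The almost everywhere part of the Riesz-Fischer theorem. Squared increments of size 4^-k leave
    room for a weight 2^k, and the weighted squares control the increments themselves. *)
Lemma L2_fast_complete (f_ : nat -> T -> R) : (forall n, L2 (f_ n)) ->
  (forall n, I (fun x => (f_ n.+1 x - f_ n x) ^+ 2) <= 4 ^- n) ->
  exists2 f : T -> R, measurable_fun D f & {ae mu, forall x, D x -> f_ ^~ x @ \oo --> f x}.
Proof.
move=> Lf_ ff.
(* A limit superior is measurable without knowing where the sequence converges, and agrees with the
   limit wherever that exists. *)
pose f x := fine (limn_esup (fun n => (f_ n x)%:E)); exists f.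
  apply: measurableT_comp; first exact: fine_measurable.
  by apply: measurable_fun_limn_esup => n; apply/measurable_EFinP; exact: (Lf_ n).1.
have L n : L2 (fun x => f_ n.+1 x - f_ n x) by apply: L2_B.
have : {ae mu, forall x, D x -> exists M : R, forall n,
    \sum_(k < n) (2 ^+ k * (f_ k.+1 x - f_ k x) ^+ 2) <= M}.
  apply: (summable_integrals_ae (h := fun k x => 2 ^+ k * (f_ k.+1 x - f_ k x) ^+ 2)) => [n|n x _|n].
  - by apply: measurable_funM => //; apply: measurable_funX; exact: (L n).1.
  - by rewrite mulr_ge0// ?sqr_ge0// exprn_ge0.
  - rewrite -EFin_I; last by apply: intgZ; exact: (L n).2.
    rewrite lee_fin I_Z; last exact: (L n).2.
    apply: (@le_trans _ _ (2 ^+ n * 4 ^- n)); first by rewrite ler_wpM2l// exprn_ge0.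
    rewrite (_ : 4 = 2 * 2 :> R); last by ring.
    by rewrite exprMn invfM mulrA mulfV ?mul1r// expf_neq0.
apply: filterS => x h /h[M hM].
have cf : cvgn (f_ ^~ x).
  apply: (@bounded_variation_cvg _ _ (1 + M / 2)) => n.
  apply: (@le_trans _ _ (\sum_(k < n) (2 ^- k / 2 + 2 ^+ k * (f_ k.+1 x - f_ k x) ^+ 2 / 2))).
    apply: ler_sum => k _; set y := _ - _; set a := 2 ^+ k.
    have a0 : 0 < a by rewrite exprn_gt0.
    (* Young's inequality |y| <= a^-1 / 2 + a y^2 / 2 with a = 2^k, by completing the square. *)
    have -> : a^-1 / 2 + a * y ^+ 2 / 2 = `|y| + a / 2 * (`|y| - a^-1) ^+ 2.
      rewrite [(`|y| - _) ^+ 2]sqrrB real_normK ?num_real//; field; exact: lt0r_neq0.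
    by rewrite lerDl mulr_ge0 ?sqr_ge0// divr_ge0// ltW.
  rewrite big_split/= -!mulr_suml; have := hM n; have := geometric_half_sum_le (R := R) n; lra.
have hx : (fun n => (f_ n x)%:E) @ \oo --> (limn (f_ ^~ x))%:E by apply: cvg_EFin; [exact: nearW|exact: cf].
by rewrite /f; have [_ ->] := cvg_limn_einf_sup hx.
Qed.


Lemma L2_complete (f_ : nat -> T -> R) : (forall n, L2 (f_ n)) ->
  (forall e : R, 0 < e -> exists N : nat, forall m n, (N <= m)%N -> (N <= n)%N ->
     I (fun x => (f_ m x - f_ n x) ^+ 2) <= e) ->
  exists2 f : T -> R, L2 f & forall e : R, 0 < e -> exists N : nat, forall n, (N <= n)%N ->
    I (fun x => (f_ n x - f x) ^+ 2) <= e.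
Proof.
move=> Lf cf.
have pos4 n : 0 < 4 ^- n :> R by rewrite invr_gt0 exprn_gt0.
pose N n := projT1 (cid (cf _ (pos4 n))).
have NP n i j : (N n <= i)%N -> (N n <= j)%N -> I (fun x => (f_ i x - f_ j x) ^+ 2) <= 4 ^- n.
  exact: (projT2 (cid (cf _ (pos4 n)))).
(* Partial sums make [K] increasing and at least both [N n] and n. *)
pose K n := (\sum_(k < n.+1) (N k + 1))%N.
have KS n : K n.+1 = (K n + (N n.+1 + 1))%N by rewrite /K big_ord_recr.
have KN n : (N n <= K n)%N.
  by rewrite /K big_ord_recr/= addnCA leq_addr.
have Kn n : (n <= K n)%N by elim: n => // n ih; rewrite KS; lia.
have [|f mf ff] := @L2_fast_complete (fun n => f_ (K n)) (fun n => Lf _).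
  by move=> n; apply: NP => //; rewrite KS; have := KN n; lia.
(* Fatou along the subsequence with n fixed: the limit inherits the Cauchy bound for every term, so
   the whole sequence converges and not only the subsequence. *)
have B n (e : R) : (\forall m \near \oo, I (fun x => (f_ (K m) x - f_ n x) ^+ 2) <= e) ->
    (\int[mu]_(x in D) `|((f x - f_ n x) ^+ 2)%:E| <= e%:E)%E.
  move=> he; apply: (fatou_ae (g_ := fun m x => (f_ (K m) x - f_ n x) ^+ 2)).
  - by move=> m; apply: measurable_funX; exact: (L2_B (Lf _) (Lf _)).1.
  - by apply: measurable_funX; apply: measurable_funB => //; exact: (Lf n).1.
  - by move=> m x _; exact: sqr_ge0.
  - apply: filterS ff => x h /h cx.
    rewrite (_ : (fun _ => _) = (fun y => (y - f_ n x) * (y - f_ n x)) \o (fun m => f_ (K m) x))//.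
    by rewrite expr2; apply: cvgM; apply: cvgB => //; exact: cvg_cst.
  - apply: filterS he => m; rewrite -lee_fin EFin_I//; exact: (L2_B (Lf _) (Lf _)).2.
have BL n (e : R) : (\forall m \near \oo, I (fun x => (f_ (K m) x - f_ n x) ^+ 2) <= e) ->
    L2 (fun x => f x - f_ n x) /\ I (fun x => (f_ n x - f x) ^+ 2) <= e.
  move=> /B he; have L : L2 (fun x => f x - f_ n x).
    split; first by apply: measurable_funB => //; exact: (Lf n).1.
    apply/integrableP; split; last exact: le_lt_trans he (ltry _).
    by apply/measurable_EFinP/measurable_funX/measurable_funB => //; exact: (Lf n).1.
  split => //; rewrite -lee_fin.
  rewrite (_ : (fun x => _) = (fun x => (f x - f_ n x) ^+ 2)); last first.
    by apply/funext => x; rewrite -sqrrN opprB.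
  rewrite EFin_I; last exact: L.2.
  apply: le_trans he; rewrite le_eqVlt; apply/orP; left; apply/eqP.
  by apply: eq_integral => x _; rewrite gee0_abs// lee_fin sqr_ge0.
exists f.
  (* Membership of the limit in L^2: it differs from one term of the sequence by a square-integrable
     function. *)
  have [|L _] := @BL (N 0%N) (4 ^- 0).
    by exists (N 0%N) => // m /= hm; apply: NP => //; exact: leq_trans hm (Kn m).
  rewrite (_ : f = (fun x => (f x - f_ (N 0%N) x) + f_ (N 0%N) x)); first exact: L2_D.
  by apply/funext => x; rewrite subrK.
move=> e e0; have [M hM] := cf _ e0; exists M => n Mn.
apply: (BL n e _).2; exists M => // m /= Mm; apply: hM => //.
exact: leq_trans Mm (Kn m).
Qed.

End L2_theory.

(** * Lebesgue measure on row vectors *)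

Section topology_rV.
Context {R : realType}.

Lemma ball_rVP n (x y : 'rV[R]_n) (e : R) : 0 < e ->
  ball x e y <-> forall i, `|x ord0 i - y ord0 i| < e.
Proof.
move=> e0; split => [[_ h] i|h]; first exact: h.
by split => // i j; rewrite ord1; exact: h.
Qed.

Lemma norm_rV_ltP n (x : 'rV[R]_n) (e : R) : 0 < e ->
  `|x| < e <-> forall i, `|x ord0 i| < e.
Proof.
move=> e0; have := @ball_rVP n x 0 e e0; rewrite -ball_normE /ball_/= subr0 => h.
by split => [/h|] k; [move=> i; have := k i|apply/h => i]; rewrite mxE subr0.
Qed.

Lemma norm_coor_le n (x : 'rV[R]_n) i : `|x ord0 i| <= `|x|.
Proof.
apply/ler_addgt0Pl => e e0.
have xe : 0 < e + `|x| by rewrite ltr_wpDr.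
by apply/ltW/(norm_rV_ltP x xe).1; rewrite ltrDr.
Qed.

Lemma norm_rV_leP n (x : 'rV[R]_n) (e : R) : 0 <= e ->
  `|x| <= e <-> forall i, `|x ord0 i| <= e.
Proof.
move=> e0; split => [h i|h]; first exact: le_trans (norm_coor_le x i) h.
apply/ler_addgt0Pl => a a0; apply/ltW/norm_rV_ltP; first by rewrite ltr_wpDr.
by move=> i; apply: le_lt_trans (h i) _; rewrite ltrDr.
Qed.

Lemma cons_rV0 n (p : R * 'rV[R]_n) : cons_rV p ord0 ord0 = p.1.
Proof. by rewrite -{2}(cons_rVK p). Qed.

Lemma cons_rV_lift n (p : R * 'rV[R]_n) (i : 'I_n) : cons_rV p ord0 (lift ord0 i) = p.2 ord0 i.
Proof.
rewrite -{2}(cons_rVK p)/= [RHS]mxE; congr (fun_of_matrix (cons_rV p)).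
exact/val_inj.
Qed.

Lemma rV_ind_coor n (P : 'I_n.+1 -> Prop) : P ord0 -> (forall i, P (lift ord0 i)) -> forall i, P i.
Proof. by move=> p0 pS i; case: (unliftP ord0 i) => [j ->|->]. Qed.

Lemma rV_addE n (x y : 'rV[R]_n) i : (x + y) ord0 i = x ord0 i + y ord0 i.
Proof. by rewrite mxE. Qed.

Lemma rV_subE n (x y : 'rV[R]_n) i : (x - y) ord0 i = x ord0 i - y ord0 i.
Proof. by rewrite !mxE. Qed.

Lemma rV_scaleE n a (x : 'rV[R]_n) i : (a *: x) ord0 i = a * x ord0 i.
Proof. by rewrite mxE. Qed.

(** Straight lines go to straight lines, so the partial derivatives of a slice are those of the
    ambient space. *)
Lemma cons_rV_lin n (h s t : R) (y z : 'rV[R]_n) :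
  cons_rV (h * s + t, h *: z + y) = h *: cons_rV (s, z) + cons_rV (t, y).
Proof.
apply/rowP; apply: rV_ind_coor => [|i]; first by rewrite rV_addE rV_scaleE !cons_rV0.
by rewrite rV_addE rV_scaleE !cons_rV_lift/= rV_addE rV_scaleE.
Qed.

Lemma cons_rV_delta0 n : cons_rV (1, 0) = delta_mx ord0 ord0 :> 'rV[R]_n.+1.
Proof.
by apply/rowP; apply: rV_ind_coor => [|i]; rewrite ?cons_rV0 ?cons_rV_lift !mxE.
Qed.

Lemma cons_rV_deltaS n (k : 'I_n) :
  cons_rV (0, delta_mx ord0 k) = delta_mx ord0 (lift ord0 k) :> 'rV[R]_n.+1.
Proof.
apply/rowP; apply: rV_ind_coor => [|i]; rewrite ?cons_rV0 ?cons_rV_lift !mxE//=.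
Qed.

Lemma norm_cons_rV_fst n (p : R * 'rV[R]_n) : `|p.1| <= `|cons_rV p|.
Proof. by rewrite -(cons_rV0 p) norm_coor_le. Qed.

Lemma norm_cons_rV_snd n (p : R * 'rV[R]_n) : `|p.2| <= `|cons_rV p|.
Proof.
by apply/norm_rV_leP => // i; rewrite -(cons_rV_lift p) norm_coor_le.
Qed.

Lemma continuous_cons_rV_fst n (y : 'rV[R]_n) : continuous (fun t => cons_rV (t, y)).
Proof.
move=> t; apply/cvgrPdist_lt => e e0; near=> s.
apply/norm_rV_ltP => //; apply: rV_ind_coor => [|i].
  by rewrite rV_subE !cons_rV0/=; near: s; exact: cvgr_dist_lt.
by rewrite rV_subE !cons_rV_lift/= subrr normr0.
Unshelve. all: by end_near. Qed.

Lemma continuous_cons_rV_snd n (t : R) : continuous (fun y : 'rV[R]_n => cons_rV (t, y)).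
Proof.
move=> y; apply/(@cvgrPdist_lt _ _ _ _ (nbhs_filter y)) => e e0.
have : \forall z \near y, `|y - z| < e.
  by have := nbhsx_ballx y e e0; rewrite -ball_normE.
apply: filterS => z yz.
apply/norm_rV_ltP => //; apply: rV_ind_coor => [|i].
  by rewrite rV_subE !cons_rV0/= subrr normr0.
rewrite rV_subE !cons_rV_lift/=; have := (norm_rV_ltP _ e0).1 yz i.
by rewrite rV_subE.
Qed.

Lemma measurable_open_cube n (c : 'rV[R]_n) (e : R) :
  measurable [set y : 'rV[R]_n | forall i, `|c ord0 i - y ord0 i| < e].
Proof.
rewrite (_ : [set y | _] = \bigcap_(i in [set: 'I_n])
    ((fun y : 'rV[R]_n => y ord0 i) @^-1` [set s | `|c ord0 i - s| < e])).
  apply: fin_bigcap_measurable => // i _; rewrite -[X in measurable X]setTI.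
  apply: measurable_coor => //.
  apply: open_measurable; rewrite (_ : [set s | _] = ball (c ord0 i) e).
    exact: ball_open.
  by rewrite -ball_normE.
by apply/seteqP; split => [y h i _ /=|y h i]; [exact: h|exact: (h i)].
Qed.

(** Rational centres and half-widths 1/(k+1) keep the family of cubes countable. The second clause
    speaks of closed cubes because compact boxes inside the open set are needed for the supports of
    test functions. *)
Lemma open_cube_cover n (A : set 'rV[R]_n) : open A -> forall x, A x ->
  exists (q : 'rV[rat]_n) (k : nat),
    (forall i, `|ratr (q ord0 i) - x ord0 i| < k.+1%:R^-1) /\
    (forall y : 'rV[R]_n, (forall i, `|ratr (q ord0 i) - y ord0 i| <= k.+1%:R^-1) -> A y).
Proof.
move=> oA x Ax.
have /nbhs_ballP[e /= e0 xe] : nbhs x A by exact: open_nbhs_nbhs.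
have [k ke] : exists k : nat, 2 * k.+1%:R^-1 < e.
  exists (Num.bound (2 / e)); have e2 : 0 <= 2 / e by rewrite divr_ge0// ltW.
  have := archi_boundP e2; rewrite ltr_pdivrMr// => h.
  rewrite ltr_pdivrMr ?ltr0n//; apply: (lt_le_trans h).
  by rewrite mulrC ler_wpM2l ?ltW// ltr_nat.
have ex i : exists q : rat, `|ratr q - x ord0 i| < k.+1%:R^-1.
  have [|q] := @rat_in_itvoo R (x ord0 i - k.+1%:R^-1) (x ord0 i + k.+1%:R^-1).
    by rewrite ltrD2l gtrN// invr_gt0.
  rewrite in_itv/= => h; exists q; rewrite ltr_norml.
  by rewrite ltrBrDr ltrBlDr addrC (addrC _ (x ord0 i)).
pose q : 'rV[rat]_n := \row_i xchoose (ex i); exists q, k.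
have qx i : `|ratr (q ord0 i) - x ord0 i| < k.+1%:R^-1.
  by rewrite mxE; exact: (xchooseP (ex i)).
split => // y hy; apply: xe; apply/ball_rVP => // i.
apply: (le_lt_trans (ler_distD (ratr (q ord0 i)) _ _)); apply: le_lt_trans ke.
by rewrite mulr2n mulrDl mul1r lerD// ltW// distrC.
Qed.

(** The sigma-algebra is the one generated by the coordinates, so an open set has to be exhibited as
    a countable union of cubes. *)
Lemma open_measurable_rV n (A : set 'rV[R]_n) : open A -> measurable A.
Proof.
move=> oA.
pose Q (p : 'rV[rat]_n * nat) := [set y : 'rV[R]_n | forall i,
   `|(map_mx ratr p.1 : 'rV[R]_n) ord0 i - y ord0 i| < p.2.+1%:R^-1].
have -> : A = \bigcup_(p : 'rV[rat]_n * nat) (if `[< Q p `<=` A >] then Q p else set0).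
  apply/seteqP; split => [x Ax|x [p _]]; last by case: asboolP => // h; exact: h.
  have [q [k [h1 h2]]] := open_cube_cover oA Ax.
  exists (q, k) => //; case: asboolP => [_ i|]; first by rewrite mxE; exact: h1.
  by case=> y h; apply: h2 => i; have := h i; rewrite mxE => /ltW.
apply: countable_bigcupT_measurable; first exact: countableP.
by move=> p; case: asboolP => // _; exact: measurable_open_cube.
Qed.

Lemma continuous_measurable_rV n (f : 'rV[R]_n -> R) : continuous f -> measurable_fun setT f.
Proof.
move=> /continuousP cf; apply: (measurability _ (RGenOpens.measurableE R)).
move=> _ [_ [a [b ->] <-]]; rewrite setTI.
by apply: open_measurable_rV; exact/cf/interval_open.
Qed.

End topology_rV.

(** * Tonelli and Fubini by splitting off the first coordinate *)

Section integral_rV.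
Context {R : realType}.
Local Notation leb n := (@lebesgue_rV R n).
Local Notation leb1 := (@lebesgue_measure R).
Local Open Scope ereal_scope.

Lemma lebesgue_rVS n : (leb n.+1 : set _ -> \bar R) = pushforward (leb1 \x leb n) (@cons_rV R n).
Proof. by []. Qed.

Lemma tonelli_rV n (f : 'rV[R]_n.+1 -> \bar R) : measurable_fun setT f -> (forall x, 0 <= f x) ->
  \int[leb n.+1]_x f x = \int[leb1]_t \int[leb n]_y f (cons_rV (t, y)).
Proof.
move=> mf f0.
rewrite lebesgue_rVS ge0_integral_pushforward//; [|exact: measurable_cons_rV].
rewrite preimage_setT; apply: etrans (fubini_tonelli1 _ _ _) _ => // [|x]; last exact: f0.
by apply: measurableT_comp => //; exact: measurable_cons_rV.
Qed.

Lemma tonelli_rV_swap n (f : 'rV[R]_n.+1 -> \bar R) : measurable_fun setT f -> (forall x, 0 <= f x) ->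
  \int[leb n.+1]_x f x = \int[leb n]_y \int[leb1]_t f (cons_rV (t, y)).
Proof.
move=> mf f0; rewrite tonelli_rV//.
rewrite -(@fubini_tonelli _ _ _ _ _ leb1 (leb n) (f \o @cons_rV R n)) => [//||x]; last exact: f0.
by apply: measurableT_comp => //; exact: measurable_cons_rV.
Qed.

Lemma fubini_rV n (f : 'rV[R]_n.+1 -> \bar R) : (leb n.+1).-integrable setT f ->
  \int[leb n.+1]_x f x = \int[leb1]_t \int[leb n]_y f (cons_rV (t, y)) /\
  \int[leb n.+1]_x f x = \int[leb n]_y \int[leb1]_t f (cons_rV (t, y)).
Proof.
move=> fi; have mf := measurable_int _ fi.
have mfc : measurable_fun setT (f \o @cons_rV R n).
  by apply: measurableT_comp => //; exact: measurable_cons_rV.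
have fci : (leb1 \x leb n).-integrable setT (f \o @cons_rV R n).
  apply/integrableP; split => //.
  have /integrableP[_] := fi; apply: le_lt_trans.
  rewrite le_eqVlt; apply/orP; left; apply/eqP.
  rewrite lebesgue_rVS ge0_integral_pushforward//; first exact: measurable_cons_rV.
  exact: measurableT_comp.
rewrite lebesgue_rVS integral_pushforward//; [|exact: measurable_cons_rV].
by rewrite preimage_setT -(integral12_prod_meas1 fci); split => //; exact: Fubini.
Qed.

Lemma measurable_inner_snd n (f : 'rV[R]_n.+1 -> \bar R) : measurable_fun setT f ->
  (forall x, 0 <= f x) ->
  measurable_fun setT (fun t => \int[leb n]_y f (cons_rV (t, y))).
Proof.
move=> mf f0; apply: (@measurable_fun_fubini_tonelli_F _ _ _ _ _ (leb n) (f \o @cons_rV R n)) => [|x]; last exact: f0.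
by apply: measurableT_comp => //; exact: measurable_cons_rV.
Qed.

Lemma measurable_inner_fst n (f : 'rV[R]_n.+1 -> \bar R) : measurable_fun setT f ->
  (forall x, 0 <= f x) ->
  measurable_fun setT (fun y => \int[leb1]_t f (cons_rV (t, y))).
Proof.
move=> mf f0; apply: (@measurable_fun_fubini_tonelli_G _ _ _ _ _ leb1 (f \o @cons_rV R n)) => [|x]; last exact: f0.
by apply: measurableT_comp => //; exact: measurable_cons_rV.
Qed.

Lemma measurable_slice_snd n (f : 'rV[R]_n.+1 -> \bar R) t : measurable_fun setT f ->
  measurable_fun setT (fun y => f (cons_rV (t, y))).
Proof.
move=> mf; apply: (measurableT_comp mf).
by apply: (measurableT_comp (@measurable_cons_rV R n)); exact: measurable_pair1.
Qed.

Lemma integral_rV0 (f : 'rV[R]_0 -> \bar R) : \int[leb 0]_x f x = f 0%R.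
Proof.
rewrite /= integral_dirac//; first by rewrite diracT mul1e.
move=> _ B mB; rewrite setTI.
have [f0|f0] := pselect (B (f 0%R)).
  rewrite (_ : _ @^-1` _ = setT) //; apply/seteqP; split => // x _ /=.
  by rewrite (_ : x = 0%R)//; apply/rowP => -[].
rewrite (_ : _ @^-1` _ = set0) //; apply/seteqP; split => // x /=.
by rewrite (_ : x = 0%R)//; apply/rowP => -[].
Qed.

Lemma measurable_norm_box n (M : R) : measurable [set x : 'rV[R]_n | `|x| <= M]%R.
Proof.
rewrite -[X in measurable X]setTI.
have mN : measurable_fun setT (fun x : 'rV[R]_n => `|x|%R).
  by apply: continuous_measurable_rV; exact: norm_continuous.
rewrite (_ : [set _ | _] = (fun x : 'rV[R]_n => `|x|%R) @^-1` `]-oo, M]%classic).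
  by apply: mN => //.
by apply/seteqP; split => x /=; rewrite in_itv.
Qed.

(** Induction on the dimension: the box lies in the product of an interval and a box of one
    dimension less. *)
Lemma norm_box_lty n (M : R) : leb n [set x | `|x| <= M]%R < +oo.
Proof.
elim: n => [|n ih].
  by rewrite /= diracE; case: (_ \in _); rewrite ltry.
apply: (@le_lt_trans _ _ ((leb1 \x leb n) (`[(- M)%R, M] `*` [set x | `|x| <= M]%R))).
  have -> : leb n.+1 [set x | `|x| <= M]%R =
      (leb1 \x leb n) (@cons_rV R n @^-1` [set x | `|x| <= M]%R) by [].
  apply: le_measure; rewrite ?inE.
  - rewrite -[X in measurable X]setTI; apply: measurable_cons_rV => //.
    exact: measurable_norm_box.
  - by apply: measurableX => //; exact: measurable_norm_box.
  - move=> p /= pM; split => /=; last exact: le_trans (norm_cons_rV_snd p) pM.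
    by rewrite in_itv/= -ler_norml (le_trans (norm_cons_rV_fst p) pM).
rewrite product_measure1E//; last exact: measurable_norm_box.
have itv : leb1 `[(- M)%R, M]%classic < +oo.
  by rewrite lebesgue_measure_itv/=; case: ifP => _; rewrite ?ltry.
by apply: lte_mul_pinfty => //; rewrite ge0_fin_numE.
Qed.

End integral_rV.

(** * Sobolev inequalities for compactly supported functions *)

Local Opaque lebesgue_rV.

Section smooth_compact_support.
Context {R : realType}.
Local Notation leb n := (@lebesgue_rV R n).
Local Notation leb1 := (@lebesgue_measure R).
Local Notation I n f := (\int[@lebesgue_rV R n]_x f x).

Definition supported (V : normedModType R) (M : R) (f : V -> R) := forall x, M < `|x| -> f x = 0.

(** The two difference quotients are the same function, so neither differentiability nor a chain
    rule is involved. *)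
Lemma derive_comp_affine (U V : normedModType R) (f : V -> R) (L : U -> V) (v : U) (w : V) a :
  (forall h, L (h *: v + a) = h *: w + L a) ->
  (derivable f (L a) w -> derivable (f \o L) a v) /\ 'D_v (f \o L) a = 'D_w f (L a).
Proof.
move=> La.
have E : (fun h : R => h^-1 *: ((f \o L \o shift a) (h *: v) - (f \o L) a)) =
         (fun h : R => h^-1 *: ((f \o shift (L a)) (h *: w) - f (L a))).
  by apply/funext => h; rewrite /= La.
by split; rewrite /derivable /derive E.
Qed.

(** The condition M < |x| is open, so [f] vanishes in a neighbourhood of such an x. *)
Lemma supported_derive (V : normedModType R) M (f : V -> R) v :
  supported M f -> supported M ('D_v f).
Proof.
move=> fM x Mx; have <- : 'D_v (cst (0 : R)) x = 0 by exact: derive_cst.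
apply: near_eq_derive.
have : \forall y \near x, M < `|y|.
  by apply: (cvgr_gt `|x|) => //; exact: norm_continuous.
by apply: filterS => y; exact: fM.
Qed.

Lemma derivable1_cts (g : R -> R) : (forall t, derivable g t 1) -> continuous g.
Proof. by move=> dg t; apply: differentiable_continuous; apply/derivable1_diffP. Qed.

Lemma integral_derive_itv (g : R -> R) a b : (forall t, derivable g t 1) ->
  continuous ('D_1 g) -> a < b ->
  (\int[leb1]_(t in `[a, b]) ('D_1 g t)%:E = (g b)%:E - (g a)%:E)%E.
Proof.
move=> dg cg ab; apply: continuous_FTC2 => //.
- exact: continuous_subspaceT.
- have cg' := derivable1_cts dg.
  split; [by move=> t _; exact: dg|exact/cvg_at_right_filter/cg'|exact/cvg_at_left_filter/cg'].
- by move=> t _; rewrite derive1E.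
Qed.

Lemma compact_support_line_bound (g : R -> R) M x : (forall t, derivable g t 1) ->
  continuous ('D_1 g) -> supported M g ->
  (`|g x|%:E <= \int[leb1]_t `|'D_1 g t|%:E)%E.
Proof.
move=> dg cg gM.
(* A point to the left of x and outside the support, from which the fundamental theorem of calculus
   starts at value 0. *)
pose a := - (`|M| + `|x| + 1).
have ax : a < x.
  by rewrite /a; have := ler_norm (- x); rewrite normrN; have := normr_ge0 M; lra.
have ga : g a = 0.
  apply: gM; rewrite /a normrN ger0_norm ?addr_ge0//.
  by have := ler_norm M; have := normr_ge0 x; lra.
have mg : measurable_fun setT ('D_1 g) by exact: continuous_measurable_fun.
have := integral_derive_itv dg cg ax; rewrite ga sube0 => h.
rewrite -[(`|g x|%:E)%E]/(`|(g x)%:E|)%E -h.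
apply: le_trans (le_abse_integral _ _ _) _ => //.
  by apply/measurable_EFinP; exact: measurable_funTS.
apply: ge0_subset_integral => //.
by apply/measurable_EFinP; apply: measurableT_comp.
Qed.

Lemma integral_derive_compact_support (g : R -> R) M : (forall t, derivable g t 1) ->
  continuous ('D_1 g) -> supported M g ->
  (\int[leb1]_t ('D_1 g t)%:E = 0)%E.
Proof.
move=> dg cg gM; pose K := `|M| + 1.
have MK : M < K by rewrite /K; have := ler_norm M; lra.
have K0 : 0 < K by rewrite /K ltr_wpDl.
have -> : (\int[leb1]_t ('D_1 g t)%:E = \int[leb1]_(t in `[(- K)%R, K]) ('D_1 g t)%:E)%E.
  rewrite [RHS]integral_mkcond; apply: eq_integral => t _; rewrite patchE.
  case: ifPn => //; rewrite notin_setE/= in_itv/= -ler_norml => /negP; rewrite -ltNge => Kt.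
  by rewrite (supported_derive (1 : R) gM)// (lt_trans MK).
rewrite integral_derive_itv//; last by lra.
by rewrite !gM ?subee// ?normrN gtr0_norm.
Qed.

Lemma bounded_support_intg n (f : 'rV[R]_n -> R) M : continuous f -> supported M f ->
  intg (leb n) setT f.
Proof.
move=> cf fM; pose K := `|M|; pose B := [set x : 'rV[R]_n | `|x| <= K].
have mB : measurable B := @measurable_norm_box R n K.
have cB : compact B.
  rewrite (_ : B = [set v | forall i, `[- K, K]%classic (v ord0 i)]).
    by apply: (@rV_compact R n (fun=> `[- K, K]%classic)) => _; exact: segment_compact.
  apply/seteqP; split => x; rewrite /B /=.
    by move=> /(norm_rV_leP _ (normr_ge0 M)) h i; rewrite in_itv/= -ler_norml h.
  by move=> h; apply/(norm_rV_leP _ (normr_ge0 M)) => i; have := h i; rewrite in_itv/= -ler_norml.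
have mf : measurable_fun setT f by exact: continuous_measurable_rV.
have bf : [bounded f x | x in B].
  have [N [Nr hN]] := compact_bounded (continuous_compact (continuous_subspaceT cf) cB).
  by exists N; split => // N' NN' x Bx; apply: (hN N' NN'); exists x.
have := measurable_bounded_integrable mB (@norm_box_lty R n K) (measurable_funTS mf) bf.
move/(integrable_mkcond _ mB); rewrite /intg (_ : _ \_ _ = EFin \o f)//.
apply/funext => x; rewrite patchE; case: ifPn => //; rewrite notin_setE /B/= => /negP.
by rewrite -ltNge /K => h; rewrite fM// (le_lt_trans (ler_norm M)).
Qed.

(** Only partial derivatives are required, so that the class is stable under products and slicing,
    as needed for |f|^2 and for induction on the dimension. *)
Record C1c n (f : 'rV[R]_n -> R) : Prop := {
  C1c_cts : continuous f ;
  C1c_der : forall x j, derivable f x (delta_mx ord0 j) ;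
  C1c_dcts : forall j, continuous (partial j f) ;
  C1c_supp : exists M, supported M f }.

Arguments C1c_cts {n f}.
Arguments C1c_der {n f}.
Arguments C1c_dcts {n f}.

Lemma C1c_psupp n (f : 'rV[R]_n -> R) j : C1c f -> exists M, supported M (partial j f).
Proof. by move=> cf; have [M fM] := C1c_supp cf; exists M; exact: supported_derive. Qed.

Lemma C1c_add n (f g : 'rV[R]_n -> R) : C1c f -> C1c g ->
  C1c (fun x => f x + g x) /\ forall j x, partial j (fun x => f x + g x) x = partial j f x + partial j g x.
Proof.
move=> cf cg.
have E j x : partial j (fun x => f x + g x) x = partial j f x + partial j g x.
  by rewrite /partial; apply: deriveD; [exact: (C1c_der cf)|exact: (C1c_der cg)].
split => //; split.
- by move=> x; exact: cvgD (C1c_cts cf x) (C1c_cts cg x).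
- by move=> x j; apply: derivableD; [exact: (C1c_der cf)|exact: (C1c_der cg)].
- move=> j; rewrite (_ : partial j _ = fun x => partial j f x + partial j g x); last exact/funext.
  by move=> x; exact: cvgD (C1c_dcts cf j x) (C1c_dcts cg j x).
- have [M fM] := C1c_supp cf; have [N gN] := C1c_supp cg.
  exists (Num.max M N) => x; rewrite gt_max => /andP[/fM -> /gN ->]; exact: addr0.
Qed.

Lemma C1c_mul n (f g : 'rV[R]_n -> R) : C1c f -> C1c g ->
  C1c (fun x => f x * g x) /\
  forall j x, partial j (fun x => f x * g x) x = f x * partial j g x + g x * partial j f x.
Proof.
move=> cf cg.
have E j x : partial j (fun x => f x * g x) x = f x * partial j g x + g x * partial j f x.
  by rewrite /partial; apply: deriveM; [exact: (C1c_der cf)|exact: (C1c_der cg)].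
split => //; split.
- by move=> x; exact: cvgM (C1c_cts cf x) (C1c_cts cg x).
- by move=> x j; apply: derivableM; [exact: (C1c_der cf)|exact: (C1c_der cg)].
- move=> j; rewrite (_ : partial j _ = fun x => f x * partial j g x + g x * partial j f x); last exact/funext.
  move=> x.
  exact: cvgD (cvgM (C1c_cts cf x) (C1c_dcts cg j x)) (cvgM (C1c_cts cg x) (C1c_dcts cf j x)).
- have [M fM] := C1c_supp cf.
  by exists M => x /fM ->; rewrite mul0r.
Qed.

Lemma partial_slice n (f : 'rV[R]_n.+1 -> R) t k y :
  partial k (fun y => f (cons_rV (t, y))) y = partial (lift ord0 k) f (cons_rV (t, y)).
Proof.
apply: (derive_comp_affine (L := fun y => cons_rV (t, y)) f _).2 => h.
by rewrite -cons_rV_deltaS -cons_rV_lin mulr0 add0r.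
Qed.

Lemma C1c_slice n (f : 'rV[R]_n.+1 -> R) t : C1c f -> C1c (fun y => f (cons_rV (t, y))).
Proof.
move=> cf; split.
- move=> y; apply: (@continuous_comp _ _ _ (fun y => cons_rV (t, y)) f).
    exact: continuous_cons_rV_snd.
  exact: (C1c_cts cf).
- move=> y k.
  have La h : cons_rV (t, h *: delta_mx ord0 k + y) = h *: delta_mx ord0 (lift ord0 k) + cons_rV (t, y).
    by rewrite -cons_rV_deltaS -cons_rV_lin mulr0 add0r.
  exact: (derive_comp_affine (L := fun y => cons_rV (t, y)) f La).1 (C1c_der cf _ _).
- move=> k; rewrite (_ : partial k _ = fun y => partial (lift ord0 k) f (cons_rV (t, y))).
    move=> y; apply: (@continuous_comp _ _ _ (fun y => cons_rV (t, y)) _).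
      exact: continuous_cons_rV_snd.
    exact: (C1c_dcts cf).
  by apply/funext => y; exact: partial_slice.
- have [M fM] := C1c_supp cf; exists M => y My; apply: fM.
  exact: lt_le_trans My (norm_cons_rV_snd (t, y)).
Qed.

Lemma derive_line n (f : 'rV[R]_n.+1 -> R) y t : C1c f ->
  derivable (fun t => f (cons_rV (t, y))) t 1 /\
  'D_1 (fun t => f (cons_rV (t, y))) t = partial ord0 f (cons_rV (t, y)).
Proof.
move=> cf.
have La h : cons_rV (h *: (1 : R) + t, y) = h *: delta_mx ord0 ord0 + cons_rV (t, y).
  by rewrite -cons_rV_delta0 -cons_rV_lin scaler0 add0r.
have [A B] := derive_comp_affine (L := fun t => cons_rV (t, y)) f La.
by split => //; apply: A; exact: (C1c_der cf).
Qed.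

Lemma line_conditions n (f : 'rV[R]_n.+1 -> R) y : C1c f ->
  [/\ forall t, derivable (fun t => f (cons_rV (t, y))) t 1,
      forall t, 'D_1 (fun t => f (cons_rV (t, y))) t = partial ord0 f (cons_rV (t, y)),
      continuous ('D_1 (fun t => f (cons_rV (t, y)))) &
      exists M, supported M (fun t => f (cons_rV (t, y)))].
Proof.
move=> cf; split.
- by move=> t; exact: (derive_line y t cf).1.
- by move=> t; exact: (derive_line y t cf).2.
- rewrite (_ : (fun t => _) = (fun t => partial ord0 f (cons_rV (t, y)))); last first.
    by apply/funext => t; exact: (derive_line y t cf).2.
  move=> t; apply: (@continuous_comp _ _ _ (fun t => cons_rV (t, y)) _).
    exact: continuous_cons_rV_fst.
  exact: (C1c_dcts cf).
- have [M fM] := C1c_supp cf; exists M => t Mt; apply: fM.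
  exact: lt_le_trans Mt (norm_cons_rV_fst (t, y)).
Qed.

Lemma C1c_line_bound n (f : 'rV[R]_n.+1 -> R) t y : C1c f ->
  (`|f (cons_rV (t, y))|%:E <= \int[leb1]_s `|partial ord0 f (cons_rV (s, y))|%:E)%E.
Proof.
move=> cf; have [dg E cg [M gM]] := line_conditions y cf.
apply: (le_trans (compact_support_line_bound t dg cg gM)).
by under eq_integral do rewrite E.
Qed.

Lemma C1c_intg n (f : 'rV[R]_n -> R) : C1c f -> intg (leb n) setT f.
Proof.
by move=> cf; have [M fM] := C1c_supp cf; apply: (bounded_support_intg _ fM); exact: (C1c_cts cf).
Qed.

Lemma C1c_partial_intg n (f : 'rV[R]_n -> R) j : C1c f -> intg (leb n) setT (partial j f).
Proof.
by move=> cf; have [M fM] := C1c_psupp j cf; apply: (bounded_support_intg _ fM); exact: (C1c_dcts cf).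
Qed.

(** Induction on the dimension: Fubini integrates a derivative along the first axis over lines
    first, and any other derivative over slices first. *)
Lemma integral_partial n (f : 'rV[R]_n -> R) j : C1c f ->
  (\int[leb n]_x (partial j f x)%:E = 0)%E.
Proof.
elim: n f j => [f []//|n ih f j cf].
have [F1 F2] := fubini_rV (C1c_partial_intg j cf).
case: (unliftP ord0 j) F1 F2 => [k ->|->] F1 F2.
  rewrite [LHS]F1; apply: integral0_eq => t _.
  under eq_integral do rewrite /= -partial_slice.
  by apply: ih; exact: C1c_slice.
rewrite [LHS]F2; apply: integral0_eq => y _.
have [dg E cg [M gM]] := line_conditions y cf.
rewrite -[RHS](integral_derive_compact_support dg cg gM).
by apply: eq_integral => t _; rewrite E.
Qed.

Lemma measurable_abs_cts n (f : 'rV[R]_n -> R) : continuous f ->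
  measurable_fun setT (fun x => `|f x|%:E).
Proof.
move=> cf; apply/measurable_EFinP; apply: measurableT_comp => //.
exact: continuous_measurable_rV.
Qed.

(** The line bound controls |f(t,y)| by an integral along the line that no longer depends on t; it
    remains to integrate over y. *)
Lemma C1c_slice_bound n (f : 'rV[R]_n.+1 -> R) t : C1c f ->
  (\int[leb n]_y `|f (cons_rV (t, y))|%:E <= \int[leb n.+1]_x `|partial ord0 f x|%:E)%E.
Proof.
move=> cf.
have mf := measurable_abs_cts (C1c_cts cf).
have mp := measurable_abs_cts (C1c_dcts cf ord0).
rewrite tonelli_rV_swap//; apply: ge0_le_integral => //.
- exact: (measurable_slice_snd t mf).
- exact: (measurable_inner_fst mp).
- by move=> y _; exact: C1c_line_bound.
Qed.

Lemma abs_intg n (f : 'rV[R]_n -> R) : intg (leb n) setT f -> intg (leb n) setT (fun x => `|f x|).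
Proof. exact: integrable_norm. Qed.

Lemma ler_EFin_mul (x y z : R) (X Y Z : \bar R) : x%:E = X -> y%:E = Y -> z%:E = Z ->
  (X <= Y * Z)%E -> x <= y * z.
Proof. by move=> <- <- <-; rewrite -EFinM lee_fin. Qed.

(** The slice bound is integrated over t in [-M, M], outside of which the slices vanish; the factor
    is the length 2 M. *)
Lemma C1c_poincare n (f : 'rV[R]_n.+1 -> R) (M : R) : C1c f -> 0 <= M -> supported M f ->
  I n.+1 (fun x => `|f x|) <= 2 * M * I n.+1 (fun x => `|partial ord0 f x|).
Proof.
move=> cf M0 fM.
have If := abs_intg (C1c_intg cf).
have Ip := abs_intg (C1c_partial_intg ord0 cf).
rewrite -lee_fin EFinM (EFin_I measurableT If) (EFin_I measurableT Ip).
have mf := measurable_abs_cts (C1c_cts cf).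
set A := (\int[leb n.+1]_x `|partial ord0 f x|%:E)%E.
have A0 : (0 <= A)%E by exact: integral_ge0.
rewrite tonelli_rV//.
apply: (@le_trans _ _ (\int[leb1]_t (A * (\1_(`[- M, M]%classic) t)%:E))%E).
  apply: ge0_le_integral => //.
  - by move=> t _; exact: integral_ge0.
  - exact: (measurable_inner_snd mf).
  - apply: measurable_funeM; apply/measurable_EFinP; exact: measurable_indic.
  - move=> t _; rewrite indicE; have [_|] := boolP (t \in `[- M, M]%classic).
      by rewrite mule1; exact: C1c_slice_bound.
    rewrite notin_setE/= in_itv/= -ler_norml => /negP; rewrite -ltNge => Mt.
    rewrite mule0 integral0_eq// => y _.
    by rewrite fM ?normr0// (lt_le_trans Mt (norm_cons_rV_fst (t, y))).
rewrite ge0_integralZl//; last by apply/measurable_EFinP; exact: measurable_indic.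
rewrite integral_indic// setIT muleC lee_wpmul2r//.
have : (leb1 `[(- M)%R, M]%classic <= (2 * M)%:E)%E; last by [].
rewrite lebesgue_measure_itv/= lte_fin; case: ifP => _; last by rewrite lee_fin; lra.
by rewrite -EFinD lee_fin; lra.
Qed.

(** |f(t,y)| is at most P(y), by integrating along the line, and at most Q(t), by the sup bound on
    the slice; the integral of P(y) Q(t) factorises. The slice hypothesis is a one-dimensional fact,
    supplied by [C1c_sup_bound1]. *)
Lemma C1c_square_bound n (k : 'I_n) (f : 'rV[R]_n.+1 -> R) :
  (forall g, C1c g -> forall y, (`|g y|%:E <= \int[leb n]_z `|partial k g z|%:E)%E) ->
  C1c f ->
  I n.+1 (fun x => f x ^+ 2) <=
  I n.+1 (fun x => `|partial ord0 f x|) * I n.+1 (fun x => `|partial (lift ord0 k) f x|).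
Proof.
move=> slice_sup cf.
have I0 := abs_intg (C1c_partial_intg ord0 cf).
have I1 := abs_intg (C1c_partial_intg (lift ord0 k) cf).
have If2 : intg (leb n.+1) setT (fun x => f x ^+ 2) := C1c_intg (C1c_mul cf cf).1.
apply: (ler_EFin_mul (EFin_I measurableT If2) (EFin_I measurableT I0) (EFin_I measurableT I1)).
have mf2 := intg_measurable If2.
have mp0 := measurable_abs_cts (C1c_dcts cf ord0).
have mp1 := measurable_abs_cts (C1c_dcts cf (lift ord0 k)).
pose P y := (\int[leb1]_s `|partial ord0 f (cons_rV (s, y))|%:E)%E.
pose Q t := (\int[leb n]_y `|partial (lift ord0 k) f (cons_rV (t, y))|%:E)%E.
have P0 y : (0 <= P y)%E by exact: integral_ge0.
have Q0 t : (0 <= Q t)%E by exact: integral_ge0.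
have mP : measurable_fun setT P by exact: (measurable_inner_fst mp0).
have mQ : measurable_fun setT Q by exact: (measurable_inner_snd mp1).
have fQ t y : (`|f (cons_rV (t, y))|%:E <= Q t)%E.
  apply: le_trans (slice_sup _ (C1c_slice t cf) y) _.
  rewrite le_eqVlt; apply/orP; left; apply/eqP.
  by apply: eq_integral => z _; rewrite partial_slice.
rewrite tonelli_rV//; last first.
- by move=> x; rewrite lee_fin sqr_ge0.
- exact/measurable_EFinP.
have EP : (\int[leb n.+1]_x `|partial ord0 f x|%:E = \int[leb n]_y P y)%E.
  have p0 x : (0 <= `|partial ord0 f x|%:E)%E by [].
  by rewrite (tonelli_rV_swap mp0 p0).
have EQ : (\int[leb n.+1]_x `|partial (lift ord0 k) f x|%:E = \int[leb1]_t Q t)%E.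
  exact: (@tonelli_rV R n (fun x => `|partial (lift ord0 k) f x|%:E)).
rewrite EP EQ; set IP := (\int[leb n]_y P y)%E.
have IP0 : (0 <= IP)%E by exact: integral_ge0.
apply: (@le_trans _ _ (\int[leb1]_t (IP * Q t))%E); last first.
  by rewrite le_eqVlt; apply/orP; left; apply/eqP; exact: ge0_integralZl.
apply: ge0_le_integral => //.
- by move=> t _; apply: integral_ge0 => y _; rewrite lee_fin sqr_ge0.
- apply: (measurable_inner_snd (f := fun x => (f x ^+ 2)%:E)); first exact/measurable_EFinP.
  by move=> x; rewrite lee_fin sqr_ge0.
- exact: measurable_funeM.
- move=> t _; rewrite muleC.
  apply: (@le_trans _ _ (\int[leb n]_y (Q t * P y))%E); last first.
    by rewrite le_eqVlt; apply/orP; left; apply/eqP; exact: ge0_integralZl.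
  apply: ge0_le_integral => //.
  + by move=> y _; rewrite lee_fin sqr_ge0.
  + apply: (measurable_slice_snd t (f := fun x => (f x ^+ 2)%:E)); exact/measurable_EFinP.
  + exact: measurable_funeM.
  + move=> y _; rewrite -real_normK ?num_real// expr2 EFinM.
    apply: lee_pmul => //; exact: C1c_line_bound.
Qed.


(** In dimension 1 the slices are single points of unit mass, so the slice bound is already a sup
    bound. *)
Lemma C1c_sup_bound1 (g : 'rV[R]_1 -> R) : C1c g ->
  forall y, (`|g y|%:E <= \int[leb 1]_z `|partial ord0 g z|%:E)%E.
Proof.
move=> cg y; have := C1c_slice_bound (y ord0 ord0) cg; rewrite integral_rV0.
rewrite (_ : cons_rV _ = y)//; apply/rowP => i; rewrite (ord1 i).
by rewrite (_ : 0 = ord0 :> 'I_1) ?cons_rV0.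
Qed.

Definition sqmod n (a b : 'rV[R]_n -> R) x := a x * a x + b x * b x.

Definition sqgrad n (a b : 'rV[R]_n -> R) j x := partial j a x ^+ 2 + partial j b x ^+ 2.

Lemma sqmod_ge0 n (a b : 'rV[R]_n -> R) x : 0 <= sqmod a b x.
Proof. by rewrite /sqmod -!expr2 addr_ge0// sqr_ge0. Qed.

Lemma sqgrad_ge0 n (a b : 'rV[R]_n -> R) j x : 0 <= sqgrad a b j x.
Proof. by rewrite /sqgrad addr_ge0// sqr_ge0. Qed.

Lemma C1c_sqmod n (a b : 'rV[R]_n -> R) : C1c a -> C1c b ->
  C1c (sqmod a b) /\ forall j x, partial j (sqmod a b) x = 2 * (a x * partial j a x + b x * partial j b x).
Proof.
move=> ca cb; have [caa Ea] := C1c_mul ca ca; have [cbb Eb] := C1c_mul cb cb.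
have [cF E] := C1c_add caa cbb; split => // j x.
by rewrite [LHS]E Ea Eb; ring.
Qed.

Lemma sqgrad_cts n (a b : 'rV[R]_n -> R) j : C1c a -> C1c b -> continuous (sqgrad a b j).
Proof.
move=> ca cb x.
exact: cvgD (cvgM (C1c_dcts ca j x) (C1c_dcts ca j x)) (cvgM (C1c_dcts cb j x) (C1c_dcts cb j x)).
Qed.

Lemma sqgrad_intg n (a b : 'rV[R]_n -> R) j : C1c a -> C1c b -> intg (leb n) setT (sqgrad a b j).
Proof.
move=> ca cb; have [M aM] := C1c_psupp j ca; have [N bN] := C1c_psupp j cb.
apply: (@bounded_support_intg _ _ (Num.max M N)); first exact: sqgrad_cts.
by move=> x; rewrite gt_max /sqgrad => /andP[/aM -> /bN ->]; rewrite expr0n addr0.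
Qed.

Lemma sqmod_intg n (a b : 'rV[R]_n -> R) : C1c a -> C1c b -> intg (leb n) setT (sqmod a b).
Proof. by move=> ca cb; apply: C1c_intg; exact: (C1c_sqmod ca cb).1. Qed.

Lemma sqmod_sq_intg n (a b : 'rV[R]_n -> R) : C1c a -> C1c b ->
  intg (leb n) setT (fun x => sqmod a b x ^+ 2).
Proof.
move=> ca cb; have [cF _] := C1c_sqmod ca cb; exact: C1c_intg (C1c_mul cF cF).1.
Qed.

(** The discriminant in t of the integral of |f|^2 - t |D_j(|f|^2)| + t^2 |D_j f|^2. Its integrand
    is a sum of two squares, with signs depending on that of the derivative of |f|^2. *)
Lemma partial_sqmod_cs n (a b : 'rV[R]_n -> R) j : C1c a -> C1c b ->
  I n (fun x => `|partial j (sqmod a b) x|) ^+ 2 <= 4 * I n (sqmod a b) * I n (sqgrad a b j).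
Proof.
move=> ca cb; have [cF E] := C1c_sqmod ca cb.
have IF := C1c_intg cF; have IG := sqgrad_intg j ca cb.
have IP := abs_intg (C1c_partial_intg j cF).
set A := I n (fun x => `|_|).
have : (- A / 2) ^+ 2 <= I n (sqmod a b) * I n (sqgrad a b j).
  apply: discriminant_le => [|t].
    by apply: Rintegral_ge0 => x _; exact: sqgrad_ge0.
  rewrite (_ : _ + _ = I n (fun x => 1 * (1 * sqmod a b x + - t * `|partial j (sqmod a b) x|) +
     t ^+ 2 * sqgrad a b j x)); last first.
    by rewrite !I_lin//; [rewrite /A; lra|exact: intg_lin].
  apply: Rintegral_ge0 => x _; rewrite E /sqmod /sqgrad !normrM (@ger0_norm _ 2)//.
  have [p0|p0] := leP 0 (a x * partial j a x + b x * partial j b x).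
    rewrite ger0_norm//.
    have := sqr_ge0 (a x - t * partial j a x); have := sqr_ge0 (b x - t * partial j b x); lra.
  rewrite ltr0_norm//.
  have := sqr_ge0 (a x + t * partial j a x); have := sqr_ge0 (b x + t * partial j b x); lra.
lra.
Qed.

Lemma mul_le_of_sqr_le (A0 A1 F G0 G1 : R) : 0 <= F -> 0 <= G0 -> 0 <= G1 ->
  A0 ^+ 2 <= 4 * F * G0 -> A1 ^+ 2 <= 4 * F * G1 -> A0 * A1 <= 2 * F * (G0 + G1).
Proof.
move=> F0 G00 G10 h0 h1.
apply: sqr_le; first by rewrite !mulr_ge0// addr_ge0.
rewrite exprMn; apply: (@le_trans _ _ ((4 * F * G0) * (4 * F * G1))).
  by apply: ler_pM => //; exact: sqr_ge0.
have := mulr_ge0 (sqr_ge0 F) (sqr_ge0 (G0 - G1)); lra.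
Qed.

(** Apply the square bound to |f|^2: the L^1 norms of its two derivatives bound the integral of
    |f|^4, and each is at most twice the product of the L^2 norms of f and of D_j f. *)
Lemma ladyzhenskaya2 (a b : 'rV[R]_2 -> R) : C1c a -> C1c b ->
  I 2 (fun x => sqmod a b x ^+ 2) <=
  2 * I 2 (sqmod a b) * I 2 (fun x => \sum_(j < 2) sqgrad a b j x).
Proof.
move=> ca cb; have [cF E] := C1c_sqmod ca cb.
apply: (le_trans (C1c_square_bound C1c_sup_bound1 cF)).
have G_ge0 j : 0 <= I 2 (sqgrad a b j) by apply: Rintegral_ge0 => x _; exact: sqgrad_ge0.
have F_ge0 : 0 <= I 2 (sqmod a b) by apply: Rintegral_ge0 => x _; exact: sqmod_ge0.
have h := mul_le_of_sqr_le F_ge0 (G_ge0 ord0) (G_ge0 (lift ord0 ord0))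
  (partial_sqmod_cs ord0 ca cb) (partial_sqmod_cs (lift ord0 ord0) ca cb).
apply: (le_trans h); rewrite (I_sum measurableT (fun j => sqgrad_intg j ca cb)).
by rewrite big_ord_recl big_ord1.
Qed.

Lemma sqgrad_slice n (a b : 'rV[R]_n.+1 -> R) t j y :
  sqgrad (fun y => a (cons_rV (t, y))) (fun y => b (cons_rV (t, y))) j y =
  sqgrad a b (lift ord0 j) (cons_rV (t, y)).
Proof. by rewrite /sqgrad !partial_slice. Qed.

(** Raises the dimension by one: the inequality holds on each slice, the slice mass of |f|^2 is
    bounded uniformly by the L^1 norm of its derivative across the slices, and the result is
    integrated over t. *)
Lemma ladyzhenskaya_succ n (a b : 'rV[R]_n.+1 -> R) :
  (forall a' b', C1c a' -> C1c b' -> I n (fun x => sqmod a' b' x ^+ 2) <=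
     2 * I n (sqmod a' b') * I n (fun x => \sum_(j < n) sqgrad a' b' j x)) ->
  C1c a -> C1c b ->
  I n.+1 (fun x => sqmod a b x ^+ 2) <=
  2 * I n.+1 (fun x => `|partial ord0 (sqmod a b) x|) * I n.+1 (fun x => \sum_(j < n.+1) sqgrad a b j x).
Proof.
move=> lady ca cb; have [cF E] := C1c_sqmod ca cb.
pose G := fun x => \sum_(j < n) sqgrad a b (lift ord0 j) x.
have IG : intg (leb n.+1) setT G by apply: intg_sum => // j; exact: sqgrad_intg.
have IA := abs_intg (C1c_partial_intg ord0 cF).
have IF2 := sqmod_sq_intg ca cb.
have G0 x : 0 <= G x by apply: sumr_ge0 => j _; exact: sqgrad_ge0.
have A_ge0 : 0 <= I n.+1 (fun x => `|partial ord0 (sqmod a b) x|) by exact: Rintegral_ge0.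
apply: (@le_trans _ _ (2 * I n.+1 (fun x => `|partial ord0 (sqmod a b) x|) * I n.+1 G)); last first.
  rewrite ler_wpM2l ?mulr_ge0//.
  apply: (I_le measurableT) => //; first by apply: intg_sum => // j; exact: sqgrad_intg.
  by apply: aeW => x _; rewrite [leRHS]big_ord_recl lerDr sqgrad_ge0.
set A := I n.+1 (fun x => `|_|) in A_ge0 *.
apply: (ler_EFin_mul (EFin_I measurableT IF2) erefl (EFin_I measurableT IG)).
have mF2 : measurable_fun setT (fun x => (sqmod a b x ^+ 2)%:E).
  by apply/measurable_EFinP; exact: intg_measurable IF2.
have mG : measurable_fun setT (fun x => (G x)%:E).
  by apply/measurable_EFinP; exact: intg_measurable IG.
have F2E x : (0 <= (sqmod a b x ^+ 2)%:E)%E by rewrite lee_fin sqr_ge0.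
have GE x : (0 <= (G x)%:E)%E by rewrite lee_fin.
rewrite (tonelli_rV mF2 F2E) (tonelli_rV mG GE).
have mGi := measurable_inner_snd mG GE.
apply: (@le_trans _ _ (\int[leb1]_t ((2 * A)%:E * \int[leb n]_y (G (cons_rV (t, y)))%:E))%E); last first.
  rewrite le_eqVlt; apply/orP; left; apply/eqP; apply: ge0_integralZl => //.
    by move=> t _; exact: integral_ge0.
  by rewrite lee_fin mulr_ge0.
- apply: ge0_le_integral => //.
  - by move=> t _; apply: integral_ge0.
  - exact: (measurable_inner_snd mF2 F2E).
  - exact: measurable_funeM.
  - move=> t _.
    pose a' y := a (cons_rV (t, y)); pose b' y := b (cons_rV (t, y)).
    have ca' : C1c a' := C1c_slice t ca; have cb' : C1c b' := C1c_slice t cb.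
    have IG' : intg (leb n) setT (fun y => \sum_(j < n) sqgrad a' b' j y).
      by apply: intg_sum => // j; exact: sqgrad_intg.
    have e1 := EFin_I measurableT (sqmod_sq_intg ca' cb').
    have e2 := EFin_I measurableT IG'.
    have GG : (\int[leb n]_y (G (cons_rV (t, y)))%:E =
               \int[leb n]_y (\sum_(j < n) sqgrad a' b' j y)%:E)%E.
      by apply: eq_integral => y _; congr EFin; apply: eq_bigr => j _; rewrite -sqgrad_slice.
    have FA : I n (sqmod a' b') <= A.
      rewrite -lee_fin (EFin_I measurableT (sqmod_intg ca' cb')) /A (EFin_I measurableT IA).
      apply: le_trans (C1c_slice_bound t cF); rewrite le_eqVlt; apply/orP; left; apply/eqP.
      by apply: eq_integral => y _; rewrite ger0_norm ?sqmod_ge0.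
    rewrite GG -[leLHS]e1 -[X in (_ <= _ * X)%E]e2 -EFinM lee_fin.
    have G'0 : 0 <= I n (fun x => \sum_(j < n) sqgrad a' b' j x).
      by apply: Rintegral_ge0 => y _; apply: sumr_ge0 => j _; exact: sqgrad_ge0.
    exact: le_trans (lady _ _ ca' cb') (ler_wpM2r G'0 (ler_wpM2l (ler0n _ 2) FA)).
Qed.

Lemma poincare_sqmod n (a b : 'rV[R]_n.+1 -> R) (M : R) : C1c a -> C1c b -> 0 <= M ->
  supported M a -> supported M b ->
  I n.+1 (sqmod a b) <= 16 * M ^+ 2 * I n.+1 (fun x => \sum_(j < n.+1) sqgrad a b j x) /\
  I n.+1 (fun x => `|partial ord0 (sqmod a b) x|) <=
    8 * M * I n.+1 (fun x => \sum_(j < n.+1) sqgrad a b j x).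
Proof.
move=> ca cb M0 aM bM; have [cF E] := C1c_sqmod ca cb.
have FM : supported M (sqmod a b).
  by move=> x Mx; rewrite /sqmod aM// bM// mulr0 addr0.
have := C1c_poincare cF M0 FM.
have -> : I n.+1 (fun x => `|sqmod a b x|) = I n.+1 (sqmod a b).
  by apply: eq_Rintegral => x _; rewrite ger0_norm ?sqmod_ge0.
have := partial_sqmod_cs ord0 ca cb.
have : I n.+1 (sqgrad a b ord0) <= I n.+1 (fun x => \sum_(j < n.+1) sqgrad a b j x).
  apply: (I_le measurableT); first exact: sqgrad_intg.
    by apply: intg_sum => // j; exact: sqgrad_intg.
  apply: aeW => x _; rewrite big_ord_recl lerDl.
  by apply: sumr_ge0 => j _; exact: sqgrad_ge0.
have F_ge0 : 0 <= I n.+1 (sqmod a b) by apply: Rintegral_ge0 => x _; exact: sqmod_ge0.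
have G_ge0 : 0 <= I n.+1 (sqgrad a b ord0) by apply: Rintegral_ge0 => x _; exact: sqgrad_ge0.
have A_ge0 : 0 <= I n.+1 (fun x => `|partial ord0 (sqmod a b) x|) by exact: Rintegral_ge0.
move: F_ge0 G_ge0 A_ge0; set F := I _ (sqmod a b); set G0 := I _ (sqgrad _ _ _).
set G := \int[leb n.+1]_x \sum_(j < n.+1) sqgrad a b j x.
set A := \int[leb n.+1]_x `|partial ord0 (sqmod a b) x| => F0 G00 A0 G0G h1 h2.
clearbody F G0 G A.
(* A^2 <= 4 F G0 and F <= 2 M A give A^2 <= 8 M A G, so one factor A cancels. *)
have A8 : A <= 8 * M * G.
  have : A ^+ 2 <= A * (8 * M * G).
    apply: (le_trans h1); apply: (@le_trans _ _ (4 * (2 * M * A) * G0)).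
      by rewrite ler_wpM2r// ler_wpM2l.
    have -> : A * (8 * M * G) = 4 * (2 * M * A) * G by ring.
    by rewrite ler_wpM2l// !mulr_ge0.
  have [A00|A00] := leP A 0.
    by move=> _; apply: (le_trans A00); rewrite !mulr_ge0// (le_trans G00).
  by rewrite expr2 ler_pM2l.
split => //; apply: (le_trans h2).
have := ler_wpM2l (mulr_ge0 (ler0n R 2) M0) A8; lra.
Qed.

(** Dimension 2 accounts for the first summand and dimension 3 for the second; the sum serves both
    at once. *)
Lemma compact_support_L4 d (a b : 'rV[R]_d -> R) (M : R) : d = 2%N \/ d = 3%N ->
  C1c a -> C1c b -> 0 <= M -> supported M a -> supported M b ->
  I d (fun x => sqmod a b x ^+ 2) <=
    32 * M ^+ 2 * I d (fun x => \sum_(j < d) sqgrad a b j x) ^+ 2 + 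
    16 * M * I d (fun x => \sum_(j < d) sqgrad a b j x) ^+ 2.
Proof.
move=> d23; case: d23 a b => -> a b ca cb M0 aM bM;
  have [h1 h2] := poincare_sqmod ca cb M0 aM bM.
- apply: (le_trans (ladyzhenskaya2 ca cb)).
  have G0 : 0 <= \int[leb 2]_x \sum_(j < 2) sqgrad a b j x.
    by apply: Rintegral_ge0 => x _; apply: sumr_ge0 => j _; exact: sqgrad_ge0.
  move: h1 h2 G0; set F := I _ (sqmod _ _); set G := \int[leb 2]_x \sum_(j < 2) sqgrad a b j x.
  set A := \int[leb 2]_x `|partial ord0 (sqmod a b) x| => h1 h2 G0.
  clearbody F A G.
  have := ler_wpM2r G0 h1; have := mulr_ge0 M0 (sqr_ge0 G); lra.
- apply: (le_trans (ladyzhenskaya_succ ladyzhenskaya2 ca cb)).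
  have G0 : 0 <= \int[leb 3]_x \sum_(j < 3) sqgrad a b j x.
    by apply: Rintegral_ge0 => x _; apply: sumr_ge0 => j _; exact: sqgrad_ge0.
  move: h1 h2 G0; set F := I _ (sqmod _ _); set G := \int[leb 3]_x \sum_(j < 3) sqgrad a b j x.
  set A := \int[leb 3]_x `|partial ord0 (sqmod a b) x| => h1 h2 G0.
  clearbody F A G.
  have := ler_wpM2r G0 h2; have := mulr_ge0 (sqr_ge0 M) (sqr_ge0 G); lra.
Qed.

End smooth_compact_support.

(** * Bump functions *)

Section flat_functions.
Context {R : realType}.
Implicit Types (c t : R) (m : nat).

(* The derivatives of [flat] are combinations of its other members, so it is smooth when [c > 0]. *)
Definition flat c m t : R := if 0 < t then t^-1 ^+ m * expR (- c * t^-1) else 0.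

(** From e^x >= x^(m+2) / (m+2)! at x = c/h. The exponent exceeds m by two so that a factor h^2
    survives, which makes the derivative at 0 vanish. *)
Lemma flat_bound c m : 0 < c -> exists C : R, forall h, `|flat c m h| <= C * h ^+ 2.
Proof.
move=> c0; pose C := (m.+2)`!%:R / c ^+ m.+2 : R; exists C => h.
have C0 : 0 <= C by rewrite divr_ge0// exprn_ge0// ltW.
rewrite /flat; case: ifPn => h0; last by rewrite normr0 mulr_ge0// sqr_ge0.
have x0 : 0 <= c * h^-1 by rewrite mulr_ge0// ?invr_ge0; exact: ltW.
have := expR_ge1Dxn m.+1 x0.
set x := c * h^-1 in x0 *; set N := (m.+2)`!%:R => ex.
have N0 : 0 < N :> R by rewrite ltr0n fact_gt0.
have xx : 0 < x ^+ m.+2 by rewrite exprn_gt0// mulr_gt0// invr_gt0.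
rewrite ger0_norm; last by rewrite mulr_ge0 ?expR_ge0// exprn_ge0// invr_ge0 ltW.
have -> : - c * h^-1 = - x by rewrite mulNr.
rewrite expRN.
apply: (@le_trans _ _ (h^-1 ^+ m * (x ^+ m.+2 / N)^-1)).
  apply: ler_wpM2l; first by rewrite exprn_ge0// invr_ge0 ltW.
  rewrite lef_pV2 ?posrE ?divr_gt0 ?expR_gt0//.
  by apply: le_trans ex; rewrite lerDr.
rewrite /C -/N /x exprMn.
have hm : h ^+ m != 0 by rewrite expf_neq0// gt_eqF.
have cm : c ^+ m.+2 != 0 by rewrite expf_neq0// gt_eqF.
have hE : h ^+ m.+2 = h ^+ m * h ^+ 2 by rewrite -exprD addn2.
have h2 : h != 0 by rewrite gt_eqF.
have N2 : N != 0 by rewrite gt_eqF.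
rewrite !exprVn hE le_eqVlt; apply/orP; left; apply/eqP.
move: (h ^+ m) (c ^+ m.+2) N hm cm N2 {C0 C ex N0 xx hE} => hm cm N hm0 cm0 N2.
by field; rewrite h2 hm0 cm0 N2.
Qed.

Lemma is_derive_flat c m t : 0 < c ->
  is_derive t 1 (flat c m) (- m%:R * flat c m.+1 t + c * flat c m.+2 t).
Proof.
move=> c0; have [t0|t0|->] := ltgtP t 0.
- have -> : - m%:R * flat c m.+1 t + c * flat c m.+2 t = 0.
    by rewrite /flat lt_gtF// !mulr0 addr0.
  have H : is_derive t 1 (fun _ : R => 0 : R) 0 by exact: is_derive_cst.
  apply: near_eq_is_derive H.
  have : \forall y \near t, y < 0 by exact: (@cvgr_lt _ _ (nbhs t) _ id t cvg_id 0 t0).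
  by apply: filterS => y y0; rewrite /flat lt_gtF.
- pose g := fun s : R => s^-1 ^+ m * expR (- c * s^-1).
  apply: (@near_eq_is_derive _ _ _ g).
    have : \forall y \near t, 0 < y by exact: (@cvgr_gt _ _ (nbhs t) _ id t cvg_id 0 t0).
    by apply: filterS => y y0; rewrite /flat y0.
  have tn0 : t != 0 by rewrite gt_eqF.
  have dV : is_derive t 1 (fun s : R => s^-1) (- t ^- 2).
    have := @is_deriveV R id t 1 1 tn0 (is_derive_id _ _).
    by rewrite /GRing.scale/= mulr1.
  have dX := @is_deriveX R _ _ m t 1 _ dV.
  have dc : is_derive t 1 (fun s : R => - c * s^-1) (- c * - t ^- 2).
    exact: (is_deriveZ (- c) dV).
  have dE := @is_derive1_comp _ expR (fun s => - c * s^-1) t _ _ (is_derive_expR (- c * t^-1)) dc.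
  have := is_deriveM dX dE.
  rewrite (_ : _ * _ = g); last by rewrite exprfctE.
  rewrite exprfctE.
  rewrite (_ : _ + _ = - m%:R * flat c m.+1 t + c * flat c m.+2 t)//.
  rewrite /flat t0 /GRing.scale/=; case: m {g dX} => [|m]; rewrite /= -!exprVn !exprS ?expr0; ring.
- have -> : - m%:R * flat c m.+1 0 + c * flat c m.+2 0 = 0.
    by rewrite /flat ltxx !mulr0 addr0.
  have [C hC] := flat_bound m c0.
  have C0 : 0 <= C by have := hC 1; rewrite expr1n mulr1; apply: le_trans.
  (* By [flat_bound] the difference quotient at 0 is at most C |h|. *)
  have H : (fun h : R => h^-1 *: ((flat c m \o shift 0) (h *: (1 : R)) - flat c m 0)) @ 0^' --> (0 : R).
    apply/cvgrPdist_lt => e e0; near=> h.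
    have h0 : h != 0 by near: h; exact: nbhs_dnbhs_neq.
    rewrite sub0r normrN {2}/flat ltxx subr0 /= /shift/= addr0 /GRing.scale/= mulr1.
    rewrite normrM normfV ltr_pdivrMl ?normr_gt0//.
    apply: (le_lt_trans (hC h)); rewrite -real_normK ?num_real// expr2 mulrCA.
    rewrite ltr_pM2l ?normr_gt0//.
    have : `|h| < e / (C + 1) by near: h; apply: dnbhs0_lt; rewrite divr_gt0// ltr_wpDl.
    rewrite ltr_pdivlMr ?ltr_wpDl//; have := normr_ge0 h; lra.
  by apply: DeriveDef; [exact: (cvgP _ H)|exact: (cvg_lim _ H)].
Unshelve. all: by end_near. Qed.

Lemma flat0_ge0 c t : 0 <= flat c 0 t.
Proof. by rewrite /flat; case: ifP => // _; rewrite mulr_ge0// expR_ge0. Qed.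

Lemma flat0_le1 c t : 0 <= c -> flat c 0 t <= 1.
Proof.
move=> c0; rewrite /flat; case: ifP => // t0.
by rewrite expr0 mul1r -expR0 ler_expR mulNr oppr_le0 mulr_ge0// invr_ge0 ltW.
Qed.

(** As c tends to 0, exp(-c/t) tends to 1 for t > 0; this lets bumps approximate indicators of
    boxes. *)
Lemma cvg_flat0 t : (fun k => flat k.+1%:R^-1 0 t) @ \oo --> ((0 < t)%R%:R : R).
Proof.
have [t0|t0] := ltP 0 t; last first.
  rewrite (_ : (fun k => _) = fun=> 0); first exact: cvg_cst.
  by apply/funext => k; rewrite /flat ltNge t0.
rewrite (_ : (fun k => _) = expR \o (fun k => - k.+1%:R^-1 * t^-1)); last first.
  by apply/funext => k; rewrite /flat t0 expr0 mul1r.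
have -> : (true%:R : R) = expR (- 0 * t^-1) by rewrite oppr0 mul0r expR0.
apply: continuous_cvg; first exact: continuous_expR.
apply: cvgM; last exact: cvg_cst.
by apply: cvgN; exact: cvg_harmonic.
Qed.

End flat_functions.

Section bump_functions.
Context {R : realType} {d : nat}.
Local Notation Rd := 'rV[R]_d.
Implicit Types (f g : Rd -> R) (a b : Rd).

Lemma derive_comp_form (f : R -> R) (f' : R) (L : Rd -> R) (v : Rd) (w : R) (a : Rd) :
  (forall h, L (h *: v + a) = h * w + L a) -> is_derive (L a) 1 f f' ->
  'D_v (f \o L) a = w * f'.
Proof.
move=> La df.
have La' h : L (h *: v + a) = h *: (w : R) + L a by rewrite La.
rewrite (derive_comp_affine f La').2.
have dfL : differentiable f (L a) by apply/derivable1_diffP.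
rewrite deriveE// -[w in LHS]mulr1 -[w * 1]/(w *: (1 : R)) linearZ/= -deriveE//.
by rewrite (derive_val).
Qed.

(** An algebra of functions that contains the bumps and is closed under [partial]. All its members
    being differentiable, smoothness follows by induction on the list of derivatives, with no
    formula for the iterated ones. *)
Inductive flat_poly : (Rd -> R) -> Prop :=
| flat_poly_atom (c : R) m i (s b : R) : 0 < c -> flat_poly (fun x => flat c m (s * x ord0 i + b))
| flat_poly_cst (c : R) : flat_poly (fun=> c)
| flat_poly_add f g : flat_poly f -> flat_poly g -> flat_poly (fun x => f x + g x)
| flat_poly_mul f g : flat_poly f -> flat_poly g -> flat_poly (fun x => f x * g x).

Lemma flat_poly_diff f : flat_poly f -> forall x, differentiable f x.
Proof.
elim=> [c m i s b c0|c|{}f g _ df _ dg|{}f g _ df _ dg] x.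
- apply: (@differentiable_comp _ _ _ _ (fun x : Rd => s * x ord0 i + b) (flat c m)).
    apply: differentiableD; last exact: differentiable_cst.
    by apply: differentiableM; [exact: differentiable_cst|exact: differentiable_coord].
  apply/derivable1_diffP; exact: (@ex_derive _ _ _ _ _ _ _ (is_derive_flat m _ c0)).
- exact: differentiable_cst.
- exact: differentiableD.
- exact: differentiableM.
Qed.

Lemma flat_poly_partial f j : flat_poly f -> flat_poly (partial j f).
Proof.
move=> ff; elim: ff => [c m i s b c0|c|{}f g ff hf fg hg|{}f g ff hf fg hg].
- rewrite (_ : partial j _ = fun x => (s * (i == j)%:R) *
     (- m%:R * flat c m.+1 (s * x ord0 i + b) + c * flat c m.+2 (s * x ord0 i + b))).
    apply: flat_poly_mul; first exact: flat_poly_cst.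
    by apply: flat_poly_add; apply: flat_poly_mul; try exact: flat_poly_cst; exact: flat_poly_atom.
  apply/funext => x; rewrite /partial.
  apply: (@derive_comp_form (flat c m) _ (fun x : Rd => s * x ord0 i + b)) => [h|].
    by rewrite !mxE eqxx/=; ring.
  exact: is_derive_flat.
- rewrite (_ : partial j _ = fun=> 0); first exact: flat_poly_cst.
  by apply/funext => x; exact: derive_cst.
- rewrite (_ : partial j _ = fun x => partial j f x + partial j g x); first exact: flat_poly_add.
  by apply/funext => x; apply: deriveD; apply: diff_derivable; exact: flat_poly_diff.
- rewrite (_ : partial j _ = fun x => f x * partial j g x + g x * partial j f x).
    by apply: flat_poly_add; exact: flat_poly_mul.
  by apply/funext => x; apply: deriveM; apply: diff_derivable; exact: flat_poly_diff.
Qed.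

Lemma flat_poly_smooth f : flat_poly f -> smooth f.
Proof.
move=> ff s; apply: flat_poly_diff.
by elim: s => //= j s ih; exact: flat_poly_partial.
Qed.

(** The factors have the form s x_i + b with s = 1 and s = -1 in order to match [flat_poly_atom]. *)
Definition bump c a b (x : Rd) : R :=
  \prod_(i < d) (flat c 0 (1 * x ord0 i + - a ord0 i) * flat c 0 (-1 * x ord0 i + b ord0 i)).

Definition obox a b := [set x : Rd | forall i, a ord0 i < x ord0 i < b ord0 i].

Definition cbox a b := [set x : Rd | forall i, a ord0 i <= x ord0 i <= b ord0 i].

Lemma flat_poly_prod (I : Type) (s : seq I) (F : I -> Rd -> R) :
  (forall i, flat_poly (F i)) -> flat_poly (fun x => \prod_(i <- s) F i x).
Proof.
move=> hF; elim: s => [|i s ih].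
  by rewrite (_ : (fun _ => _) = (fun=> 1)); [exact: flat_poly_cst|apply/funext => x; rewrite big_nil].
rewrite (_ : (fun _ => _) = (fun x => F i x * \prod_(j <- s) F j x)); first exact: flat_poly_mul.
by apply/funext => x; rewrite big_cons.
Qed.

Lemma bump_smooth c a b : 0 < c -> smooth (bump c a b).
Proof.
move=> c0; apply: flat_poly_smooth; apply: flat_poly_prod => i.
by apply: flat_poly_mul; exact: flat_poly_atom.
Qed.

Lemma bump_out c a b x : ~ cbox a b x -> bump c a b x = 0.
Proof.
move=> /existsNP[i /negP]; rewrite negb_and -!ltNge => h.
rewrite /bump (bigD1 i)//= /flat; case/orP: h => h.
  by rewrite (_ : 0 < 1 * x ord0 i - a ord0 i = false) ?mul0r//; apply/negbTE; rewrite -leNgt; lra.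
rewrite (_ : 0 < -1 * x ord0 i + b ord0 i = false) ?mulr0 ?mul0r//.
by apply/negbTE; rewrite -leNgt; lra.
Qed.

Lemma bump_ge0 c a b x : 0 <= bump c a b x.
Proof. by apply: prodr_ge0 => i _; rewrite mulr_ge0 ?flat0_ge0. Qed.

Lemma bump_le1 c a b x : 0 <= c -> bump c a b x <= 1.
Proof.
move=> c0; apply: prodr_ile1 => i _; rewrite mulr_ge0 ?flat0_ge0//=.
by rewrite mulr_ile1 ?flat0_ge0 ?flat0_le1.
Qed.

Lemma cvg_prod_seq (I : Type) (s : seq I) (u : I -> nat -> R) (l : I -> R) :
  (forall i, u i @ \oo --> l i) ->
  (fun k => \prod_(i <- s) u i k) @ \oo --> \prod_(i <- s) l i.
Proof.
move=> h; elim: s => [|i s ih].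
  rewrite big_nil (_ : (fun _ => _) = (fun=> 1)); first exact: cvg_cst.
  by apply/funext => k; rewrite big_nil.
rewrite big_cons (_ : (fun _ => _) = (fun k => u i k * \prod_(j <- s) u j k)); first exact: cvgM.
by apply/funext => k; rewrite big_cons.
Qed.

Lemma cvg_bump a b x : (fun k => bump k.+1%:R^-1 a b x) @ \oo --> (\1_(obox a b) x : R).
Proof.
have -> : \1_(obox a b) x = \prod_(i < d) ((0 < 1 * x ord0 i + - a ord0 i)%R%:R *
    (0 < -1 * x ord0 i + b ord0 i)%R%:R) :> R.
  rewrite indicE; have [/set_mem h|/negP h] := boolP (x \in obox a b).
    rewrite big1// => i _; have /andP[h1 h2] := h i.
    have -> : 0 < 1 * x ord0 i + - a ord0 i by lra.
    have -> : 0 < -1 * x ord0 i + b ord0 i by lra.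
    by rewrite mulr1.
  have /existsNP[i hi] : ~ obox a b x by move=> k; apply: h; exact: mem_set.
  move/negP : hi; rewrite negb_and -!leNgt => /orP hi.
  rewrite (bigD1 i)//=; case: hi => hi.
    have -> : 0 < 1 * x ord0 i + - a ord0 i = false by apply/negbTE; rewrite -leNgt; lra.
    by rewrite !mul0r.
  have -> : 0 < -1 * x ord0 i + b ord0 i = false by apply/negbTE; rewrite -leNgt; lra.
  by rewrite mulr0 mul0r.
by apply: cvg_prod_seq => i; apply: cvgM; exact: cvg_flat0.
Qed.

Lemma compact_cbox a b : compact (cbox a b).
Proof.
rewrite (_ : cbox a b = [set v | forall i, `[a ord0 i, b ord0 i]%classic (v ord0 i)]).
  by apply: (@rV_compact R d (fun i => `[a ord0 i, b ord0 i]%classic)) => i; exact: segment_compact.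
by apply/seteqP; split => x h i; have := h i; rewrite /= in_itv.
Qed.

Lemma smooth_C1c f M : smooth f -> supported M f -> C1c f.
Proof.
move=> sf fM; split.
- by move=> x; apply: differentiable_continuous; exact: (sf [::]).
- by move=> x j; apply: diff_derivable; exact: (sf [::]).
- by move=> j x; apply: differentiable_continuous; exact: (sf [:: j]).
- by exists M.
Qed.

Lemma smooth_partial f j : smooth f -> smooth (partial j f).
Proof. by move=> sf s; have := sf (rcons s j); rewrite foldr_rcons. Qed.

Lemma smooth_continuous f : smooth f -> continuous f.
Proof. by move=> sf x; apply: differentiable_continuous; exact: (sf [::]). Qed.

Lemma smooth_partial_lin (c : R) f g j x : smooth f -> smooth g ->
  partial j (fun x => c * f x + g x) x = c * partial j f x + partial j g x.
Proof.
move=> sf sg; rewrite /partial.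
have df := @diff_derivable _ _ _ f x (delta_mx ord0 j) (sf [::] x).
have dg := @diff_derivable _ _ _ g x (delta_mx ord0 j) (sg [::] x).
rewrite (_ : (fun x0 => _) = (c \*: f) + g)//.
by rewrite deriveD ?deriveZ//; exact: derivableZ.
Qed.

Lemma smooth_lin (c : R) f g : smooth f -> smooth g -> smooth (fun x => c * f x + g x).
Proof.
move=> sf sg s.
have -> : foldr partial (fun x => c * f x + g x) s =
   (fun x => c * foldr partial f s x + foldr partial g s x).
  elim: s => //= j s ->; apply/funext => x.
  apply: smooth_partial_lin.
    by move=> s'; rewrite -foldr_cat; exact: sf.
  by move=> s'; rewrite -foldr_cat; exact: sg.
move=> x; apply: differentiableD; last exact: sg.
by apply: differentiableZ; exact: sf.
Qed.

Lemma smooth_cst0 : smooth (fun _ : Rd => 0 : R).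
Proof. exact/flat_poly_smooth/flat_poly_cst. Qed.

End bump_functions.

(** * The fundamental lemma of the calculus of variations *)

Section fundamental_lemma.
Context {R : realType} {d : nat}.
Local Notation Rd := 'rV[R]_d.
Local Notation mu := (@lebesgue_rV R d).

Definition rtest (D : set Rd) (psi : Rd -> R) := smooth psi /\
  exists K : set Rd, [/\ compact K, K `<=` D & forall x, ~ K x -> psi x = 0].

Lemma dominated_integral0 dT (T : measurableType dT) (nu : {measure set T -> \bar R})
    (D : set T) (f_ : nat -> T -> R) (f h : T -> R) : measurable D ->
  (forall n, measurable_fun D (f_ n)) -> measurable_fun D f ->
  (forall x, D x -> f_ ^~ x @ \oo --> f x) -> intg nu D h ->
  (forall n x, D x -> `|f_ n x| <= h x) ->
  (forall n, \int[nu]_(x in D) f_ n x = 0) -> \int[nu]_(x in D) f x = 0.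
Proof.
move=> mD mf_ mf ff ih fh f0.
have if_ n : intg nu D (f_ n) by apply: (intg_dom mD _ ih) => // x Dx; exact: fh.
have mfE n : measurable_fun D (EFin \o f_ n) by exact/measurable_EFinP.
have mE : measurable_fun D (EFin \o f) by exact/measurable_EFinP.
have [] := @dominated_convergence _ _ _ nu D mD (fun n => EFin \o f_ n) (EFin \o f) (EFin \o h) mfE mE.
- by apply: aeW => x Dx; apply: cvg_EFin; [exact: nearW|exact: ff].
- exact: ih.
- by apply: aeW => x n Dx; rewrite lee_fin fh.
move=> _ _; rewrite (_ : [sequence _]_n = fun=> 0%E); last first.
  by apply/funext => n /=; rewrite -(EFin_I mD (if_ n)) f0.
move=> c0; have := cvg_unique _ c0 (cvg_cst _) => E.
have {}E : (\int[nu]_(x in D) (f x)%:E = 0)%E := E (@ereal_hausdorff R) _ _.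
by rewrite /Rintegral E.
Qed.

Variables (D : set Rd) (oD : open D).
Let mD : measurable D := open_measurable_rV oD.

Lemma rtest_bump c a b : 0 < c -> cbox a b `<=` D -> rtest D (bump c a b).
Proof.
move=> c0 ab; split; first exact: bump_smooth.
by exists (cbox a b); split => //; [exact: compact_cbox|exact: bump_out].
Qed.

Lemma measurable_obox (a b : Rd) : measurable (obox a b).
Proof.
rewrite (_ : obox a b = \bigcap_(i in [set: 'I_d])
    ((fun y : Rd => y ord0 i) @^-1` `]a ord0 i, b ord0 i[%classic)).
  apply: fin_bigcap_measurable => // i _; rewrite -[X in measurable X]setTI.
  by apply: measurable_coor.
by apply/seteqP; split => [x h i _|x h i]; [rewrite /= in_itv/=; exact: h|have := h i I; rewrite /= in_itv].
Qed.

Section vanishing.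
Variables (g : Rd -> R) (ig : intg mu D g).
Hypothesis g_test : forall psi, rtest D psi -> \int[mu]_(x in D) (g x * psi x) = 0.

Lemma intg_mul_indic (A : set Rd) : measurable A -> intg mu D (fun x => g x * \1_A x).
Proof.
move=> mA; apply: (intg_dom mD _ (integrable_norm ig)) => [|x _].
  apply: measurable_funM; first exact: intg_measurable ig.
  exact: measurable_indic.
by rewrite /= normrM ler_piMr// indicE; case: (_ \in _); rewrite ?normr1 ?normr0.
Qed.

Lemma box_integral0 a b : cbox a b `<=` D -> \int[mu]_(x in D) (g x * \1_(obox a b) x) = 0.
Proof.
move=> abD.
apply: (@dominated_integral0 _ _ mu D (fun k x => g x * bump k.+1%:R^-1 a b x) _ (fun x => `|g x|)) => //.
- move=> k; apply: measurable_funM; first exact: intg_measurable ig.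
  apply: measurable_funTS; apply: continuous_measurable_rV; apply: smooth_continuous.
  by apply: bump_smooth; rewrite invr_gt0.
- by have /intg_measurable := intg_mul_indic (measurable_obox a b).
- by move=> x _; apply: cvgM; [exact: cvg_cst|exact: cvg_bump].
- exact: (integrable_norm ig).
- move=> k x _; rewrite normrM ler_piMr// ger0_norm ?bump_ge0//.
  by apply: bump_le1; rewrite invr_ge0.
- by move=> k; apply: g_test; apply: rtest_bump => //; rewrite invr_gt0.
Qed.

(** A pi-system generating the Borel sets. Its members meet an open box in an open box, where the
    integral is already known to vanish. *)
Definition rays : set (set Rd) := [set A | exists b : Rd, A = [set x : Rd | forall i, x ord0 i < b ord0 i]].

Lemma rays_setI : setI_closed rays.
Proof.
move=> _ _ [b ->] [b' ->]; exists (\row_i Num.min (b ord0 i) (b' ord0 i)).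
apply/seteqP; split => [x [h1 h2] i|x h]; first by rewrite mxE lt_min h1 h2.
by split => i; have := h i; rewrite mxE lt_min => /andP[].
Qed.

Lemma measurable_sub_rays (A : set Rd) : measurable A -> <<s rays >> A.
Proof.
pose T := g_sigma_algebraType rays.
have mc i : measurable_fun [set: T] (fun x : T => (x : Rd) ord0 i).
  apply: (measurability _ (RGenInftyO.measurableE R)).
  move=> _ [_ [b ->] <-]; rewrite setTI.
  (* A half-space in one coordinate is the increasing union of rays whose other bounds are k. *)
  pose F (k : nat) := [set x : Rd | forall j, x ord0 j < (\row_j (if j == i then b else k%:R)) ord0 j].
  rewrite (_ : _ @^-1` _ = \bigcup_k F k).
    apply: bigcupT_measurable => k; apply: sub_sigma_algebra.
    by exists (\row_j (if j == i then b else k%:R)).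
  apply/seteqP; split => [x|x [k _ h]]; last first.
    by have := h i; rewrite mxE eqxx /= in_itv.
  rewrite /= in_itv/= => xb; exists (Num.bound `|x|) => // j; rewrite mxE.
  case: eqP => [->//|_]; apply: le_lt_trans (ler_norm _) _.
  by apply: le_lt_trans (norm_coor_le x j) _; exact: archi_boundP.
apply: smallest_sub; first exact: smallest_sigma_algebra.
rewrite -bigcup_seq => B [i _] [C mC <-].
exact: mc.
Qed.

(** Dynkin's argument: the sets A with this property form a lambda-system that contains [rays]. *)
Lemma box_indic_integral0 a b (A : set Rd) : cbox a b `<=` D -> measurable A ->
  \int[mu]_(x in D) (g x * \1_(A `&` obox a b) x) = 0.
Proof.
move=> abD mA; set Q := obox a b; have mQ : measurable Q by exact: measurable_obox.
pose H := [set A : set Rd | measurable A /\ \int[mu]_(x in D) (g x * \1_(A `&` Q) x) = 0].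
suff : H A by case.
apply: (@lambda_system_subset _ rays rays_setI setT H) => //; last exact: measurable_sub_rays.
- split => //.
  + by split => //; rewrite setTI; exact: box_integral0.
  + move=> B C CB [mB B0] [mC C0]; split; first exact: measurableD.
    have -> : (fun x => g x * \1_((B `\` C) `&` Q) x) =
       (fun x => 1 * (g x * \1_(B `&` Q) x) + (-1) * (g x * \1_(C `&` Q) x)).
      apply/funext => x; rewrite [in RHS]indicI [in RHS]indicI.
      have -> : \1_((B `\` C) `&` Q) x = (\1_B x - \1_C x) * \1_Q x :> R.
        rewrite indicI /=; congr (_ * _); rewrite !indicE; have [Cx|nCx] := pselect (C x).
          rewrite (mem_set Cx) (mem_set (CB _ Cx)) memNset ?subrr// => -[].
          by [].
        rewrite (memNset nCx) subr0; congr ((_ : bool)%:R).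
        by apply/idP/idP => /set_mem h; apply/mem_set => //; case: h.
      by rewrite /=; ring.
    by rewrite I_lin ?B0 ?C0; [ring|exact: mD|apply: intg_mul_indic; exact: measurableI..].
  + move=> F ndF HF.
    have mF i : measurable (F i) by have [] := HF i.
    split; first exact: bigcupT_measurable.
    apply: (@dominated_integral0 _ _ mu D (fun k x => g x * \1_(F k `&` Q) x) _ (fun x => `|g x|)) => //.
    * by move=> k; have /intg_measurable := intg_mul_indic (measurableI _ _ (mF k) mQ).
    * have /intg_measurable := intg_mul_indic (measurableI _ _ (bigcupT_measurable F mF) mQ).
      exact.
    * move=> x _; apply: cvgM; first exact: cvg_cst.
      have [[k _ Fkx]|nF] := pselect ((\bigcup_i F i) x); last first.
        rewrite (_ : (fun _ => _) = fun=> \1_(\bigcup_i F i `&` Q) x); first exact: cvg_cst.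
        apply/funext => k; rewrite !indicE; congr ((_ : bool)%:R).
        by apply/idP/idP => /set_mem[Fx _]; case: nF => //; exists k.
      apply: cvg_near_cst; exists k => // m /= km.
      rewrite !indicE; congr ((_ : bool)%:R); apply/idP/idP => /set_mem[Fx Qx]; apply/mem_set; split => //.
        by exists m.
      by move: Fkx; exact/subsetPset/ndF.
    * exact: (integrable_norm ig).
    * move=> k x _; rewrite normrM ler_piMr// indicE.
      by case: (_ \in _); rewrite ?normr1 ?normr0.
    * by move=> k; have [] := HF k.
- move=> _ [b' ->]; split.
    apply: open_measurable_rV; rewrite openE => x hx.
    (* The default value 1 of the minimum keeps e positive even in the absence of coordinates. *)
    pose e : R := \big[Num.min/1]_i (b' ord0 i - x ord0 i).
    have e0 : 0 < e.
      by apply: lt_bigmin => [|i _]; [exact: ltr01|rewrite subr_gt0; exact: hx].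
    rewrite /interior; apply/nbhs_ballP; exists e => //= y /(ball_rVP _ _ e0) h i.
    have : e <= b' ord0 i - x ord0 i by exact: bigmin_le_cond.
    by have := h i; rewrite ltr_norml => /andP[]; lra.
  pose b2 : Rd := \row_i Num.min (b ord0 i) (b' ord0 i).
  rewrite (_ : _ `&` Q = obox a b2); last first.
    apply/seteqP; split => [x [h1 h2] i|x h].
      by rewrite mxE lt_min h1; have /andP[-> ->] := h2 i.
    by split => i; have := h i; rewrite mxE lt_min => /andP[] h1 /andP[] h2 h3; rewrite ?h1.
  apply: box_integral0 => x h; apply: abD => i.
  by have /andP[-> ] := h i; rewrite mxE le_min => /andP[].
Qed.

(** Take for A the set where g > 0: the integrand is then nonnegative with zero integral. *)
Lemma box_ae_le0 a b : cbox a b `<=` D ->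
  {ae mu, forall x, D x -> obox a b x -> g x <= 0}.
Proof.
move=> abD; set Q := obox a b; have mQ : measurable Q by exact: measurable_obox.
pose A := D `&` g @^-1` `]0, +oo[%classic.
have mA : measurable A by exact: (intg_measurable ig).
have h0 := box_indic_integral0 abD mA.
have : {ae mu, forall x, D x -> g x * \1_(A `&` Q) x = 0}.
  apply: (I_eq0_ae mD) => //; first by apply: intg_mul_indic; exact: measurableI.
  move=> x Dx; rewrite indicE; have [/set_mem[[_ gx] _]|_] := boolP (_ \in _).
    by move: gx; rewrite /= in_itv/= andbT mulr1 => /ltW.
  by rewrite mulr0.
apply: filterS => x h Dx Qx; rewrite leNgt; apply/negP => gx.
have := h Dx; rewrite indicE mem_set ?mulr1; first by move=> g0; rewrite g0 ltxx in gx.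
by split => //; split => //=; rewrite in_itv/= andbT.
Qed.

End vanishing.

Lemma fundamental_lemma (g : Rd -> R) : intg mu D g ->
  (forall psi, rtest D psi -> \int[mu]_(x in D) (g x * psi x) = 0) ->
  {ae mu, forall x, D x -> g x = 0}.
Proof.
move=> ig g0.
have iNg : intg mu D (fun x => - g x).
  by have := integrableN ig; rewrite /intg.
have Ng0 psi : rtest D psi -> \int[mu]_(x in D) (- g x * psi x) = 0.
  move=> [spsi [K [cK KD psi0]]]; rewrite -[RHS](g0 (fun x => (-1) * psi x + 0)).
    by apply: eq_Rintegral => x _; ring.
  split; first exact: smooth_lin spsi smooth_cst0.
  by exists K; split => // x /psi0 ->; rewrite mulr0 addr0.
pose c (p : 'rV[rat]_d) : Rd := map_mx ratr p.
pose lo p (k : nat) : Rd := \row_i (c p ord0 i - k.+1%:R^-1).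
pose hi p (k : nat) : Rd := \row_i (c p ord0 i + k.+1%:R^-1).
(* Boxes with rational centres and half-widths 1/(k+1) are enumerated through [unpickle], so that
   their exceptional null sets can be united. *)
have key (n : nat) : {ae mu, forall x, D x ->
    if unpickle n is Some (p, k) then
      cbox (lo p k) (hi p k) `<=` D -> obox (lo p k) (hi p k) x -> g x = 0 else True}.
  case: (unpickle n : option ('rV[rat]_d * nat)%type) => [[p k]|]; last exact: aeW.
  have [pD|npD] := pselect (cbox (lo p k) (hi p k) `<=` D); last first.
    by apply: aeW => x _ /npD.
  have h1 := box_ae_le0 ig g0 pD; have h2 := box_ae_le0 iNg Ng0 pD.
  apply: filterS2 h1 h2 => x h1 h2 Dx _ Qx; apply/eqP; rewrite eq_le h1//=.
  by rewrite -oppr_le0 h2.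
apply: filterS (ae_foralln key) => x h Dx.
have [q [k [h1 h2]]] := open_cube_cover oD Dx.
have := h (pickle (q, k)) Dx; rewrite pickleK; apply.
- move=> y hy; apply: h2 => i; have := hy i; rewrite !mxE => /andP[a1 a2].
  move: (k.+1%:R^-1) (ratr _) (y _ _) a1 a2 => r s t a1 a2.
  by rewrite ler_norml; apply/andP; split; lra.
- move=> i; have := h1 i; rewrite !mxE ltr_norml => /andP[].
  move: (k.+1%:R^-1) (ratr _) (x _ _) => r s t a1 a2.
  by apply/andP; split; lra.
Qed.

End fundamental_lemma.

(** * Weak derivatives and the closure of test functions *)

Lemma poincare_sqmod_pos {R : realType} d (a b : 'rV[R]_d -> R) (M : R) : (0 < d)%N ->
  C1c a -> C1c b -> 0 <= M -> supported M a -> supported M b ->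
  \int[lebesgue_rV d]_x sqmod a b x <=
    16 * M ^+ 2 * \int[lebesgue_rV d]_x \sum_(j < d) sqgrad a b j x.
Proof.
case: d a b => // n a b _ ca cb M0 aM bM.
exact: (poincare_sqmod ca cb M0 aM bM).1.
Qed.

Lemma cvgn_expr {R : realType} (u : nat -> R) (l : R) n : u @ \oo --> l ->
  (fun k => u k ^+ n) @ \oo --> l ^+ n.
Proof.
move=> ul; elim: n => [|n ih]; first exact: cvg_cst.
under eq_fun do rewrite exprS.
by rewrite exprS; exact: cvgM.
Qed.

Section weak_derivatives.
Context {R : realType} {d : nat}.
Local Notation Rd := 'rV[R]_d.
Local Notation mu := (@lebesgue_rV R d).
Variables (D : set Rd) (oD : open D) (M : R) (DM : forall x, D x -> `|x| <= M).
Let mD : measurable D := open_measurable_rV oD.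
Local Notation I f := (\int[mu]_(x in D) (f x)).
Implicit Types (a u f psi phi : Rd -> R) (g : 'I_d -> Rd -> R).

Lemma bounded_domain_lty : (mu D < +oo)%E.
Proof.
apply: (le_lt_trans _ (@norm_box_lty R d M)); apply: le_measure => //.
- by rewrite inE.
- by rewrite inE; exact: measurable_norm_box.
Qed.

Lemma intg_cst (c : R) : intg mu D (fun=> c).
Proof.
apply/integrableP; split; first exact/measurable_EFinP/measurable_cst.
under eq_integral do rewrite abse_EFin.
by rewrite integral_cst//; apply: lte_mul_pinfty => //; exact: bounded_domain_lty.
Qed.

Lemma L2_intg f : L2 mu D f -> intg mu D f.
Proof.
move=> [mf If]; apply: (intg_dom mD mf (intgD mD If (intg_cst 1))) => x _ /=.
have := sqr_ge0 (`|f x| - 1); rewrite -(real_normK (num_real (f x))).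
have := sqr_ge0 (`|f x|); nra.
Qed.

Lemma compact_closed_rV (K : set Rd) : compact K -> closed K.
Proof. by apply: compact_closed; exact: norm_hausdorff. Qed.

Lemma rtest_partial psi j : rtest D psi -> rtest D (partial j psi).
Proof.
move=> [spsi [K [cK KD psi0]]]; split; first exact: smooth_partial.
exists K; split => // x nKx; rewrite /partial.
have <- : 'D_(delta_mx ord0 j) (cst (0 : R)) x = 0 by exact: derive_cst.
apply: near_eq_derive; have : nbhs x (~` K).
  by apply: open_nbhs_nbhs; split => //; apply: closed_openC; exact: compact_closed_rV.
by apply: filterS => y /psi0.
Qed.

Lemma rtest_off psi x : rtest D psi -> ~ D x -> psi x = 0.
Proof. by move=> [_ [K [_ KD psi0]]] nDx; apply: psi0 => /KD. Qed.

Lemma rtest_supported psi : rtest D psi -> supported M psi.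
Proof. by move=> tpsi x Mx; apply: (rtest_off tpsi) => /DM; rewrite leNgt Mx. Qed.

Lemma rtest_C1c psi : rtest D psi -> C1c psi.
Proof. by move=> tpsi; apply: (smooth_C1c tpsi.1); exact: rtest_supported. Qed.

Lemma rtest0 : rtest D (fun=> 0).
Proof.
split; first exact: smooth_cst0.
by exists set0; split => //; exact: compact0.
Qed.

Lemma rtest_lin (c : R) phi psi : rtest D phi -> rtest D psi -> rtest D (fun x => c * phi x + psi x).
Proof.
move=> [sphi [K [cK KD phi0]]] [spsi [K' [cK' KD' psi0]]]; split; first exact: smooth_lin.
exists (K `|` K'); split; first exact: compactU.
- by rewrite subUset.
- by move=> x /not_orP[nK nK']; rewrite phi0 ?psi0// mulr0 addr0.
Qed.

Lemma I_extend f : (forall x, ~ D x -> f x = 0) -> I f = \int[mu]_x f x.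
Proof.
move=> f0; rewrite /Rintegral integral_mkcond; congr fine; apply: eq_integral => x _.
rewrite /patch; case: ifPn => // /negP nDx; rewrite f0// => Dx.
by apply: nDx; exact: mem_set.
Qed.

Lemma intg_restrict f : intg mu setT f -> intg mu D f.
Proof. by move=> h; apply: (integrableS measurableT) h. Qed.

Lemma rtest_L2 psi : rtest D psi -> L2 mu D psi.
Proof.
move=> tpsi; have cpsi := rtest_C1c tpsi; split.
  by apply: measurable_funTS; apply: continuous_measurable_rV; exact: C1c_cts.
by apply: intg_restrict; exact: C1c_intg (C1c_mul cpsi cpsi).1.
Qed.

Definition weak_deriv j u f := forall psi, rtest D psi ->
  I (fun x => u x * partial j psi x) = - I (fun x => f x * psi x).

(** The derivative of phi psi has zero integral over the whole space, and both functions vanish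
    outside D. *)
Lemma weak_deriv_rtest phi j : rtest D phi -> weak_deriv j phi (partial j phi).
Proof.
move=> tphi psi tpsi.
have cphi := rtest_C1c tphi; have cpsi := rtest_C1c tpsi.
have [cF E] := C1c_mul cphi cpsi.
have tp := rtest_partial j tphi; have tq := rtest_partial j tpsi.
apply/eqP; rewrite -addr_eq0; apply/eqP.
rewrite -I_D//; [|by apply: (L2_mul mD); exact: rtest_L2..].
rewrite -[RHS](_ : \int[mu]_x (partial j (fun x => phi x * psi x) x) = 0); last first.
  by rewrite /Rintegral integral_partial.
rewrite -I_extend; last by move=> x nDx; rewrite E (rtest_off tphi)// (rtest_off tpsi)// !mul0r addr0.
by apply: eq_Rintegral => x _; rewrite E (mulrC (partial j phi x)).
Qed.

Lemma weak_deriv_uniq j u f f' : L2 mu D f -> L2 mu D f' ->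
  weak_deriv j u f -> weak_deriv j u f' -> {ae mu, forall x, D x -> f x = f' x}.
Proof.
move=> Lf Lf' uf uf'.
have : {ae mu, forall x, D x -> f x - f' x = 0}.
  apply: (fundamental_lemma oD) => [|psi tpsi]; first exact: L2_intg (L2_B mD Lf Lf').
  rewrite (_ : (fun _ => _) = (fun x => 1 * (f x * psi x) + (-1) * (f' x * psi x))); last first.
    by apply/funext => x; ring.
  rewrite I_lin//; [|by apply: (L2_mul mD) => //; exact: rtest_L2..].
  by have := uf _ tpsi; rewrite (uf' _ tpsi); lra.
by apply: filterS => x h /h /eqP; rewrite subr_eq0 => /eqP.
Qed.

(* The squared L^2 distance to such pairs bounds the defect in [weak_deriv]. *)
Lemma weak_deriv_closed j u f : L2 mu D u -> L2 mu D f ->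
  (forall e : R, 0 < e -> exists u' f', [/\ L2 mu D u', L2 mu D f', weak_deriv j u' f',
     I (fun x => (u x - u' x) ^+ 2) <= e & I (fun x => (f x - f' x) ^+ 2) <= e]) ->
  weak_deriv j u f.
Proof.
move=> Lu Lf h psi tpsi.
have Lp := rtest_L2 tpsi; have Lq := rtest_L2 (rtest_partial j tpsi).
set P := I (fun x => psi x ^+ 2); set Q := I (fun x => partial j psi x ^+ 2).
have P0 : 0 <= P by apply: Rintegral_ge0 => x _; exact: sqr_ge0.
have Q0 : 0 <= Q by apply: Rintegral_ge0 => x _; exact: sqr_ge0.
apply/eqP; rewrite -addr_eq0 -sqrf_eq0; set S := _ + _.
suff hS (e : R) : 0 < e -> S ^+ 2 <= e.
  by rewrite eq_le sqr_ge0 andbT; apply/ler_addgt0Pl => e /hS; rewrite addr0.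
move=> e0.
have c0 : 0 < 2 * (P + Q + 1) by rewrite mulr_gt0// ltr_wpDl// addr_ge0.
(* The 1 keeps the denominator positive when P and Q vanish; the factor 2 comes from (A + B)^2 <= 2
   A^2 + 2 B^2. *)
have [u' [f' [Lu' Lf' uf' h1 h2]]] := h (e / (2 * (P + Q + 1))) (divr_gt0 e0 c0).
pose A := I (fun x => (u x - u' x) * partial j psi x).
pose B := I (fun x => (f x - f' x) * psi x).
have -> : S = A + B.
  rewrite /A /B (_ : (fun x => (u x - u' x) * _) =
    (fun x => 1 * (u x * partial j psi x) + (-1) * (u' x * partial j psi x))); last first.
    by apply/funext => x; ring.
  rewrite (_ : (fun x => (f x - f' x) * _) =
    (fun x => 1 * (f x * psi x) + (-1) * (f' x * psi x))); last first.
    by apply/funext => x; ring.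
  rewrite !I_lin//; try exact: (L2_mul mD).
  by rewrite (uf' _ tpsi) /S; ring.
have k1 : A ^+ 2 <= I (fun x => (u x - u' x) ^+ 2) * Q := L2_cs mD (L2_B mD Lu Lu') Lq.
have k2 : B ^+ 2 <= I (fun x => (f x - f' x) ^+ 2) * P := L2_cs mD (L2_B mD Lf Lf') Lp.
have {}k1 := le_trans k1 (ler_wpM2r Q0 h1).
have {}k2 := le_trans k2 (ler_wpM2r P0 h2).
apply: (@le_trans _ _ (2 * (A ^+ 2 + B ^+ 2))); first by have := sqr_ge0 (A - B); nra.
apply: (@le_trans _ _ (e / (2 * (P + Q + 1)) * (2 * (P + Q)))); first by lra.
rewrite -mulrA ler_piMr ?(ltW e0)// mulrC ler_pdivrMr// mul1r; lra.
Qed.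

(* [a] and its gradient [g] are limits of test functions and their gradients. *)
Definition real_H10 a g := [/\ L2 mu D a, forall j, L2 mu D (g j) &
  forall e : R, 0 < e -> exists phi, [/\ rtest D phi, I (fun x => (a x - phi x) ^+ 2) <= e &
    forall j, I (fun x => (g j x - partial j phi x) ^+ 2) <= e]].

Lemma real_H10_weak_deriv a g j : real_H10 a g -> weak_deriv j a (g j).
Proof.
move=> [La Lg h]; apply: weak_deriv_closed => // e e0.
have [phi [tphi h1 h2]] := h _ e0; exists phi, (partial j phi); split => //.
- exact: rtest_L2.
- exact/rtest_L2/rtest_partial.
- exact: weak_deriv_rtest.
Qed.

Lemma I_sqr_lin_le (c : R) f f' k k' : L2 mu D f -> L2 mu D f' -> L2 mu D k -> L2 mu D k' ->
  I (fun x => ((c * f x + f' x) - (c * k x + k' x)) ^+ 2) <=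
  2 * c ^+ 2 * I (fun x => (f x - k x) ^+ 2) + 2 * I (fun x => (f' x - k' x) ^+ 2).
Proof.
move=> Lf Lf' Lk Lk'; have L1 := L2_B mD Lf Lk; have L2' := L2_B mD Lf' Lk'.
have [_ i1] := L1; have [_ i2] := L2'.
rewrite -I_lin//; apply: (I_le mD).
- have [_] := L2_lin mD c 1 L1 L2'; congr intg; apply/funext => x; congr (_ ^+ 2); ring.
- exact: intg_lin.
- apply: aeW => x _; have := sqr_ge0 (c * (f x - k x) - (f' x - k' x)); nra.
Qed.

Lemma real_H10_lin (c : R) a a' g g' : real_H10 a g -> real_H10 a' g' ->
  real_H10 (fun x => c * a x + a' x) (fun j x => c * g j x + g' j x).
Proof.
have llin f f' : L2 mu D f -> L2 mu D f' -> L2 mu D (fun x => c * f x + f' x).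
  by move=> Lf /(L2_D mD (L2_Z mD c Lf)).
move=> [La Lg h] [La' Lg' h']; split; first exact: llin.
- by move=> j; exact: llin.
- move=> e e0; have c0 : 0 < 2 * c ^+ 2 + 2 by rewrite ltr_wpDl// mulr_ge0// sqr_ge0.
  have [phi [tphi h1 h2]] := h _ (divr_gt0 e0 c0).
  have [phi' [tphi' h1' h2']] := h' _ (divr_gt0 e0 c0).
  set de := e / _ in h1 h2 h1' h2'.
  have eE : e = 2 * c ^+ 2 * de + 2 * de by rewrite -mulrDl mulrC divfK// gt_eqF.
  exists (fun x => c * phi x + phi' x); split; first exact: rtest_lin.
    apply: le_trans (I_sqr_lin_le _ _ _ _ _) _ => //; try exact: rtest_L2.
    by rewrite eE lerD// ler_wpM2l// mulr_ge0// sqr_ge0.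
  move=> j; under eq_Rintegral do rewrite (smooth_partial_lin _ _ _ tphi.1 tphi'.1).
  apply: le_trans (I_sqr_lin_le _ _ _ _ _) _ => //; try exact/rtest_L2/rtest_partial.
  by rewrite eE lerD// ler_wpM2l// mulr_ge0// sqr_ge0.
Qed.

(** Young's inequality with a free parameter: the first factor can be as close to 1 as needed, so
    constants survive the passage to the closure. *)
Lemma I_sqr_young (s : R) f k : 0 < s -> L2 mu D f -> L2 mu D k ->
  I (fun x => k x ^+ 2) <= (1 + s) * I (fun x => f x ^+ 2) + (1 + s^-1) * I (fun x => (f x - k x) ^+ 2).
Proof.
move=> s0 Lf Lk; have [_ i1] := Lf; have [_ i2] := L2_B mD Lf Lk; have [_ i3] := Lk.
rewrite -I_lin//; apply: (I_le mD) => //; first exact: intg_lin.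
apply: aeW => x _; rewrite -subr_ge0.
have -> : (1 + s) * f x ^+ 2 + (1 + s^-1) * (f x - k x) ^+ 2 - k x ^+ 2 =
    s^-1 * (s * f x + (f x - k x)) ^+ 2.
  by field; rewrite gt_eqF.
by rewrite mulr_ge0 ?sqr_ge0// invr_ge0 ltW.
Qed.

Definition dirichlet g := \sum_(j < d) I (fun x => g j x ^+ 2).

Lemma dirichlet_ge0 g : 0 <= dirichlet g.
Proof. by apply: sumr_ge0 => j _; apply: Rintegral_ge0 => x _; exact: sqr_ge0. Qed.

Lemma dirichlet_close a g (e : R) : real_H10 a g -> 0 < e ->
  exists2 de : R, 0 < de & forall phi, rtest D phi ->
    (forall j, I (fun x => (g j x - partial j phi x) ^+ 2) <= de) ->
    dirichlet (fun j => partial j phi) <= dirichlet g + e.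
Proof.
move=> [_ Lg _] e0; have G0 := dirichlet_ge0 g; set G := dirichlet g in G0 *.
(* Makes s G at most e/2; the other half of e is shared among the d components. *)
pose s := e / (2 * (G + 1)); have G1 : 0 < 2 * (G + 1) by rewrite mulr_gt0// ltr_wpDl.
have s0 : 0 < s by exact: divr_gt0.
have sV0 : 0 <= 1 + s^-1 by rewrite addr_ge0// invr_ge0 ltW.
have sG : s * G <= e / 2.
  by rewrite /s mulrAC ler_pdivrMr// -mulrA ler_wpM2l ?(ltW e0)//; lra.
pose c := (1 + s^-1) * d.+1%:R; have c0 : 0 < c by rewrite mulr_gt0// ltr_pwDl// invr_ge0 ltW.
exists (e / 2 / c); first by rewrite !divr_gt0.
move=> phi tphi h.
apply: (@le_trans _ _ (\sum_(j < d) ((1 + s) * I (fun x => g j x ^+ 2) + (1 + s^-1) * (e / 2 / c)))).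
  apply: ler_sum => j _; apply: le_trans (I_sqr_young s0 (Lg j) (rtest_L2 (rtest_partial j tphi))) _.
  by rewrite lerD2l ler_wpM2l.
rewrite big_split/= -mulr_sumr -/(dirichlet g) -/G sumr_const card_ord -[_ *+ d]mulr_natr.
have : (1 + s^-1) * (e / 2 / c) * d%:R <= e / 2.
  have cE (x y z : R) : x != 0 -> x * (y / (x * z)) = y / z.
    by move=> x0; rewrite invfM mulrCA mulVKf.
  rewrite /c cE; last by rewrite gt_eqF// ltr_pwDl// invr_ge0 ltW.
  by rewrite mulrAC ler_pdivrMr// ler_wpM2l ?divr_ge0 ?(ltW e0)// ler_nat.
lra.
Qed.

(** Approximants with squared L^2 error at most 2^-n converge almost everywhere, so Fatou bounds the
    even power of [a]; the excess e in the Dirichlet energy is then sent to 0. The cases p = m = 1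
    and p = m = 2 give the Poincare and the quartic inequality. *)
Lemma real_H10_fatou (p m : nat) (C : R) a g : real_H10 a g ->
  (forall phi, rtest D phi -> intg mu D (fun x => phi x ^+ p.*2) /\
     I (fun x => phi x ^+ p.*2) <= C * dirichlet (fun j => partial j phi) ^+ m) ->
  0 <= C ->
  intg mu D (fun x => a x ^+ p.*2) /\ I (fun x => a x ^+ p.*2) <= C * dirichlet g ^+ m.
Proof.
move=> Ha hC C0; have [La Lg happ] := Ha; have [ma _] := La.
have map : measurable_fun D (fun x => a x ^+ p.*2) by exact: measurable_funX.
have bound (e : R) : 0 < e ->
    (\int[mu]_(x in D) `|(a x ^+ p.*2)%:E| <= (C * (dirichlet g + e) ^+ m)%:E)%E.
  move=> e0; have [de de0 hde] := dirichlet_close Ha e0.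
  have /choice[phi hphi] n : exists phi, [/\ rtest D phi,
      I (fun x => (a x - phi x) ^+ 2) <= 2 ^- n &
      forall j, I (fun x => (g j x - partial j phi x) ^+ 2) <= de].
    have m0 : 0 < Num.min (2 ^- n) de by rewrite lt_min de0 andbT invr_gt0 exprn_gt0.
    have [phi [tphi h1 h2]] := happ _ m0; exists phi; split => //.
      by apply: le_trans h1 _; rewrite ge_min lexx.
    by move=> j; apply: le_trans (h2 j) _; rewrite ge_min lexx orbT.
  have tphi n : rtest D (phi n) by have [] := hphi n.
  have cae : {ae mu, forall x, D x -> (fun n => phi n x) @ \oo --> a x}.
    apply: (L2_fast_cvg_ae mD) => // [n|n]; first exact: rtest_L2.
    have [_ h _] := hphi n; apply: le_trans h.
    by under eq_Rintegral do rewrite -sqrrN opprB.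
  apply: (@fatou_ae _ _ _ mu D mD (fun n x => phi n x ^+ p.*2) (fun x => a x ^+ p.*2)) => //.
  - by move=> n; apply: measurable_funX; have [] := rtest_L2 (tphi n).
  - by move=> n x _; rewrite -mul2n exprM exprn_ge0// sqr_ge0.
  - apply: filterS cae => x h /h hx.
    exact: cvgn_expr.
  - near=> n; have [ip hp] := hC _ (tphi n).
    rewrite -EFin_I// lee_fin; apply: le_trans hp _; rewrite ler_wpM2l//.
    rewrite lerXn2r ?nnegrE ?dirichlet_ge0 ?addr_ge0 ?dirichlet_ge0 ?(ltW e0)//.
    by apply: hde => //; have [] := hphi n.
have ia : intg mu D (fun x => a x ^+ p.*2).
  apply/integrableP; split; first exact/measurable_EFinP.
  by apply: le_lt_trans (bound 1 ltr01) _; rewrite ltry.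
split => //.
have cG : (fun k => C * (dirichlet g + k.+1%:R^-1) ^+ m) @ \oo --> C * (dirichlet g) ^+ m.
  apply: cvgM; first exact: cvg_cst.
  apply: cvgn_expr.
  rewrite -[X in _ --> X]addr0; apply: cvgD; [exact: cvg_cst|exact: cvg_harmonic].
rewrite -(cvg_lim _ cG)//; apply: limr_ge; first by apply/cvg_ex; exists (C * dirichlet g ^+ m).
near=> k; rewrite -lee_fin EFin_I//.
rewrite (_ : (\int[mu]_(x in D) _ = \int[mu]_(x in D) `|(a x ^+ p.*2)%:E|)%E).
  by apply: bound; rewrite invr_gt0.
by apply: eq_integral => x _; rewrite gee0_abs// lee_fin -mul2n exprM exprn_ge0// sqr_ge0.
Unshelve. all: by end_near. Qed.

Lemma real_H10_complete (a_ : nat -> Rd -> R) (g_ : nat -> 'I_d -> Rd -> R) :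
  (forall n, real_H10 (a_ n) (g_ n)) ->
  (forall e : R, 0 < e -> exists N : nat, forall m n, (N <= m)%N -> (N <= n)%N ->
     I (fun x => (a_ m x - a_ n x) ^+ 2) <= e /\
     forall j, I (fun x => (g_ m j x - g_ n j x) ^+ 2) <= e) ->
  exists a g, real_H10 a g /\ forall e : R, 0 < e -> exists N : nat, forall n, (N <= n)%N ->
     I (fun x => (a_ n x - a x) ^+ 2) <= e /\
     forall j, I (fun x => (g_ n j x - g j x) ^+ 2) <= e.
Proof.
move=> H cauchy.
have [|a La ca] := @L2_complete _ _ _ mu D mD a_ (fun n => let: And3 h _ _ := H n in h).
  move=> e e0; have [N hN] := cauchy e e0; exists N => m n Nm Nn.
  by have [] := hN m n Nm Nn.
have /choice[g hg] (j : 'I_d) : exists f, L2 mu D f /\ forall e : R, 0 < e -> exists N : nat,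
    forall n, (N <= n)%N -> I (fun x => (g_ n j x - f x) ^+ 2) <= e.
  have [|f Lf cf] := @L2_complete _ _ _ mu D mD (fun n => g_ n j) (fun n => let: And3 _ h _ := H n in h j).
    move=> e e0; have [N hN] := cauchy e e0; exists N => m n Nm Nn.
    by have [_] := hN m n Nm Nn.
  by exists f.
have lim (e : R) : 0 < e -> exists N : nat, forall n, (N <= n)%N ->
     I (fun x => (a_ n x - a x) ^+ 2) <= e /\ forall j, I (fun x => (g_ n j x - g j x) ^+ 2) <= e.
  move=> e0; have [N0 hN0] := ca e e0.
  have /choice[N hN] j := (hg j).2 e e0.
  exists (maxn N0 (\max_j N j)) => n; rewrite geq_max => /andP[n0 n1]; split; first exact: hN0.
  by move=> j; apply: hN; apply: leq_trans n1; exact: leq_bigmax.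
exists a, g; split => //; split => // [j|e e0]; first by have [] := hg j.
have e40 : 0 < e / 4 by rewrite divr_gt0.
have [N hN] := lim _ e40; have [h1 h2] := hN N (leqnn N).
have [La_ Lg_ happ] := H N; have [phi [tphi k1 k2]] := happ _ e40.
(* The term N of the sequence is the common reference: the limit and the test function are both
   within e/4 of it, and adding under the square costs a factor 2. *)
exists phi; have tri f f' k : L2 mu D f -> L2 mu D f' -> L2 mu D k ->
    I (fun x => (f' x - f x) ^+ 2) <= e / 4 -> I (fun x => (f' x - k x) ^+ 2) <= e / 4 ->
    I (fun x => (f x - k x) ^+ 2) <= e.
  move=> Lf Lf' Lk i1 i2.
  have [_ j1] := L2_B mD Lf' Lf; have [_ j2] := L2_B mD Lf' Lk; have [_ j3] := L2_B mD Lf Lk.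
  apply: (@le_trans _ _ (2 * I (fun x => (f' x - f x) ^+ 2) + 2 * I (fun x => (f' x - k x) ^+ 2))); last by lra.
  rewrite -I_lin//; apply: (I_le mD) => //; first exact: intg_lin.
  by apply: aeW => x _; have := sqr_ge0 ((f' x - f x) + (f' x - k x)); nra.
split => //; first by apply: (tri a (a_ N)) => //; exact: rtest_L2.
move=> j; apply: (tri (g j) (g_ N j)) => //; first by have [] := hg j.
exact/rtest_L2/rtest_partial.
Qed.

Hypothesis M_ge0 : 0 <= M.

Lemma I_dirichlet phi : rtest D phi ->
  dirichlet (fun j => partial j phi) = \int[mu]_x \sum_(j < d) sqgrad phi (fun=> 0) j x.
Proof.
move=> tphi; rewrite I_sum//; last by move=> j; apply: sqgrad_intg; apply: rtest_C1c => //; exact: rtest0.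
apply: eq_bigr => j _; rewrite I_extend.
  by apply: eq_Rintegral => x _; rewrite /sqgrad /partial (derive_cst) expr0n addr0.
by move=> x nDx; rewrite (rtest_off (rtest_partial j tphi))// expr0n.
Qed.

Lemma real_H10_L4 a g : d = 2%N \/ d = 3%N -> real_H10 a g ->
  intg mu D (fun x => a x ^+ 4) /\
  I (fun x => a x ^+ 4) <= (32 * M ^+ 2 + 16 * M) * dirichlet g ^+ 2.
Proof.
move=> hd Ha; apply: (real_H10_fatou (p := 2) Ha); last by rewrite addr_ge0// mulr_ge0// exprn_ge0.
move=> phi tphi; have cphi := rtest_C1c tphi; have c0 := rtest_C1c rtest0.
have sM := rtest_supported tphi; have s0 := rtest_supported rtest0.
have E x : phi x ^+ 4 = sqmod phi (fun=> 0) x ^+ 2 by rewrite /sqmod mul0r addr0 -expr2 -exprM.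
split.
  apply: intg_restrict; have := sqmod_sq_intg cphi c0; congr intg; apply/funext => x; exact/esym/E.
rewrite I_extend; last by move=> x /(rtest_off tphi) ->; rewrite expr0n.
under eq_Rintegral do rewrite E.
apply: le_trans (compact_support_L4 hd cphi c0 M_ge0 sM s0) _.
by rewrite -I_dirichlet// -mulrDl.
Qed.

Lemma real_H10_poincare a g : d = 2%N \/ d = 3%N -> real_H10 a g ->
  I (fun x => a x ^+ 2) <= 16 * M ^+ 2 * dirichlet g.
Proof.
move=> hd Ha; rewrite -[dirichlet g]expr1.
apply: (real_H10_fatou (p := 1) Ha _ _).2; last by rewrite mulr_ge0// exprn_ge0.
move=> phi tphi; split; first by have [] := rtest_L2 tphi.
have cphi := rtest_C1c tphi; have c0 := rtest_C1c rtest0.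
have sM := rtest_supported tphi; have s0 := rtest_supported rtest0.
rewrite I_extend; last by move=> x /(rtest_off tphi) ->; rewrite expr0n.
have -> : \int[mu]_x (phi x ^+ 2) = \int[mu]_x sqmod phi (fun=> 0) x.
  by apply: eq_Rintegral => x _; rewrite /sqmod mul0r addr0 -expr2.
rewrite expr1 I_dirichlet//.
by apply: poincare_sqmod_pos => //; case: hd => ->.
Qed.

End weak_derivatives.

(** * Complex-valued functions *)

Section complex_H10.
Context {R : realType} {d : nat}.
Local Notation Rd := 'rV[R]_d.
Local Notation Cfun := ('rV[R]_d -> R[i]).
Local Notation mu := (@lebesgue_rV R d).
Implicit Types (u v w phi : Cfun) (z : R[i]).

(** A boolean index ([false] for the real part, [true] for the imaginary one) lets every real
    statement be applied to both parts by one quantifier. *)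
Definition part (b : bool) z : R := if b then complex.Im z else complex.Re z.

Definition rdot z z' : R := part false z * part false z' + part true z * part true z'.

Lemma Re_mul_conj z z' : complex.Re (z * (z'^*)%C) = rdot z z'.
Proof. by case: z z' => [a b] [a' b']; rewrite /rdot/=; ring. Qed.

Lemma cmod_sqr z : cmod z ^+ 2 = rdot z z.
Proof.
by case: z => a b; rewrite /cmod/= sqr_sqrtr ?addr_ge0 ?sqr_ge0// /rdot/= !expr2.
Qed.

Lemma rdot_ge0 z : 0 <= rdot z z.
Proof. by rewrite -cmod_sqr sqr_ge0. Qed.

Lemma rdotC z z' : rdot z z' = rdot z' z.
Proof. by rewrite /rdot !(mulrC (part _ z)). Qed.

Lemma part_lin b (c : R) z z' : part b (c%:C%C * z + z') = c * part b z + part b z'.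
Proof. by case: b z z' => [] [x y] [x' y']; rewrite /part/=; ring. Qed.

Lemma partB b z z' : part b (z - z') = part b z - part b z'.
Proof. by case: b z z' => [] [x y] [x' y']. Qed.

Definition of_parts (a : bool -> Rd -> R) : Cfun := fun x => (a false x +i* a true x)%C.

Lemma part_of_parts b a x : part b (of_parts a x) = a b x.
Proof. by case: b. Qed.

Variables (D : set Rd) (oD : open D) (M : R) (DM : forall x, D x -> `|x| <= M).
Let mD : measurable D := open_measurable_rV oD.
Local Notation I f := (\int[mu]_(x in D) (f x)).

Definition L2C v := forall b, L2 mu D (fun x => part b (v x)).

Lemma L2spaceP v : L2space D v <-> L2C v.
Proof.
split=> [[[m1 m2] h] b|h].
  have mb : measurable_fun D (fun x => part b (v x)) by case: b.
  split => //; apply: (intg_dom mD _ h); first exact: measurable_funX.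
  move=> x _; rewrite cmod_sqr ger0_norm ?sqr_ge0// /rdot.
  by case: b {mb}; rewrite -!expr2 ?lerDl ?lerDr sqr_ge0.
have [[m1 i1] [m2 i2]] := (h false, h true).
split; first by [].
have := intgD mD i1 i2; congr intg; apply/funext => x.
by rewrite cmod_sqr /rdot !expr2.
Qed.

Lemma rdot_intg v w : L2C v -> L2C w -> intg mu D (fun x => rdot (v x) (w x)).
Proof. by move=> Lv Lw; apply: intgD => //; exact: L2_mul. Qed.

Lemma I_rdot v w : L2C v -> L2C w -> I (fun x => rdot (v x) (w x)) =
  I (fun x => part false (v x) * part false (w x)) + I (fun x => part true (v x) * part true (w x)).
Proof. by move=> Lv Lw; rewrite I_D//; exact: L2_mul. Qed.

Lemma HinnerE v w : Hinner D v w = I (fun x => rdot (v x) (w x)).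
Proof. by apply: eq_Rintegral => x _; rewrite Re_mul_conj. Qed.

Lemma Re_sum (F : 'I_d -> R[i]) : complex.Re (\sum_(j < d) F j) = \sum_(j < d) complex.Re (F j).
Proof. by apply: (big_morph (@complex.Re R)) => // -[x y] [x' y']. Qed.

Lemma VinnerE v w : Vinner D v w = I (fun x => \sum_(j < d) rdot (grad D v j x) (grad D w j x)).
Proof.
apply: eq_Rintegral => x _; rewrite Re_sum.
by apply: eq_bigr => j _; rewrite Re_mul_conj.
Qed.

Lemma test_functionP phi : test_function D phi <-> forall b, rtest D (fun x => part b (phi x)).
Proof.
split=> [[s1 s2 [K [cK KD phi0]]] b|h].
  split; first by case: b.
  by exists K; split => // x /phi0 ->; case: b.
have [[s1 [K [cK KD phi0]]] [s2 [K' [cK' KD' phi0']]]] := (h false, h true).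
split => //; exists (K `|` K'); split; first exact: compactU.
  by rewrite subUset.
move=> x /not_orP[/phi0 p1 /phi0' p2]; move: p1 p2; rewrite /part.
by case: (phi x) => a b /= -> ->.
Qed.

Lemma part_Cpartial b j phi x : part b (Cpartial j phi x) = partial j (fun y => part b (phi y)) x.
Proof. by case: b. Qed.

(** A real test function, seen as a complex one with zero imaginary part, separates the two parts of
    the identity; conversely the complex integrals expand into real ones. *)
Lemma weak_partialP j u g : L2C u -> L2C g -> weak_partial D j u g <->
  forall b, weak_deriv D j (fun x => part b (u x)) (fun x => part b (g x)).
Proof.
move=> Lu Lg; split=> [h b psi tpsi|h phi /test_functionP tphi].
  pose phi : Cfun := of_parts (fun b x => if b then 0 else psi x).
  have tphi : test_function D phi.
    by apply/test_functionP => -[]; [exact: rtest0|exact: tpsi].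
  have p0 x : partial j (fun=> 0 : R) x = 0 :> R by exact: derive_cst.
  have {}h := h phi tphi; case: b.
    have := congr1 (@complex.Im R) h; rewrite /Cintegral/= => E.
    apply: etrans (etrans _ E) _; [|congr (- _)]; apply: eq_Rintegral => x _.
      by rewrite /part/=; case: (u x) => a b; rewrite /= p0; ring.
    by rewrite /part/=; case: (g x) => a b/=; ring.
  have := congr1 (@complex.Re R) h; rewrite /Cintegral/= => E.
  apply: etrans (etrans _ E) _; [|congr (- _)]; apply: eq_Rintegral => x _.
    by rewrite /part/=; case: (u x) => a b; rewrite /= p0; ring.
  by rewrite /part/=; case: (g x) => a b/=; ring.
pose psi b x := part b (phi x).
have Lp b : L2 mu D (psi b) := rtest_L2 oD DM (tphi b).
have Lq b : L2 mu D (partial j (psi b)) by apply: (rtest_L2 oD DM); exact: rtest_partial (tphi b).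
have hu b b' := h b _ (tphi b').
have mulE z z' b : part b (z * z') =
    (1 * (part b z * part false z') + (if b then 1 else -1) * (part (~~ b) z * part true z')).
  by case: b z z' => [] [x y] [x' y']; rewrite /part/=; ring.
have intE (v w : Cfun) b : L2C v -> L2C w -> I (fun x => part b (v x * w x)) =
    1 * I (fun x => part b (v x) * part false (w x)) +
    (if b then 1 else -1) * I (fun x => part (~~ b) (v x) * part true (w x)).
  move=> Lv Lw; rewrite -I_lin//; [|exact: L2_mul..].
  by apply: eq_Rintegral => x _; rewrite mulE.
have LC : L2C (Cpartial j phi) by move=> b; under eq_fun do rewrite part_Cpartial; exact: Lq.
have key b : I (fun x => part b (u x * Cpartial j phi x)) = - I (fun x => part b (g x * phi x)).
  rewrite !intE//.
  have e1 := hu b false; have e2 := hu (~~ b) true.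
  under eq_Rintegral do rewrite part_Cpartial; rewrite e1.
  under [X in _ + _ * X]eq_Rintegral do rewrite part_Cpartial; rewrite e2.
  by ring.
have [k1 k2] := (key false, key true).
by rewrite /Cintegral; rewrite [X in (X +i* _)%C]k1 [X in (_ +i* X)%C]k2.
Qed.

Lemma grad_spec v j : H1space D v -> L2C (grad D v j) /\
  forall b, weak_deriv D j (fun x => part b (v x)) (fun x => part b (grad D v j x)).
Proof.
move=> [/L2spaceP Lv /(_ j)[g hg]].
have [/L2spaceP Lg hw] := @xgetPex _ (fun=> 0) 
  [set g | L2space D g /\ weak_partial D j v g] (ex_intro _ _ hg).
by split => //; exact/weak_partialP.
Qed.

(** By uniqueness of weak derivatives, the representative chosen by [grad] agrees almost everywhere
    with any explicitly known weak gradient. *)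
Lemma H1space_parts v (g : bool -> 'I_d -> Rd -> R) : L2C v -> (forall b j, L2 mu D (g b j)) ->
  (forall b j, weak_deriv D j (fun x => part b (v x)) (g b j)) ->
  H1space D v /\ forall b j, {ae mu, forall x, D x -> part b (grad D v j x) = g b j x}.
Proof.
move=> Lv Lg hg; have Hv : H1space D v.
  split; first exact/L2spaceP.
  move=> j; exists (of_parts (fun b => g b j)).
  have Lo : L2C (of_parts (fun b => g b j)) by move=> b; under eq_fun do rewrite part_of_parts; exact: Lg.
  split; first exact/L2spaceP.
  by apply/weak_partialP => // b; under [X in weak_deriv _ _ _ X]eq_fun do rewrite part_of_parts; exact: hg.
split => // b j; have [Lj hj] := grad_spec j Hv.
exact: (weak_deriv_uniq oD DM (Lj b) (Lg b j) (hj b) (hg b j)).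
Qed.

Lemma H1norm_sqr v : H1space D v -> H1norm D v ^+ 2 =
  I (fun x => part false (v x) ^+ 2) + I (fun x => part true (v x) ^+ 2) +
  \sum_(j < d) (I (fun x => part false (grad D v j x) ^+ 2) + I (fun x => part true (grad D v j x) ^+ 2)).
Proof.
move=> Hv; have Lv : L2C v by exact/L2spaceP/(Hv.1).
have Lg j := (grad_spec j Hv).1.
have rdotE (f : Cfun) : L2C f -> I (fun x => rdot (f x) (f x)) =
    I (fun x => part false (f x) ^+ 2) + I (fun x => part true (f x) ^+ 2).
  by move=> Lf; rewrite I_rdot.
have E : Hinner D v v + Vinner D v v =
  I (fun x => part false (v x) ^+ 2) + I (fun x => part true (v x) ^+ 2) +
  \sum_(j < d) (I (fun x => part false (grad D v j x) ^+ 2) + I (fun x => part true (grad D v j x) ^+ 2)).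
  rewrite HinnerE VinnerE rdotE// I_sum//; last by move=> j; exact: rdot_intg.
  by congr (_ + _); apply: eq_bigr => j _; exact: rdotE.
rewrite /H1norm sqr_sqrtr E// addr_ge0//.
  by rewrite addr_ge0//; apply: Rintegral_ge0 => x _; exact: sqr_ge0.
by apply: sumr_ge0 => j _; rewrite addr_ge0//; apply: Rintegral_ge0 => x _; exact: sqr_ge0.
Qed.

(** As [grad] is a choice, linearity has to be recovered almost everywhere: an explicit weak
    gradient of v - phi is built from [g] and the classical gradient of phi. *)
Lemma grad_sub_test v (g : bool -> 'I_d -> Rd -> R) phi : L2C v -> (forall b j, L2 mu D (g b j)) ->
  (forall b j, weak_deriv D j (fun x => part b (v x)) (g b j)) -> test_function D phi ->
  H1space D (v - phi) /\ forall b j, {ae mu, forall x, D x ->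
    part b (grad D (v - phi) j x) = g b j x - partial j (fun y => part b (phi y)) x}.
Proof.
move=> Lv Lg hg /test_functionP tphi.
have Lp b : L2 mu D (fun x => part b (phi x)) by exact: (rtest_L2 oD DM).
have Lq b j : L2 mu D (partial j (fun x => part b (phi x))).
  by apply: (rtest_L2 oD DM); exact: rtest_partial.
apply: H1space_parts.
- move=> b; have := L2_B mD (Lv b) (Lp b); congr L2.
  by apply/funext => x; exact/esym/partB.
- by move=> b j; apply: L2_B.
- move=> b j psi tpsi; have Lpsi := rtest_L2 oD DM tpsi.
  have Lpsi' := rtest_L2 oD DM (rtest_partial j tpsi).
  have e1 := hg b j psi tpsi; have e2 := weak_deriv_rtest oD DM j (tphi b) tpsi.
  transitivity (1 * I (fun x => part b (v x) * partial j psi x) +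
      (-1) * I (fun x => part b (phi x) * partial j psi x)).
    rewrite -I_lin//; [|exact: L2_mul..].
    by apply: eq_Rintegral => x _; rewrite [part b _]partB; ring.
  rewrite e1 e2.
  transitivity (- (1 * I (fun x => g b j x * psi x) +
      (-1) * I (fun x => partial j (fun y => part b (phi y)) x * psi x))); first by ring.
  rewrite -I_lin//; [|exact: L2_mul..].
  by congr (- _); apply: eq_Rintegral => x _; ring.
Qed.

Lemma I_part_grad_sub v (g : bool -> 'I_d -> Rd -> R) phi b j : L2C v -> (forall b j, L2 mu D (g b j)) ->
  (forall b j, weak_deriv D j (fun x => part b (v x)) (g b j)) -> test_function D phi ->
  I (fun x => part b (grad D (v - phi) j x) ^+ 2) =
  I (fun x => (g b j x - partial j (fun y => part b (phi y)) x) ^+ 2).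
Proof.
move=> Lv Lg hg tphi; have [H1 ae] := grad_sub_test Lv Lg hg tphi.
have [Lj _] := grad_spec j H1.
apply: (I_ae_eq mD).
- by apply: measurable_funX; have [] := Lj b.
- apply: measurable_funX; apply: measurable_funB; first by have [] := Lg b j.
  have /test_functionP/(_ b) tb := tphi.
  by have [] := rtest_L2 oD DM (rtest_partial j tb).
- by apply: filterS (ae b j) => x h /h ->.
Qed.

Definition gpart v b (j : 'I_d) x := part b (grad D v j x).

(** Each real component of the error is one nonnegative summand of the squared H^1 norm. *)
Lemma H10space_real v b : H10space D v -> real_H10 D (fun x => part b (v x)) (gpart v b).
Proof.
move=> [Hv happ]; have Lv : L2C v by exact/L2spaceP/(Hv.1).
have Lg b' j : L2 mu D (gpart v b' j) := (grad_spec j Hv).1 b'.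
have hg b' j : weak_deriv D j (fun x => part b' (v x)) (gpart v b' j) := (grad_spec j Hv).2 b'.
split => // e e0.
have se0 : 0 < Num.sqrt e by rewrite sqrtr_gt0.
have [phi tphi] := happ _ se0.
have [H1 _] := grad_sub_test Lv Lg hg tphi.
have N0 : 0 <= H1norm D (v - phi) by exact: sqrtr_ge0.
move=> h; have : H1norm D (v - phi) ^+ 2 < e.
  by rewrite -(sqr_sqrtr (ltW e0)) ltr_pXn2r// nnegrE sqrtr_ge0.
rewrite H1norm_sqr// => he {h}.
have nn (f : Rd -> R) : 0 <= I (fun x => f x ^+ 2) by apply: Rintegral_ge0 => x _; exact: sqr_ge0.
have snn j : 0 <= I (fun x => part false (grad D (v - phi) j x) ^+ 2) +
     I (fun x => part true (grad D (v - phi) j x) ^+ 2) by rewrite addr_ge0.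
have Snn : 0 <= \sum_(j < d) (I (fun x => part false (grad D (v - phi) j x) ^+ 2) +
     I (fun x => part true (grad D (v - phi) j x) ^+ 2)) by apply: sumr_ge0.
exists (fun x => part b (phi x)); split; first by move/test_functionP : tphi.
  have -> : I (fun x => (part b (v x) - part b (phi x)) ^+ 2) = I (fun x => part b ((v - phi) x) ^+ 2).
    by apply: eq_Rintegral => x _; rewrite [part b ((v - phi) x)]partB.
  have := nn (fun x => part false ((v - phi) x)); have := nn (fun x => part true ((v - phi) x)).
  by case: b; lra.
move=> j; rewrite -(I_part_grad_sub b j Lv Lg hg tphi).
have := nn (fun x => part false ((v - phi) x)); have := nn (fun x => part true ((v - phi) x)).
move: he Snn; rewrite (bigD1 j)//=.
have := nn (fun x => part false (grad D (v - phi) j x)).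
have := nn (fun x => part true (grad D (v - phi) j x)).
have : 0 <= \sum_(i < d | i != j) (I (fun x => part false (grad D (v - phi) i x) ^+ 2) +
     I (fun x => part true (grad D (v - phi) i x) ^+ 2)) by apply: sumr_ge0.
by case: b; lra.
Qed.

Lemma real_H10_space v (g : bool -> 'I_d -> Rd -> R) :
  (forall b, real_H10 D (fun x => part b (v x)) (g b)) ->
  H10space D v /\ forall b j, {ae mu, forall x, D x -> gpart v b j x = g b j x}.
Proof.
move=> H.
have Lv : L2C v by move=> b; have [] := H b.
have Lg b j : L2 mu D (g b j) by have [_ h _] := H b; exact: h.
have hg b j := real_H10_weak_deriv oD DM j (H b).
have [Hv ae] := H1space_parts Lv Lg hg; split => //; split => // e e0.
(* The squared norm has 2 (d + 1) real summands, two parts for the value and for each derivative;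
   [de] makes their sum at most e^2/2, strictly below e^2. *)
pose N : R := 2 * d.+1%:R; have N0 : 0 < N by rewrite mulr_gt0.
pose de := e ^+ 2 / (2 * N); have de0 : 0 < de by rewrite divr_gt0 ?exprn_gt0 ?mulr_gt0.
have /choice[phi hphi] (b : bool) : exists phi : Rd -> R,
    [/\ rtest D phi, I (fun x => (part b (v x) - phi x) ^+ 2) <= de &
    forall j, I (fun x => (g b j x - partial j phi x) ^+ 2) <= de].
  by have [_ _ /(_ _ de0)] := H b.
have tphi : test_function D (of_parts phi).
  apply/test_functionP => b; under eq_fun do rewrite part_of_parts.
  by have [] := hphi b.
exists (of_parts phi) => //; have [H1 _] := grad_sub_test Lv Lg hg tphi.
rewrite -(ltr_pXn2r (n := 2))// ?nnegrE ?sqrtr_ge0 ?(ltW e0)// H1norm_sqr//.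
have e1 b : I (fun x => part b ((v - of_parts phi) x) ^+ 2) <= de.
  have [_ h _] := hphi b; apply: le_trans h; rewrite le_eqVlt; apply/orP; left; apply/eqP.
  by apply: eq_Rintegral => x _; rewrite [part b _]partB part_of_parts.
have e2 b j : I (fun x => part b (grad D (v - of_parts phi) j x) ^+ 2) <= de.
  have [_ _ h] := hphi b; rewrite (I_part_grad_sub b j Lv Lg hg tphi); apply: le_trans (h j).
  by rewrite (_ : (fun y => part b (of_parts phi y)) = phi b)//; apply/funext => y; exact: part_of_parts.
apply: (@le_lt_trans _ _ (de + de + \sum_(j < d) (de + de))).
  by apply: lerD; [exact: lerD|apply: ler_sum => j _; exact: lerD].
rewrite sumr_const card_ord -mulr_natr.
have -> : de + de + (de + de) * d%:R = N * de by rewrite /N -(natr1 d); ring.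
have -> : N * de = e ^+ 2 / 2.
  by rewrite /de invfM mulrCA (mulrCA N) mulfV ?gt_eqF// mulr1.
by rewrite ltr_pdivrMr//; have := exprn_gt0 2 e0; lra.
Qed.

End complex_H10.

(** * Forms on the energy space *)

Section H10_forms.
Context {R : realType} {d : nat}.
Local Notation Rd := 'rV[R]_d.
Local Notation Cfun := ('rV[R]_d -> R[i]).
Local Notation mu := (@lebesgue_rV R d).
Variables (D : set Rd) (oD : open D) (M : R) (DM : forall x, D x -> `|x| <= M).
Let mD : measurable D := open_measurable_rV oD.
Local Notation I f := (\int[mu]_(x in D) (f x)).
Implicit Types (u v w : Cfun).

Lemma H10space_lin (c : R) u v : H10space D u -> H10space D v ->
  let w := fun x => c%:C%C * u x + v x in
  H10space D w /\ forall b j,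
    {ae mu, forall x, D x -> gpart D w b j x = c * gpart D u b j x + gpart D v b j x}.
Proof.
move=> Hu Hv; apply: (real_H10_space oD DM (g := fun b j x => c * gpart D u b j x + gpart D v b j x)) => b.
rewrite (_ : (fun x => part b _) = (fun x => c * part b (u x) + part b (v x))).
  by apply: (real_H10_lin oD DM); exact: (H10space_real oD DM).
by apply/funext => x; rewrite part_lin.
Qed.

(** Value and gradient in one vector: every quadratic form becomes a pointwise function of it, and
    additivity of the gradient has to be treated only once. *)
Definition jet v x (k : option 'I_d) : R[i] := if k is Some j then grad D v j x else v x.

Lemma jet_lin (c : R) u v : H10space D u -> H10space D v ->
  {ae mu, forall x, D x -> forall k,
    jet (fun x => c%:C%C * u x + v x) x k = c%:C%C * jet u x k + jet v x k}.
Proof.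
move=> Hu Hv; have [_ ae] := H10space_lin c Hu Hv.
have : \forall x \ae mu, forall p : bool * 'I_d, D x ->
    gpart D (fun x => c%:C%C * u x + v x) p.1 p.2 x = c * gpart D u p.1 p.2 x + gpart D v p.1 p.2 x.
  by apply: filter_forall => -[b j]; exact: ae.
apply: filterS => x h Dx [j|]//=.
have hb b : gpart D _ b j x = _ := h (b, j) Dx.
have {hb}:= (hb false, hb true); rewrite /gpart -!part_lin => -[].
case: (grad D _ j x) => a b; case: (_ + _) => a' b'.
by rewrite /part/= => -> ->.
Qed.

Lemma H10space_add u v : H10space D u -> H10space D v -> H10space D (fun x => u x + v x).
Proof.
move=> Hu Hv; have := (H10space_lin 1 Hu Hv).1.
by rewrite (_ : (fun x => _) = (fun x => u x + v x))//; apply/funext => x; rewrite mul1r.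
Qed.

Lemma scale_lin (c : R) u : (fun x => c%:C%C * u x) = (fun x => (c - 1)%:C%C * u x + u x).
Proof. by apply/funext => x; rewrite rmorphB/= mulrBl mul1r subrK. Qed.

Lemma H10space_scale (c : R) u : H10space D u -> H10space D (fun x => c%:C%C * u x).
Proof. by move=> Hu; rewrite scale_lin; exact: (H10space_lin _ Hu Hu).1. Qed.

(** There is no quotient by almost everywhere equality, since the integral forms cannot see the
    difference. *)
Definition H10 := {v : Cfun | H10space D v}.
Implicit Types (f g : H10).

Definition H10_add f g : H10 :=
  exist _ (fun x => sval f x + sval g x) (H10space_add (svalP f) (svalP g)).

Definition H10_sc (c : R) f : H10 :=
  exist _ (fun x => c%:C%C * sval f x) (H10space_scale c (svalP f)).

Lemma L2C_jet v k : H10space D v -> L2C D (fun x => jet v x k).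
Proof.
move=> [Hv _]; case: k => [j|]; first exact: (grad_spec oD DM j Hv).1.
by apply/(L2spaceP oD); have [] := Hv.
Qed.

Local Notation jets := (option 'I_d -> R[i]).

(** Bilinearity is imposed on arbitrary jets, where it is plain algebra; only integrability refers
    to the function space. *)
Record pointwise_form (B : Rd -> jets -> jets -> R) : Prop := {
  pf_lin : forall x (c : R) J J' L,
    B x (fun k => c%:C%C * J k + J' k) L = c * B x J L + B x J' L ;
  pf_sym : forall x J L, B x J L = B x L J ;
  pf_intg : forall f g, intg mu D (fun x => B x (jet (sval f) x) (jet (sval g) x)) }.

Definition int_form (B : Rd -> jets -> jets -> R) f g :=
  I (fun x => B x (jet (sval f) x) (jet (sval g) x)).

Lemma int_form_lin B (pB : pointwise_form B) (c : R) f f' f'' g :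
  sval f'' = (fun x => c%:C%C * sval f x + sval f' x) ->
  int_form B f'' g = c * int_form B f g + int_form B f' g.
Proof.
move=> E; have ae := jet_lin c (svalP f) (svalP f'); rewrite -E in ae.
rewrite /int_form -[X in _ = _ + X]mul1r -I_lin//; [|exact: pf_intg..].
apply: (I_ae_eq mD).
- exact: intg_measurable (pf_intg pB f'' g).
- by apply: intg_measurable; apply: intg_lin => //; exact: pf_intg.
- apply: filterS ae => x h /h /funext ->.
  by rewrite (pf_lin pB) mul1r.
Qed.

Lemma int_form_linfun B g : pointwise_form B -> linfun_on H10_add H10_sc (fun f => int_form B f g).
Proof.
move=> pB; split=> [f f'|c f].
  rewrite (@int_form_lin B pB 1 f f') ?mul1r//=.
  by apply/funext => x; rewrite mul1r.
rewrite (@int_form_lin B pB (c - 1) f f) //=; last exact: scale_lin.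
ring.
Qed.

Lemma int_form_ge0 B f : pointwise_form B ->
  {ae mu, forall x, D x -> forall J, 0 <= B x J J} -> 0 <= int_form B f f.
Proof.
move=> pB B0; apply: (I_ge0 mD); last exact: intg_measurable (pf_intg pB f f).
by apply: filterS B0 => x h /h.
Qed.

Lemma int_form_symform B : pointwise_form B ->
  {ae mu, forall x, D x -> forall J, 0 <= B x J J} -> symform H10_add H10_sc (int_form B).
Proof.
move=> pB B0; split=> [w|f g|f].
- exact: int_form_linfun.
- by apply: eq_Rintegral => x _; exact: pf_sym.
- exact: int_form_ge0.
Qed.

Lemma int_form_le B B' B'' (c c' : R) f :
  pointwise_form B -> pointwise_form B' -> pointwise_form B'' ->
  {ae mu, forall x, D x -> forall J, B x J J <= c * B' x J J + c' * B'' x J J} ->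
  int_form B f f <= c * int_form B' f f + c' * int_form B'' f f.
Proof.
move=> pB pB' pB'' h; rewrite -I_lin//; [|exact: pf_intg..].
apply: (I_le mD); [exact: pf_intg|apply: intg_lin => //; exact: pf_intg|].
by apply: filterS h => x h /h.
Qed.

Lemma rdot_lin (c : R) (z z' t : R[i]) : rdot (c%:C%C * z + z') t = c * rdot z t + rdot z' t.
Proof. by rewrite /rdot !part_lin; ring. Qed.

Definition h_form (x : Rd) (J L : jets) := rdot (J None) (L None).

Definition v_form (x : Rd) (J L : jets) := \sum_(j < d) rdot (J (Some j)) (L (Some j)).

Lemma h_form_pointwise : pointwise_form h_form.
Proof.
split=> [x c J J' L|x J L|f g]; first exact: rdot_lin.
  exact: rdotC.
apply: (rdot_intg oD); exact: (L2C_jet None (svalP _)).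
Qed.

Lemma v_form_pointwise : pointwise_form v_form.
Proof.
split=> [x c J J' L|x J L|f g].
- by rewrite /v_form mulr_sumr -big_split/=; apply: eq_bigr => j _; rewrite rdot_lin.
- by apply: eq_bigr => j _; exact: rdotC.
- apply: (intg_sum mD) => j; apply: (rdot_intg oD); exact: (L2C_jet (Some j) (svalP _)).
Qed.

Lemma Hinner_form f g : Hinner D (sval f) (sval g) = int_form h_form f g.
Proof. exact: HinnerE. Qed.

Lemma Vinner_form f g : Vinner D (sval f) (sval g) = int_form v_form f g.
Proof. exact: VinnerE. Qed.

Lemma h_form_ge0 x J : 0 <= h_form x J J.
Proof. exact: rdot_ge0. Qed.

Lemma v_form_ge0 x J : 0 <= v_form x J J.
Proof. by apply: sumr_ge0 => j _; exact: rdot_ge0. Qed.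

Lemma Hinner_symform : symform H10_add H10_sc (int_form h_form).
Proof. by apply: int_form_symform => //; [exact: h_form_pointwise|apply: aeW => x _; exact: h_form_ge0]. Qed.

Lemma Vinner_symform : symform H10_add H10_sc (int_form v_form).
Proof. by apply: int_form_symform => //; [exact: v_form_pointwise|apply: aeW => x _; exact: v_form_ge0]. Qed.

Lemma int_v_form f : int_form v_form f f =
  dirichlet D (gpart D (sval f) false) + dirichlet D (gpart D (sval f) true).
Proof.
rewrite /int_form I_sum//; last first.
  by move=> j; apply: (rdot_intg oD); exact: (L2C_jet (Some j) (svalP f)).
rewrite /dirichlet -big_split/=; apply: eq_bigr => j _.
by rewrite (I_rdot oD)//; exact: (L2C_jet (Some j) (svalP f)).
Qed.

Lemma int_h_form f : int_form h_form f f =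
  I (fun x => part false (sval f x) ^+ 2) + I (fun x => part true (sval f x) ^+ 2).
Proof. by rewrite [LHS](I_rdot oD)//; exact: (L2C_jet None (svalP f)). Qed.

(** * Poincare inequality, quartic form and completeness on the complex space *)

Section sobolev.
Hypotheses (M_ge0 : 0 <= M) (hd : d = 2%N \/ d = 3%N).

Lemma H10_poincare f : int_form h_form f f <= 16 * M ^+ 2 * int_form v_form f f.
Proof.
rewrite int_v_form int_h_form mulrDr.
by apply: lerD; apply: (real_H10_poincare oD DM M_ge0 hd); exact: (H10space_real oD DM _ (svalP f)).
Qed.

Lemma part_L4 f b : intg mu D (fun x => part b (sval f x) ^+ 4) /\
  I (fun x => part b (sval f x) ^+ 4) <=
    (32 * M ^+ 2 + 16 * M) * dirichlet D (gpart D (sval f) b) ^+ 2.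
Proof. by apply: (real_H10_L4 oD DM M_ge0 hd); exact: (H10space_real oD DM _ (svalP f)). Qed.

Lemma part_measurable f b : measurable_fun D (fun x => part b (sval f x)).
Proof. by have [] := L2C_jet None (svalP f) b. Qed.

Lemma rdot_L2 f g : L2 mu D (fun x => rdot (sval f x) (sval g x)).
Proof.
have mul b : L2 mu D (fun x => part b (sval f x) * part b (sval g x)).
  split; first by apply: measurable_funM; exact: part_measurable.
  apply: (intg_dom mD _ (intgD mD (part_L4 f b).1 (part_L4 g b).1)).
    by apply: measurable_funX; apply: measurable_funM; exact: part_measurable.
  move=> x _; set s := part b _; set t := part b _.
  rewrite ger0_norm ?sqr_ge0//; have := sqr_ge0 (s ^+ 2 - t ^+ 2); have := sqr_ge0 (s * t); nra.
exact: L2_D.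
Qed.

Definition quartic f f' g g' := I (fun x => rdot (sval f x) (sval f' x) * rdot (sval g x) (sval g' x)).

Lemma quartic_lin f' g g' : linfun_on H10_add H10_sc (fun f => quartic f f' g g').
Proof.
have L := rdot_L2.
split=> [f1 f2|c f1]; rewrite /quartic.
  rewrite -I_D//; [|exact: L2_mul..].
  apply: eq_Rintegral => x _ /=; rewrite -mulrDl; congr (_ * _).
  by rewrite -[sval f1 x]mul1r -[1](rmorph1 (real_complex R)) rdot_lin mul1r rmorph1 mul1r.
rewrite -I_Z//; last exact: L2_mul.
apply: eq_Rintegral => x _ /=; rewrite mulrA; congr (_ * _).
by rewrite -[_ * sval f1 x]addr0 rdot_lin [X in _ + X](_ : _ = 0) ?addr0// /rdot/part/= !mul0r addr0.
Qed.

Lemma quarticC f f' g g' : quartic f f' g g' = quartic f' f g g'.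
Proof. by apply: eq_Rintegral => x _; rewrite (rdotC (sval f x)). Qed.

Lemma quarticS f f' g g' : quartic f f' g g' = quartic g g' f f'.
Proof. by apply: eq_Rintegral => x _; rewrite mulrC. Qed.

Lemma quartic_ge0 f g : 0 <= quartic f g f g.
Proof. by apply: Rintegral_ge0 => x _; rewrite -expr2 sqr_ge0. Qed.

Lemma quartic_cs f f' g g' : quartic f f' g g' ^+ 2 <= quartic f f' f f' * quartic g g' g g'.
Proof. exact: (L2_cs mD (rdot_L2 f f') (rdot_L2 g g')). Qed.

Lemma rdot_cs (z z' : R[i]) : rdot z z' * rdot z z' <= rdot z z * rdot z' z'.
Proof.
rewrite /rdot; move: (part _ z) (part _ z') (part _ z) (part _ z') => a b c e.
have := sqr_ge0 (a * e - b * c); nra.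
Qed.

Lemma quartic_swap f g : quartic f g f g <= quartic f f g g.
Proof.
have L := rdot_L2; apply: (I_le mD); [exact: L2_mul..|].
by apply: aeW => x _; exact: rdot_cs.
Qed.

(** The factor 2 comes from (s^2 + t^2)^2 <= 2 s^4 + 2 t^4 for the two parts; the squares of their
    Dirichlet energies add up to at most the square of the total. *)
Lemma quartic_le f : quartic f f f f <= 2 * (32 * M ^+ 2 + 16 * M) * int_form v_form f f ^+ 2.
Proof.
have [i1 l1] := part_L4 f false; have [i2 l2] := part_L4 f true.
set C := (32 * M ^+ 2 + 16 * M) in l1 l2 *.
have C0 : 0 <= C by rewrite addr_ge0// mulr_ge0// exprn_ge0.
apply: (@le_trans _ _ (2 * I (fun x => part false (sval f x) ^+ 4) +
    2 * I (fun x => part true (sval f x) ^+ 4))).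
  rewrite -I_lin//; apply: (I_le mD); [exact: L2_mul (rdot_L2 _ _) (rdot_L2 _ _)|exact: intg_lin|].
  apply: aeW => x _; rewrite /rdot; set s := part false _; set t := part true _.
  have := sqr_ge0 (s ^+ 2 - t ^+ 2); nra.
rewrite int_v_form.
have := dirichlet_ge0 D (gpart D (sval f) false); have := dirichlet_ge0 D (gpart D (sval f) true).
set A := dirichlet D _ in l2 *; set B := dirichlet D _ in l1 * => A0 B0.
have : 0 <= C * (A * B) by rewrite !mulr_ge0.
move: l1 l2; set X := I (fun x => part false _ ^+ 4); set Y := I (fun x => part true _ ^+ 4) => l1 l2.
nra.
Qed.

(** By the Poincare inequality a sequence that is Cauchy for the gradients is Cauchy for the values
    too; the two parts are completed separately and reassembled. *)
Lemma Vinner_complete : complete_for H10_add H10_sc (int_form v_form).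
Proof.
move=> F cF; pose sub := @sub_on R H10 H10_add H10_sc.
have subE f g : sval (sub f g) = fun x => (-1)%:C%C * sval g x + sval f x.
  by apply/funext => x; rewrite /= addrC.
have partE b f g x : part b (sval (sub f g) x) = part b (sval f x) - part b (sval g x).
  by rewrite subE part_lin; ring.
have gE b j f g : I (fun x => (gpart D (sval f) b j x - gpart D (sval g) b j x) ^+ 2) =
    I (fun x => gpart D (sval (sub f g)) b j x ^+ 2).
  have [_ /(_ b j)] := H10space_lin (-1) (svalP g) (svalP f); rewrite -subE => ae.
  have m (k : H10) : measurable_fun D (gpart D (sval k) b j).
    by have [] := L2C_jet (Some j) (svalP k) b.
  apply: (I_ae_eq mD).
  - by apply: measurable_funX; apply: measurable_funB; exact: m.
  - by apply: measurable_funX; exact: m.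
  - by apply: filterS ae => x h /h ->; congr (_ ^+ 2); ring.
have dir_le b f : dirichlet D (gpart D (sval f) b) <= int_form v_form f f.
  by rewrite int_v_form; case: b; rewrite ?lerDl ?lerDr dirichlet_ge0.
have grad_le b j f : I (fun x => gpart D (sval f) b j x ^+ 2) <= int_form v_form f f.
  apply: le_trans (dir_le b f); rewrite /dirichlet (bigD1 j)//= lerDl.
  by apply: sumr_ge0 => k _; apply: Rintegral_ge0 => x _; exact: sqr_ge0.
have val_le b f : I (fun x => part b (sval f x) ^+ 2) <= 16 * M ^+ 2 * int_form v_form f f.
  apply: le_trans (real_H10_poincare oD DM M_ge0 hd (H10space_real oD DM b (svalP f))) _.
  by rewrite ler_wpM2l// mulr_ge0// exprn_ge0.
pose C := 16 * M ^+ 2 + 1; have C1 : 1 <= C by rewrite lerDr mulr_ge0// exprn_ge0.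
have C0 : 0 < C by exact: lt_le_trans C1.
have lim b : exists (a : Rd -> R) (g : 'I_d -> Rd -> R), real_H10 D a g /\
    forall e : R, 0 < e -> exists N : nat, forall n, (N <= n)%N ->
     I (fun x => (part b (sval (F n) x) - a x) ^+ 2) <= e /\
     forall j, I (fun x => (gpart D (sval (F n)) b j x - g j x) ^+ 2) <= e.
  apply: (real_H10_complete oD DM) => [n|e e0]; first exact: (H10space_real oD DM b (svalP (F n))).
  have [N hN] := cF (e / C) (divr_gt0 e0 C0); exists N => m n Nm Nn.
  have {hN} := hN m n Nm Nn; rewrite -/sub => hN.
  have V0 := sf_ge0 Vinner_symform (sub (F m) (F n)).
  have hC : C * int_form v_form (sub (F m) (F n)) (sub (F m) (F n)) <= e.
    by rewrite mulrC -ler_pdivlMr.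
  split.
    under eq_Rintegral do rewrite -partE.
    apply: le_trans (val_le b _) _; apply: le_trans hC.
    by rewrite ler_wpM2r// lerDl.
  move=> j; rewrite gE; apply: le_trans (grad_le b j _) _; apply: le_trans hC.
  by rewrite ler_peMl.
have [a0 [g0 [H0 l0]]] := lim false; have [a1 [g1 [H1 l1]]] := lim true.
pose a b := if b then a1 else a0; pose g b := if b then g1 else g0.
have Hb b : real_H10 D (fun x => part b (of_parts a x)) (g b).
  by under eq_fun do rewrite part_of_parts; case: b.
have [Hv ae] := real_H10_space oD DM Hb.
exists (exist _ (of_parts a) Hv) => e e0.
have N0 : 0 < 2 * d.+1%:R :> R by rewrite mulr_gt0.
have [n0 h0] := l0 _ (divr_gt0 e0 N0); have [n1 h1] := l1 _ (divr_gt0 e0 N0).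
exists (maxn n0 n1) => n; rewrite geq_max => /andP[nn0 nn1].
have key b j :
    I (fun x => gpart D (sval (sub (F n) (exist _ (of_parts a) Hv))) b j x ^+ 2) <= e / (2 * d.+1%:R).
  rewrite -gE; apply: (@le_trans _ _ (I (fun x => (gpart D (sval (F n)) b j x - g b j x) ^+ 2))).
    rewrite le_eqVlt; apply/orP; left; apply/eqP.
    have m : measurable_fun D (gpart D (sval (F n)) b j).
      by have [] := L2C_jet (Some j) (svalP (F n)) b.
    have m' : measurable_fun D (gpart D (of_parts a) b j).
      by have [] := L2C_jet (Some j) Hv b.
    have m'' : measurable_fun D (g b j) by have [_ /(_ j) []] := Hb b.
    apply: (I_ae_eq mD); [by apply: measurable_funX; exact: measurable_funB..|].
    by apply: filterS (ae b j) => x h /h /= ->.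
  by case: b; [exact: (h1 n nn1).2|exact: (h0 n nn0).2].
rewrite -/sub int_v_form.
apply: (@le_trans _ _ (\sum_(j < d) e / (2 * d.+1%:R) + \sum_(j < d) e / (2 * d.+1%:R))).
  by apply: lerD; apply: ler_sum => j _; exact: key.
rewrite sumr_const card_ord -[_ *+ d]mulr_natr -mulrDr mulrAC ler_pdivrMr// ler_wpM2l ?(ltW e0)//.
by rewrite -(natr1 d); have := ler0n R d; lra.
Qed.

End sobolev.
End H10_forms.

(** * The rotating Gross-Pitaevskii forms *)

Section rotating_forms.
Context {R : realType} {d : nat}.
Local Notation Rd := 'rV[R]_d.
Local Notation Cfun := ('rV[R]_d -> R[i]).
Local Notation mu := (@lebesgue_rV R d).
Variables (D : set Rd) (oD : open D) (M : R) (DM : forall x, D x -> `|x| <= M).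
Hypotheses (M_ge0 : 0 <= M) (hd : d = 2%N \/ d = 3%N).
Variables (W : Rd -> R) (Omega kappa K : R) (mW : measurable_fun D W).
Hypothesis K_ge0 : 0 <= K.
Hypothesis W_le : {ae mu, forall x, D x -> `|W x| <= K}.
Hypothesis W_ge : {ae mu, forall x, D x -> Omega ^+ 2 * sqnorm x <= W x}.
Let mD : measurable D := open_measurable_rV oD.
Local Notation I f := (\int[mu]_(x in D) (f x)).
Local Notation jets := (option 'I_d -> R[i]).
Implicit Types (f g : H10 D) (J L : jets).

(** The rotation permutes two coordinates up to sign; in dimension 3 the last one is lost, hence an
    inequality. *)
Lemma rotation_le (x : Rd) : \sum_(j < d) rotation x ord0 j ^+ 2 <= sqnorm x.
Proof.
rewrite /sqnorm; move: x; case: hd => -> x; rewrite /rotation !big_ord_recl !big_ord0 !mxE;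
  rewrite !big_ord_recl !big_ord0 !mxE /=.
  have := sqr_ge0 (x ord0 ord0); have := sqr_ge0 (x ord0 (lift ord0 ord0)); nra.
have := sqr_ge0 (x ord0 (lift ord0 (lift ord0 ord0))).
have := sqr_ge0 (x ord0 ord0); have := sqr_ge0 (x ord0 (lift ord0 ord0)); nra.
Qed.

Definition rot_coef (j : 'I_d) (x : Rd) : R := Omega / 2 * rotation x ord0 j.

Lemma rot_coef_le x : \sum_(j < d) rot_coef j x ^+ 2 <= Omega ^+ 2 / 4 * sqnorm x.
Proof.
under eq_bigr do rewrite exprMn.
rewrite -mulr_sumr (_ : (Omega / 2) ^+ 2 = Omega ^+ 2 / 4); last by field.
by rewrite ler_wpM2l ?rotation_le// divr_ge0// sqr_ge0.
Qed.

Lemma sqnorm_ge0 (x : Rd) : 0 <= sqnorm x.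
Proof. by apply: sumr_ge0 => i _; exact: sqr_ge0. Qed.

Definition rot_bound : R := Omega ^+ 2 / 4 * (d%:R * M ^+ 2).

Lemma rot_bound_ge0 : 0 <= rot_bound.
Proof. by apply: mulr_ge0; [rewrite divr_ge0// sqr_ge0|rewrite mulr_ge0// sqr_ge0]. Qed.

Lemma sqnorm_le x : D x -> Omega ^+ 2 / 4 * sqnorm x <= rot_bound.
Proof.
move=> Dx; apply: ler_wpM2l; first by rewrite divr_ge0// sqr_ge0.
rewrite -[d in d%:R]card_ord mulr_natl -sumr_const; apply: ler_sum => i _.
rewrite -real_normK ?num_real// lerXn2r ?nnegrE//.
by apply: le_trans (norm_coor_le x i) _; exact: DM.
Qed.

Lemma measurable_sum_coor (F : 'I_d -> Rd -> R) : (forall i, measurable_fun D (F i)) ->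
  measurable_fun D (fun x => \sum_(i < d) F i x).
Proof. by move=> mF; apply: measurable_sum. Qed.

Lemma measurable_coorD i : measurable_fun D (fun x : Rd => x ord0 i).
Proof. by apply: measurable_funTS; exact: measurable_coor. Qed.

Lemma measurable_rot_coef j : measurable_fun D (rot_coef j).
Proof.
rewrite (_ : rot_coef j = fun x => Omega / 2 * \sum_(i < d) x ord0 i * rot_mx i j); last first.
  by apply/funext => x; rewrite /rot_coef /rotation mxE.
apply: measurable_funM; first exact: measurable_cst.
apply: measurable_sum_coor => i; apply: measurable_funM; first exact: measurable_coorD.
exact: measurable_cst.
Qed.

Lemma measurable_W_R : measurable_fun D (W_R W Omega).
Proof.
apply: measurable_funB => //; apply: measurable_funM; first exact: measurable_cst.
by apply: measurable_sum_coor => i; apply: measurable_funX; exact: measurable_coorD.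
Qed.

Lemma rot_coef_bounded j x : D x -> `|rot_coef j x| <= rot_bound + 1.
Proof.
move=> Dx; have Q0 := rot_bound_ge0.
have : rot_coef j x ^+ 2 <= rot_bound.
  apply: le_trans (sqnorm_le Dx); apply: le_trans (rot_coef_le x).
  by rewrite (bigD1 j)//= lerDl; apply: sumr_ge0 => k _; exact: sqr_ge0.
move=> h; apply: sqr_le_normr; first by lra.
apply: le_trans h _; nra.
Qed.

Lemma W_R_bounded : {ae mu, forall x, D x -> `|W_R W Omega x| <= K + rot_bound}.
Proof.
apply: filterS W_le => x h Dx; rewrite /W_R; apply: le_trans (ler_normB _ _) _.
apply: lerD; first exact: h.
rewrite ger0_norm; last by rewrite mulr_ge0 ?sqnorm_ge0// mulr_ge0 ?sqr_ge0 ?invr_ge0.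
by have := sqnorm_le Dx; rewrite (mulrC 4^-1).
Qed.

Definition rot_jet (x : Rd) J (j : 'I_d) : R[i] := J (Some j) + (0 +i* rot_coef j x)%C * J None.

Definition a_form (x : Rd) J L : R :=
  \sum_(j < d) rdot (rot_jet x J j) (rot_jet x L j) + W_R W Omega x * rdot (J None) (L None).

Lemma rot_jet_lin x (c : R) J J' j :
  rot_jet x (fun k => c%:C%C * J k + J' k) j = c%:C%C * rot_jet x J j + rot_jet x J' j.
Proof. by rewrite /rot_jet; ring. Qed.

Lemma L2C_rot_jet f j : L2C D (fun x => rot_jet x (jet D (sval f) x) j).
Proof.
have Lg := L2C_jet oD DM (Some j) (svalP f); have Lv := L2C_jet oD DM None (svalP f).
have rb : {ae mu, forall x, D x -> `|rot_coef j x| <= rot_bound + 1}.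
  by apply: aeW => x Dx; exact: rot_coef_bounded.
have L b := L2_bounded_mul mD (Lv b) (measurable_rot_coef j) rb.
case.
  have := L2_D mD (Lg true) (L false); congr L2; apply/funext => x.
  rewrite /rot_jet/=; case: (grad D _ j x) => a b; case: (sval f x) => a' b'.
  by rewrite /part/=; ring.
have := L2_B mD (Lg false) (L true); congr L2; apply/funext => x.
rewrite /rot_jet/=; case: (grad D _ j x) => a b; case: (sval f x) => a' b'.
by rewrite /part/=; ring.
Qed.

Lemma a_form_intg1 f g :
  intg mu D (fun x => \sum_(j < d) rdot (rot_jet x (jet D (sval f) x) j) (rot_jet x (jet D (sval g) x) j)).
Proof. by apply: (intg_sum mD) => j; apply: (rdot_intg oD); exact: L2C_rot_jet. Qed.

Lemma a_form_intg2 f g :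
  intg mu D (fun x => W_R W Omega x * rdot (jet D (sval f) x None) (jet D (sval g) x None)).
Proof.
have := rdot_intg oD (L2C_jet oD DM None (svalP f)) (L2C_jet oD DM None (svalP g)).
move=> ih; apply: (intg_ae_dom mD _ (intgZ mD (K + rot_bound) (integrable_norm ih))).
  by apply: measurable_funM; [exact: measurable_W_R|exact: intg_measurable ih].
apply: filterS W_R_bounded => x h Dx.
by rewrite normrM ler_wpM2r// h.
Qed.

Lemma a_form_pointwise : pointwise_form D a_form.
Proof.
split=> [x c J J' L|x J L|f g].
- rewrite /a_form; under eq_bigr do rewrite rot_jet_lin rdot_lin.
  by rewrite big_split/= -mulr_sumr rdot_lin; ring.
- rewrite /a_form (rdotC (J None)); congr (_ + _).
  by apply: eq_bigr => j _; exact: rdotC.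
- by apply: intgD => //; [exact: a_form_intg1|exact: a_form_intg2].
Qed.

(** One square per component for each inequality. The first returns half of the gradient at the
    price of c^2 |z'|^2, which the potential will cover. *)
Lemma rdot_shift_le (z z' : R[i]) (c : R) :
  2^-1 * rdot z z <= rdot (z + (0 +i* c)%C * z') (z + (0 +i* c)%C * z') + c ^+ 2 * rdot z' z' /\
  rdot (z + (0 +i* c)%C * z') (z + (0 +i* c)%C * z') <= 2 * rdot z z + 2 * (c ^+ 2 * rdot z' z').
Proof.
case: z z' => [a b] [a' b']; rewrite /rdot/part/=; split.
  have := sqr_ge0 (a - 2 * (c * b')); have := sqr_ge0 (b + 2 * (c * a')); nra.
have := sqr_ge0 (a + c * b'); have := sqr_ge0 (b - c * a'); nra.
Qed.

(** From W >= Omega^2 |x|^2 one gets W_R >= 3/4 Omega^2 |x|^2, more than the Omega^2 |x|^2 / 4 that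
    the rotation term costs. The summand with factor 0 fits the shape of [int_form_le]. *)
Lemma a_form_ge : {ae mu, forall x, D x -> forall J,
  v_form x J J <= 2 * a_form x J J + 0 * h_form x J J}.
Proof.
apply: filterS W_ge => x h Dx J; rewrite mul0r addr0.
suff : \sum_(j < d) 2^-1 * rdot (J (Some j)) (J (Some j)) <= a_form x J J.
  by rewrite -mulr_sumr -/(v_form x J J); lra.
apply: (@le_trans _ _ (\sum_(j < d) (rdot (rot_jet x J j) (rot_jet x J j) +
    rot_coef j x ^+ 2 * rdot (J None) (J None)))).
  by apply: ler_sum => j _; exact: (rdot_shift_le _ _ _).1.
rewrite big_split/= -mulr_suml lerD2l ler_wpM2r ?rdot_ge0//.
apply: le_trans (rot_coef_le x) _; rewrite /W_R.
have := h Dx; have := mulr_ge0 (sqr_ge0 Omega) (sqnorm_ge0 x); lra.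
Qed.

Lemma a_form_le : {ae mu, forall x, D x -> forall J,
  a_form x J J <= 2 * v_form x J J + (2 * rot_bound + (K + rot_bound)) * h_form x J J}.
Proof.
apply: filterS W_R_bounded => x h Dx J.
rewrite /a_form [X in _ <= _ + X]mulrDl addrA lerD//; last first.
  by rewrite ler_wpM2r ?rdot_ge0// (le_trans (ler_norm _))// h.
apply: (@le_trans _ _ (\sum_(j < d) (2 * rdot (J (Some j)) (J (Some j)) +
    2 * (rot_coef j x ^+ 2 * rdot (J None) (J None))))).
  by apply: ler_sum => j _; exact: (rdot_shift_le _ _ _).2.
rewrite big_split/= -!mulr_sumr lerD2l -mulr_suml -mulrA ler_wpM2l// ler_wpM2r ?rdot_ge0//.
exact: le_trans (rot_coef_le x) (sqnorm_le Dx).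
Qed.

Local Notation h := (int_form (@h_form R d)).
Local Notation vip := (int_form (@v_form R d)).
Local Notation a := (int_form a_form).
Local Notation q := (@quartic R d D).

Let pv := v_form_pointwise oD DM.
Let ph := h_form_pointwise oD DM.

Lemma a_coercive f : 2^-1 * vip f f <= a f f.
Proof. by have := int_form_le oD f pv a_form_pointwise ph a_form_ge; lra. Qed.

Lemma a_symform : symform (H10_add oD DM) (H10_sc oD DM) a.
Proof.
apply: int_form_symform; first exact: a_form_pointwise.
by apply: filterS a_form_ge => x hx Dx J; have := hx Dx J; have := v_form_ge0 x J; lra.
Qed.

Definition poincare_const : R := 16 * M ^+ 2.

Definition a_const : R := 2 + (2 * rot_bound + (K + rot_bound)) * poincare_const.

Definition quartic_const : R := 2 * (32 * M ^+ 2 + 16 * M).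

Lemma poincare_const_ge0 : 0 <= poincare_const.
Proof. by rewrite mulr_ge0// exprn_ge0. Qed.

Lemma a_const_ge0 : 0 <= a_const.
Proof.
have Q0 := rot_bound_ge0.
by rewrite /a_const addr_ge0// mulr_ge0 ?poincare_const_ge0// !addr_ge0// mulr_ge0.
Qed.

Lemma quartic_const_ge0 : 0 <= quartic_const.
Proof. by rewrite mulr_ge0// addr_ge0// mulr_ge0// exprn_ge0. Qed.

Lemma a_bounded f : a f f <= a_const * vip f f.
Proof.
apply: le_trans (int_form_le oD f a_form_pointwise pv ph a_form_le) _.
have c0 : 0 <= 2 * rot_bound + (K + rot_bound) by have := rot_bound_ge0 => Q0; rewrite !addr_ge0// mulr_ge0.
have := ler_wpM2l c0 (H10_poincare oD DM M_ge0 hd f); rewrite -/poincare_const /a_const.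
by move: (2 * rot_bound + _) => c; lra.
Qed.

Lemma expr4 (t : R) : t ^+ 4 = t ^+ 2 * t ^+ 2.
Proof. by rewrite -exprD. Qed.

Lemma energy_form f : energy D W Omega kappa (sval f) = E_form a q kappa f.
Proof.
rewrite /energy /E_form.
have -> : \int[mu]_(x in D) (\sum_(j < d) cmod (grad_R D Omega (sval f) j x) ^+ 2 +
    W_R W Omega x * cmod (sval f x) ^+ 2 + kappa / 2 * cmod (sval f x) ^+ 4) =
    1 * a f f + kappa / 2 * q f f f f.
  have L := rdot_L2 oD DM M_ge0 hd f f.
  rewrite -I_lin//; [|exact: pf_intg a_form_pointwise _ _|exact: (L2_mul mD L L)].
  apply: eq_Rintegral => x _; rewrite mul1r /a_form expr4 !cmod_sqr /=; congr (_ + _ + _).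
  by apply: eq_bigr => j _; rewrite cmod_sqr.
by field.
Qed.

Lemma Re_addZ (z z' : R[i]) (c : R) : complex.Re (z + c%:C%C * z') = complex.Re z + c * complex.Re z'.
Proof. by case: z z' => [s t] [s' t'] /=; ring. Qed.

Lemma Re_subZ (z z' : R[i]) (c : R) : complex.Re (z - c%:C%C * z') = complex.Re z - c * complex.Re z'.
Proof. by case: z z' => [s t] [s' t'] /=; ring. Qed.

Lemma Re_linear_part f g : complex.Re (linear_part D W Omega (sval f) (sval g)) = a f g.
Proof.
apply: eq_Rintegral => x _; rewrite -(mulrA (W_R W Omega x)%:C%C) Re_addZ Re_sum Re_mul_conj; congr (_ + _).
by apply: eq_bigr => j _; rewrite Re_mul_conj.
Qed.

Lemma Hnorm_sqr f : Hnorm D (sval f) ^+ 2 = h f f.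
Proof.
by rewrite /Hnorm sqr_sqrtr Hinner_form// (sf_ge0 (Hinner_symform oD DM)).
Qed.

Lemma Re_cubic f f' g :
  complex.Re (Cintegral D (fun x => (cmod (sval f x) ^+ 2)%:C%C * sval f' x * ((sval g x)^*)%C)) = q f f f' g.
Proof.
apply: eq_Rintegral => x _; rewrite -mulrA.
by rewrite -[X in complex.Re X]add0r Re_addZ add0r Re_mul_conj cmod_sqr.
Qed.

Lemma GP_operator_form f g : h f f = 1 -> GP_operator D W Omega kappa (sval f) (sval g) = A_gen a q kappa f g.
Proof.
move=> hf; rewrite /GP_operator /A_form Hnorm_sqr hf Re_addZ Re_linear_part Re_cubic.
by rewrite divr1.
Qed.

(** One of the two copies of z' conj z joins z conj z' to form the real factor 2 Re(z conj z'). *)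
Lemma Re_jacobian (z z' w : R[i]) :
  complex.Re ((z * (z'^*)%C + 2%:R * z' * (z^*)%C) * z * (w^*)%C) =
  2 * (rdot z z' * rdot z w) + rdot z z * rdot z' w.
Proof.
case: z z' w => [x y] [x' y'] [s t]; rewrite /rdot/part (_ : 2%:R = (2%:R +i* 0)%C :> R[i])/=.
  by ring.
by rewrite -[2%:R](rmorph_nat (real_complex R)).
Qed.

Lemma J_sigma_form (sigma : R) f f' g : h f f = 1 ->
  J_sigma D W Omega kappa sigma (sval f) (sval f') (sval g) = J_gen h a q kappa sigma f f' g.
Proof.
move=> hf; rewrite /J_sigma /J_form Re_subZ Re_addZ Re_linear_part Re_cubic.
rewrite expr4 Hnorm_sqr hf mulr1 !divr1 !Hinner_form.
have -> : complex.Re (Cintegral D (fun x => (sval f x * ((sval f' x)^*)%C +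
    2%:R * sval f' x * ((sval f x)^*)%C) * sval f x * ((sval g x)^*)%C)) =
    2 * q f f' f g + 1 * q f f f' g.
  have L := rdot_L2 oD DM M_ge0 hd.
  rewrite -I_lin//; [|by apply: (L2_mul mD); exact: L..].
  by apply: eq_Rintegral => x _; rewrite Re_jacobian mul1r.
by rewrite /J_gen /N_gen; ring.
Qed.

End rotating_forms.

(** * The iteration *)

Section iteration.
Context {R : realType} {d : nat}.
Local Notation Rd := 'rV[R]_d.
Local Notation Cfun := ('rV[R]_d -> R[i]).
Local Notation mu := (@lebesgue_rV R d).
Variables (D : set Rd) (oD : open D) (M : R) (DM : forall x, D x -> `|x| <= M).
Hypotheses (M_ge0 : 0 <= M) (hd : d = 2%N \/ d = 3%N).
Variables (W : Rd -> R) (Omega kappa K : R) (mW : measurable_fun D W).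
Hypotheses (K_ge0 : 0 <= K) (kappa_ge0 : 0 <= kappa).
Hypothesis W_le : {ae mu, forall x, D x -> `|W x| <= K}.
Hypothesis W_ge : {ae mu, forall x, D x -> Omega ^+ 2 * sqnorm x <= W x}.
Let mD : measurable D := open_measurable_rV oD.
Local Notation T := (H10 D).
Local Notation add := (H10_add oD DM).
Local Notation sc := (H10_sc oD DM).
Local Notation h := (int_form (D := D) (@h_form R d)).
Local Notation vip := (int_form (D := D) (@v_form R d)).
Local Notation a := (int_form (D := D) (a_form W Omega)).
Local Notation q := (@quartic R d D).
Local Notation E := (E_form a q kappa).
Implicit Types (f g s : T) (F : Cfun -> R).

Let vS : symform add sc vip := Vinner_symform oD DM.
Let hS : symform add sc h := Hinner_symform oD DM.
Let aS : symform add sc a := a_symform oD DM M_ge0 hd mW W_le W_ge.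
Let vc : complete_for add sc vip := @Vinner_complete _ _ _ oD M DM M_ge0 hd.
Let h_le f : h f f <= poincare_const M * vip f f := H10_poincare oD DM M_ge0 hd f.
Let a_ge f : 2^-1 * vip f f <= a f f := a_coercive oD DM M_ge0 hd mW W_le W_ge f.
Let a_le := a_bounded oD DM M_ge0 hd Omega mW K_ge0 W_le.
Let cq : 0 <= quartic_const M := quartic_const_ge0 M_ge0.
Let cp : 0 <= poincare_const M := poincare_const_ge0 M_ge0.
Let ca := a_const_ge0 (d := d) M_ge0 Omega K_ge0.
Let qL := quartic_lin oD DM M_ge0 hd.
Let qC := @quarticC R d D.
Let qS := @quarticS R d D.
Let q0 := @quartic_ge0 R d D.
Let qcs := quartic_cs oD DM M_ge0 hd.
Let qsw := quartic_swap oD DM M_ge0 hd.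
Let qle f : q f f f f <= quartic_const M * vip f f ^+ 2 := quartic_le oD DM M_ge0 hd f.

Lemma Vnorm_form f : Vnorm D (sval f) = Num.sqrt (vip f f).
Proof. by rewrite /Vnorm Vinner_form. Qed.

Lemma Vnorm_sqr f : Vnorm D (sval f) ^+ 2 = vip f f.
Proof. by rewrite Vnorm_form sqr_sqrtr// (sf_ge0 vS). Qed.

Lemma H10dual_linfun F : H10dual D F -> linfun_on add sc (fun f => F (sval f)) /\
  exists C : R, forall f, `|F (sval f)| <= C * Num.sqrt (vip f f).
Proof.
move=> [Fl [C hC]]; split; last first.
  by exists C => f; rewrite -Vnorm_form; apply: hC; exact: svalP.
split=> [f g|c f] /=.
  rewrite -[F (sval f)]mul1r -(Fl 1); [|exact: svalP..].
  by congr F; apply/funext => x; rewrite mul1r.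
rewrite scale_lin Fl; [|exact: svalP..].
ring.
Qed.

Lemma linfun_H10dual F (G : T -> R) : (forall f, F (sval f) = G f) -> linfun_on add sc G ->
  (exists C : R, forall f, `|G f| <= C * Num.sqrt (vip f f)) -> H10dual D F.
Proof.
move=> FG lG [C hC]; split=> [c v w Hv Hw|].
  pose f : T := exist _ v Hv; pose g : T := exist _ w Hw.
  by rewrite -[F v]/(F (sval f)) -[F w]/(F (sval g)) !FG -(linZ lG) -(linD lG) -FG.
exists C => v Hv; pose f : T := exist _ v Hv.
by rewrite -[v]/(sval f) FG Vnorm_form.
Qed.

Lemma Hinner_dual f : H10dual D (Hinner D (sval f)).
Proof.
apply: (linfun_H10dual (G := h f)) => [g||]; first exact: Hinner_form.
  by split=> *; rewrite ?(sfDr hS) ?(sfZr hS).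
by exists (poincare_const M * Num.sqrt (vip f f)) => g; exact: (sf_bound f g vS cp hS h_le).
Qed.

Lemma Hnorm1 f : h f f = 1 <-> Hnorm D (sval f) = 1.
Proof.
split=> [hf|Hf]; first by rewrite /Hnorm Hinner_form hf sqrtr1.
by rewrite -(Hnorm_sqr oD DM) Hf expr1n.
Qed.

(** * One step of the method at a vector of unit norm *)

Section unit_vector.
Variables (e0 sigma : R) (f : T).
Hypotheses (hf : h f f = 1) (Ef : E f <= e0) (hs : 4 / 3 * e0 <= sigma).
Local Notation J := (J_gen h a q kappa sigma f).

Let JE f' g : J_sigma D W Omega kappa sigma (sval f) (sval f') (sval g) = J f' g.
Proof. exact: (J_sigma_form oD DM M_ge0 hd). Qed.

Let Jge := J_gen_coercive_vip hS aS kappa_ge0 a_ge q0 qcs qsw hf Ef hs.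

Lemma J_sigma_invertible : invertible D (J_sigma D W Omega kappa sigma (sval f)).
Proof.
split.
- move=> v Hv; apply: (linfun_H10dual (G := J (exist _ v Hv))) => [g||].
  + by rewrite -JE.
  + exact: (J_gen_lin kappa hS aS qL qC qS).
  + exact: (J_gen_bound vS hS aS kappa_ge0 h_le a_le cq cp ca q0 qcs qsw qle).
- move=> F /H10dual_linfun[lF bF].
  have [s Js] := J_gen_onto vS hS aS vc kappa_ge0 h_le a_ge a_le cq cp ca qL qC qS q0 qcs qsw qle hf Ef hs lF bF.
  exists (sval s); split; first exact: svalP.
  move=> w Hw; pose g : T := exist _ w Hw.
  by rewrite -[w]/(sval g) JE Js.
- move=> v v' Hv Hv' vv'; pose g : T := exist _ v Hv; pose g' : T := exist _ v' Hv'.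
  pose p : T := add g (sc (-1) g').
  have Jp w : J p w = 0.
    have lJ := J_gen_linl kappa hS aS qL qC qS sigma f w.
    have e : J g w = J g' w.
      exact: etrans (esym (JE g w)) (etrans (vv' _ (svalP w)) (JE g' w)).
    by rewrite (linD lJ) (linZ lJ) e; ring.
  (* Coercivity yields only zero Dirichlet length; boundedness of [h] by [vip] turns it into zero
     L^2 length, hence equality almost everywhere. *)
  have vp : vip p p = 0.
    by have := Jge p; have := sf_ge0 vS p; rewrite Jp; lra.
  have [_ [_ hp]] := vip_null vS hS aS kappa_ge0 h_le a_le cq cp ca q0 qcs qsw qle sigma f vp.
  have : {ae mu, forall x, D x -> rdot (sval p x) (sval p x) = 0}.
    apply: (I_eq0_ae mD); [|by move=> x _; exact: rdot_ge0|exact: (hp p)].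
    exact: (pf_intg (h_form_pointwise oD DM) p p).
  apply: filterS => x h0 Dx; have := h0 Dx; rewrite /= /rdot/part/=.
  case: (v x) (v' x) => [s t] [s' t'] /= e.
  have /eqP := e; rewrite paddr_eq0 -?expr2 ?sqr_ge0// !sqrf_eq0 => /andP[/eqP e1 /eqP e2].
  by congr (_ +i* _)%C; lra.
(* Coercivity with constant 1/2 gives V^2 / 2 <= N V, where V is the norm of v. *)
- exists 2 => v N Hv N0 hN; pose g : T := exist _ v Hv.
  have := hN _ Hv; rewrite -[v]/(sval g) JE => {}hN.
  have := Jge g; rewrite -Vnorm_sqr => Jg.
  have V0 : 0 <= Vnorm D (sval g) by exact: sqrtr_ge0.
  have {}hN := le_trans (ler_norm _) hN.
  move: V0; rewrite le_eqVlt => /predU1P[<-|V0]; first by rewrite mulr_ge0.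
  rewrite -(ler_pM2r V0); nra.
Qed.

(** Surjectivity shows that the set from which [xget] chooses is inhabited, so its default value is
    not taken. *)
Lemma J_solution_spec : exists2 s, sval s = J_solution D W Omega kappa sigma (sval f) &
  forall w, J s w = h f w.
Proof.
have [_ onto _ _] := J_sigma_invertible.
have [Hs hJ] := @xgetPex _ (fun=> 0) [set v | solves D (J_sigma D W Omega kappa sigma (sval f)) (Hinner D (sval f)) v]
  (onto _ (Hinner_dual f)).
move: Hs hJ; set v := xget _ _ => Hs hJ; pose s : T := exist _ v Hs.
exists s => [//|w]; have e : J_sigma D W Omega kappa sigma (sval f) v (sval w) = J s w := JE s w.
by rewrite -e (hJ _ (svalP w)) Hinner_form.
Qed.

Lemma A_gen_dual : H10dual D (fun w => GP_operator D W Omega kappa (sval f) w).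
Proof.
apply: (linfun_H10dual (G := A_gen a q kappa f)) => [g||].
- exact: (GP_operator_form oD DM).
- exact: (A_gen_lin kappa aS qL qC qS).
- exact: (A_gen_bound vS aS kappa_ge0 a_le cq ca q0 qcs qsw qle).
Qed.

Lemma eigenstateP : eigenstate D W Omega kappa (sval f) <->
  exists lambda, forall w, A_gen a q kappa f w = lambda * h f w.
Proof.
split=> -[l hl]; exists l => w.
  by rewrite -Hinner_form -(hl _ (svalP w)) (GP_operator_form oD DM).
move=> Hw; pose g : T := exist _ w Hw.
by rewrite -[w]/(sval g) (GP_operator_form oD DM)// hl Hinner_form.
Qed.

Lemma energy_expansion : exists2 C : R, 0 <= C & forall w,
  `|energy D W Omega kappa (sval f + sval w) - energy D W Omega kappa (sval f) - A_gen a q kappa f w| <=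
    C * (Vnorm D (sval w) ^+ 2 + Vnorm D (sval w) ^+ 4).
Proof.
have [C C0 hC] := E_form_derivative vS aS kappa_ge0 a_le cq ca qL qC qS q0 qcs qsw qle f.
exists C => // w; rewrite -[sval f + sval w]/(sval (add f w)).
rewrite !(energy_form oD DM M_ge0 hd Omega kappa mW W_le) (expr4 (Vnorm _ _)) Vnorm_sqr -expr2.
exact: hC.
Qed.

Lemma energy_derivative : H10derivative D (energy D W Omega kappa) (sval f) (GP_operator D W Omega kappa (sval f)).
Proof.
split; first exact: A_gen_dual.
move=> e e_gt0; have [C C0 hC] := energy_expansion.
have c0 : 0 < 2 * C + 1 by lra.
exists (Num.min 1 (e / (2 * C + 1))); first by rewrite lt_min ltr01 divr_gt0.
move=> v Hv; rewrite lt_min => /andP[v1 ve]; pose w : T := exist _ v Hv.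
rewrite -[v]/(sval w) in v1 ve *; rewrite (GP_operator_form oD DM)//.
apply: le_trans (hC w) _.
have V0 : 0 <= Vnorm D (sval w) by exact: sqrtr_ge0.
move: v1 ve V0; rewrite ltr_pdivlMr//; move: (Vnorm _ _) => t t1 te t0.
have t2 : t ^+ 4 <= t ^+ 2 by rewrite ler_wiXn2l// ltW.
apply: (@le_trans _ _ (C * (2 * t ^+ 2))); first by rewrite ler_wpM2l//; lra.
rewrite expr2; have := mulr_ge0 t0 (ltW e_gt0); nra.
Qed.

(** Both expansions hold along t w for small t; dividing by t leaves an arbitrarily small difference
    between the two linear forms. *)
Lemma derivative_uniq F : H10derivative D (energy D W Omega kappa) (sval f) F ->
  forall w, F (sval w) = A_gen a q kappa f w.
Proof.
move=> [dF hF] w; have [lF _] := H10dual_linfun dF.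
have [C C0 hC] := energy_expansion.
have lA := A_gen_lin kappa aS qL qC qS f.
pose z := F (sval w) - A_gen a q kappa f w; suff z0 : z = 0 by apply/eqP; rewrite -subr_eq0 -/z z0.
set V := Vnorm D (sval w); have V0 : 0 <= V by exact: sqrtr_ge0.
suff zV (e : R) : 0 < e -> `|z| <= e * V + e * (C * (V ^+ 2 + V ^+ 4)).
  apply/eqP; rewrite -normr_eq0 eq_le normr_ge0 andbT; apply/ler_addgt0Pl => e e_gt0; rewrite addr0.
  pose S := V + C * (V ^+ 2 + V ^+ 4) + 1.
  have S0 : 0 < S.
    by rewrite ltr_wpDl// addr_ge0// mulr_ge0// addr_ge0// exprn_ge0.
  have := zV (e / S) (divr_gt0 e_gt0 S0); rewrite -mulrDr => h0; apply: le_trans h0 _.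
  by rewrite mulrAC ler_pdivrMr// ler_wpM2l ?(ltW e_gt0)// /S lerDl.
move=> e_gt0; have [r r0 hr] := hF e e_gt0.
(* The bound 1 compares t^4 with t^2, the bound e makes the quadratic remainder small, and r / (2 (V
   + 1)) keeps the norm of t w below r. *)
pose t := Num.min (Num.min 1 e) (r / (V + 1) / 2).
have V1 : 0 < V + 1 by lra.
have t0 : 0 < t by rewrite !lt_min ltr01 e_gt0 !divr_gt0.
have t1 : t <= 1 by rewrite !ge_min lexx.
have te : t <= e by rewrite !ge_min lexx orbT.
have tr : t * V < r.
  apply: (@le_lt_trans _ _ (r / (V + 1) / 2 * V)).
    by rewrite ler_wpM2r// !ge_min lexx orbT.
  have : r / (V + 1) * V <= r by rewrite mulrAC ler_pdivrMr// ler_wpM2l ?(ltW r0)//; lra.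
  lra.
have Vt : Vnorm D (sval (sc t w)) = t * V.
  rewrite Vnorm_form (sfZl vS) (sfZr vS) mulrA -expr2 sqrtrM ?sqr_ge0//.
  by rewrite sqrtr_sqr ger0_norm ?(ltW t0)// -Vnorm_form.
have k1 := hr _ (svalP (sc t w)); rewrite Vt in k1.
have {}k1 := k1 tr; have k2 := hC (sc t w); rewrite Vt in k2.
rewrite (linZ lF) in k1; rewrite (linZ lA) in k2.
have k3 : `|t * z| <= e * (t * V) + C * ((t * V) ^+ 2 + (t * V) ^+ 4).
  apply: le_trans (lerD k1 k2); rewrite /z mulrBr [X in _ <= X + _]distrC.
  exact: ler_distD.
rewrite -(ler_pM2l t0) -{1}(ger0_norm (ltW t0)) -normrM; apply: le_trans k3 _.
rewrite [X in _ <= X]mulrDr [e * (t * V)]mulrCA lerD2l !exprMn.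
have t24 : t ^+ 4 <= t ^+ 2 by rewrite ler_wiXn2l// ltW.
have V4 : 0 <= V ^+ 4 by rewrite exprn_ge0.
have V2 : 0 <= V ^+ 2 by rewrite exprn_ge0.
apply: (@le_trans _ _ (t ^+ 2 * (C * (V ^+ 2 + V ^+ 4)))).
  by rewrite [leRHS]mulrCA ler_wpM2l// [leRHS]mulrDr lerD2l ler_wpM2r.
have : 0 <= C * (V ^+ 2 + V ^+ 4) by rewrite mulr_ge0// addr_ge0.
move: (C * _) => x x0; rewrite expr2 -!mulrA ler_wpM2l ?(ltW t0)// ler_wpM2r//.
Qed.

(** Projecting w to the tangent vector w - h(f,w) f gives the eigenvalue A(f, f). Conversely the
    derivative of the energy at a unit vector is the operator itself. *)
Lemma critical_point_eigenstate :
  critical_point D W Omega kappa (sval f) <-> eigenstate D W Omega kappa (sval f).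
Proof.
split.
  move=> [_ _ [F dF F0]]; have [lF _] := H10dual_linfun dF.1.
  apply/eigenstateP; exists (A_gen a q kappa f f) => w.
  have FA := derivative_uniq dF.
  have := F0 _ (svalP (add w (sc (- h f w) f))).
  rewrite Hinner_form (sfDr hS) (sfZr hS) hf mulr1 subrr => /(_ erefl).
  by rewrite (linD lF) (linZ lF) !FA; lra.
move=> [l hl]; split; [exact: svalP|exact/Hnorm1|].
exists (GP_operator D W Omega kappa (sval f)); first exact: energy_derivative.
by move=> v Hv fv; rewrite hl// fv mulr0.
Qed.

Variables (taus tau : R) (htau : 0 < tau <= taus).
Hypothesis descent : forall (sigma tau : R) f s, h f f = 1 -> E f <= e0 -> 4 / 3 * e0 <= sigma ->
  0 < tau <= taus -> (forall w, J_gen h a q kappa sigma f s w = h f w) ->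
  let x := affine_step add sc tau (h s f)^-1 f s in
  [/\ 1 <= h x x,
      E (sc (Num.sqrt (h x x))^-1 x) <= E f &
      E f <= E (sc (Num.sqrt (h x x))^-1 x) ->
        exists lambda, forall w, A_gen a q kappa f w = lambda * h f w].

(** The threshold [taus] enters as a hypothesis valid for all admissible [sigma], all unit vectors
    below the energy level and all steps, so that one choice made from the initial energy serves the
    whole iteration. *)
Lemma J_step_spec : exists f', [/\ sval f' = J_step D W Omega kappa sigma tau (sval f),
  h f' f' = 1, E f' <= E f,
  E f <= E f' -> eigenstate D W Omega kappa (sval f) &
  step_wellposed D W Omega kappa sigma tau (sval f)].
Proof.
have [s es Js] := J_solution_spec.
have := descent hf Ef hs htau Js; set x := affine_step _ _ _ _ _ _ => -[x1 Ex xeig].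
have ex : sval x = J_unnormalized D W Omega kappa sigma tau (sval f).
  apply/funext => y; rewrite /= /J_unnormalized /J_gamma -es.
  by rewrite -(Hinner_form s f).
have xn : Hnorm D (sval x) = Num.sqrt (h x x) by rewrite /Hnorm Hinner_form.
have x0 : 0 < h x x by exact: lt_le_trans x1.
exists (sc (Num.sqrt (h x x))^-1 x); split => //.
- by apply/funext => y; rewrite /= /J_step -ex xn.
- by rewrite (sfZl hS) (sfZr hS) mulrA -expr2 exprVn sqr_sqrtr ?(ltW x0)// mulVf// gt_eqF.
- by move=> /xeig ?; exact/eigenstateP.
- split.
  + exact: svalP.
  + by rewrite (Hnorm1 f).1// oner_neq0.
  + exact: J_sigma_invertible.
  + rewrite -es Hinner_form.
    exact: (J_gen_solution_neq0 vS hS aS kappa_ge0 h_le a_ge a_le cq cp ca q0 qcs qsw qle hf Ef hs Js).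
  + by rewrite -ex xn sqrtr_eq0 -ltNge.
Qed.

End unit_vector.

Lemma J_method_energy_diminishing (u0 : Cfun) : H10space D u0 -> Hnorm D u0 = 1 ->
  exists tau_star : R, 0 < tau_star /\
    forall (sigma : R) (tau : nat -> R),
      4%:R / 3%:R * energy D W Omega kappa u0 <= sigma ->
      (forall n, 0 < tau n <= tau_star) ->
      let u := J_method D W Omega kappa sigma tau u0 in
      let E := energy D W Omega kappa in
      forall n : nat,
        [/\ step_wellposed D W Omega kappa sigma (tau n) (u n),
            E (u n.+1) <= E (u n) <= E u0,
            critical_point D W Omega kappa (u n) <->
              eigenstate D W Omega kappa (u n) &
            ~ critical_point D W Omega kappa (u n) -> E (u n.+1) < E (u n)].
Proof.
move=> Hu0 u01; pose f0 : T := exist _ u0 Hu0.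
have EE g : energy D W Omega kappa (sval g) = E g := energy_form oD DM M_ge0 hd Omega kappa mW W_le g.
have h0 : h f0 f0 = 1 by exact/Hnorm1.
have e00 : 0 <= E f0 := e0_ge0 aS kappa_ge0 q0 (lexx (E f0)).
have [taus taus0 descent] :=
  J_step_descent vS hS aS kappa_ge0 h_le a_ge a_le cq cp ca qL qC qS q0 qcs qsw qle e00.
exists taus; split; first exact: taus0.
move=> sigma tau hs0 ht u En n.
have hs : 4 / 3 * E f0 <= sigma by rewrite -(EE f0).
have step m f : sval f = u m -> h f f = 1 -> E f <= E f0 ->
    exists f', [/\ sval f' = u m.+1, h f' f' = 1, E f' <= E f,
      E f <= E f' -> eigenstate D W Omega kappa (sval f) &
      step_wellposed D W Omega kappa sigma (tau m) (sval f)].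
  move=> fu hf Ef; have [f' [e1 e2 e3 e4 e5]] := J_step_spec hf Ef hs (ht m) descent.
  by exists f'; split => //; rewrite e1 fu.
(* Invariant: unit norm and energy at most E(u0), so that the threshold and the condition on
   [sigma], both fixed by E(u0), stay valid. *)
have [f [fu hf Ef]] : exists f, [/\ sval f = u n, h f f = 1 & E f <= E f0].
  elim: n => [|n [f [fu hf Ef]]]; first by exists f0.
  have [f' [e1 e2 e3 _ _]] := step n f fu hf Ef.
  by exists f'; split => //; exact: le_trans Ef.
have [f' [e1 e2 e3 e4 e5]] := step n f fu hf Ef.
have ce := critical_point_eigenstate hf.
have En1 : En (u n.+1) = E f' by rewrite -e1; exact: EE.
have Enn : En (u n) = E f by rewrite -fu; exact: EE.
have En0 : En u0 = E f0 := EE f0.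
rewrite En1 Enn En0 -fu; split; [exact: e5|by rewrite e3|exact: ce|].
by move=> nc; rewrite ltNge; apply/negP => /e4 eig; apply: nc; exact/ce.
Qed.

End iteration.

Theorem theorem5p3 (R : realType) (d : nat) (hd : d = 2%N \/ d = 3%N)
  (D : set 'rV[R]_d)
  (D_neq0 : D !=set0) (D_open : open D) (D_connected : connected D)
  (D_bounded : bounded_set D)
  (W : 'rV[R]_d -> R) (Omega kappa : R)
  (W_measurable : measurable_fun D W)
  (W_bounded : exists M : R, \forall x \ae lebesgue_rV d, D x -> `|W x| <= M)
  (W_ge0 : \forall x \ae lebesgue_rV d, D x -> 0 <= W x)
  (kappa_ge0 : 0 <= kappa)
  (W_ge : \forall x \ae lebesgue_rV d, D x -> Omega ^+ 2 * sqnorm x <= W x)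
  (u0 : 'rV[R]_d -> R[i]) (u0_V : H10space D u0) (u0_norm : Hnorm D u0 = 1) :
  exists tau_star : R, 0 < tau_star /\
    forall (sigma : R) (tau : nat -> R),
      4%:R / 3%:R * energy D W Omega kappa u0 <= sigma ->
      (forall n, 0 < tau n <= tau_star) ->
      let u := J_method D W Omega kappa sigma tau u0 in
      let E := energy D W Omega kappa in
      forall n : nat,
        [/\ step_wellposed D W Omega kappa sigma (tau n) (u n),
            E (u n.+1) <= E (u n) <= E u0,
            critical_point D W Omega kappa (u n) <->
              eigenstate D W Omega kappa (u n) &
            ~ critical_point D W Omega kappa (u n) -> E (u n.+1) < E (u n)].
Proof.
have [N [_ hN]] := D_bounded.
(* [bounded_set] bounds the norm on D by every number above N; the absolute value also makes M
   nonnegative. *)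
pose M := `|N| + 1.
have DM x : D x -> `|x| <= M by move=> Dx; apply: (hN M) => //; rewrite /M; have := ler_norm N; lra.
have M0 : 0 <= M by rewrite addr_ge0.
have [K hK] := W_bounded.
have W_le : \forall x \ae lebesgue_rV d, D x -> `|W x| <= `|K|.
  by apply: filterS hK => x h /h hx; exact: le_trans (ler_norm K).
exact: (J_method_energy_diminishing D_open DM M0 hd W_measurable (normr_ge0 K) kappa_ge0 W_le W_ge).
Qed.
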